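(* Let $\tau_0>0$ and let $(U_1(\tau),U_2(\tau),U_3(\tau))$ be the process defined by $$dU_1(\tau) = -2\,\mathrm{sign}(U_1(\tau))\,d\tau + \eta(\tau_0-\tau)\sqrt{2}\,dW(\tau),\qquad dU_2(\tau)=U_1(\tau)\,d\tau,\qquad dU_3(\tau)=|U_1(\tau)|\,d\tau,$$ with $U_1(0)=U_2(0)=U_3(0)=0$. Denote by $\bar u_j(\tau)=\mathbb{E}[U_j(\tau)]$ and $\sigma^2_{U_j}(\tau)=\mathrm{Var}(U_j(\tau))$, $j=1,2,3$, the means and variances. Then for $0\le \tau\le\tau_0$: $$\bar u_1(\tau)=0,\qquad \bar u_2(\tau)=0,$$ $$\bar u_3(\tau) = \frac18\left[2(1+2\tau)\sqrt{\frac{\tau}{\pi}}\,e^{-\tau} - 4\tau^2\,\mathrm{Erfc}(\sqrt{\tau}) + (4\tau-1)\,\mathrm{Erf}(\sqrt{\tau})\right],$$ $$\sigma^2_{U_1}(\tau) = \frac12\left[\mathrm{Erf}(\sqrt{\tau}) + 4\tau(\tau+1)\,\mathrm{Erfc}(\sqrt{\tau}) - 2(1+2\tau)\sqrt{\frac{\tau}{\pi}}\,e^{-\tau}\right],$$ $$\sigma^2_{U_2}(\tau) = \frac58\tau - \frac{27}{32} + e^{-\tau}\left[1-\sqrt{\frac{\tau}{\pi}}\left(\frac12\tau^3+\frac{7}{12}\tau^2-\frac{13}{24}\tau+\frac{5}{16}\right)\right] + \mathrm{Erfc}(\sqrt{\tau})\left(\frac12\tau^4+\frac56\tau^3-\frac12\tau^2+\frac38\tau-\frac{5}{32}\right),$$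 $$\sigma^2_{U_3}(\tau) = \frac14\tau^2+\frac18\tau-\frac{11}{32} + e^{-\tau}\left[\frac12-\sqrt{\frac{\tau}{\pi}}\left(\frac12\tau^3+\frac{7}{12}\tau^2-\frac{13}{24}\tau+\frac{5}{16}\right)\right] + \mathrm{Erfc}(\sqrt{\tau})\left(\frac12\tau^4+\frac56\tau^3-\frac12\tau^2+\frac38\tau-\frac{5}{32}\right) - \bar u_3(\tau)^2 .$$
   Context: $W$ is a standard one-dimensional Wiener process; $\eta$ is the Heaviside step function (so for $\tau\le\tau_0$ the noise coefficient is $\sqrt2$); $\mathrm{sign}(x)=1$ for $x>0$, $-1$ for $x<0$, and $\mathrm{sign}(0)=0$. $\mathrm{Erf}(x)=\frac{2}{\sqrt{\pi}}\int_0^x e^{-s^2}\,ds$ and $\mathrm{Erfc}(x)=1-\mathrm{Erf}(x)$. The process is the dimensionless form of the velocity $V$, displacement $U$ and traveled distance $S$ of a body sliding with dry friction on a randomly excited foundation, governed by $\dot V=-\mu g\,\mathrm{sign}(V)+\eta(t_0-t)h\xi(t)$, $\dot U=V$, $\dot S=|V|$ (with $\xi$ standard Gaussian white noise), under the scaling $U_1=\frac{\mu g}{h^2}V$, $U_2=\frac{\mu^3g^3}{2h^4}U$, $U_3=\frac{\mu^3g^3}{2h^4}S$, $\tau=\frac{\mu^2g^2}{2h^2}t$, $\tau_0=\frac{\mu^2g^2}{2h^2}t_0$. *)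

(* Defs.v *)
(* MathComp-Analysis; the reals are an arbitrary R : realType. *)
From mathcomp Require Import all_boot all_order all_algebra.
From mathcomp Require Import all_classical all_reals all_analysis.

Set Implicit Arguments.
Unset Strict Implicit.
Unset Printing Implicit Defensive.

Import Order.TTheory GRing.Theory Num.Theory.
Import numFieldNormedType.Exports.

Local Open Scope classical_set_scope.
Local Open Scope ring_scope.

(* Both summands are needed for all real x: the oriented integral from 0 to x
   is the first one if 0 <= x and the second one if x <= 0. *)
Definition Erf {R : realType} (x : R) : R :=
  2 / Num.sqrt pi *
  (\int[lebesgue_measure]_(s in `[0, x]) expR (- s ^+ 2)
   - \int[lebesgue_measure]_(s in `[x, 0]) expR (- s ^+ 2)).

Definition Erfc {R : realType} (x : R) : R := 1 - Erf x.

(* heaviside 0 = 1, so that s |-> heaviside (tau0 - s) is 1 on ]-oo, tau0]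
   and is left-continuous. *)
Definition heaviside {R : realType} (x : R) : R := (0 <= x)%R%:R.

Section processes.
Context {d : measure_display} {T : measurableType d} {R : realType}.
Variable P : probability T R.

(* Families are indexed by R, but only the times t >= 0 are meaningful. *)
Implicit Types (F : R -> set (set T)) (X W U M : R -> T -> R).

Definition filtration F :=
  [/\ forall t : R, 0 <= t -> sigma_algebra setT (F t),
      forall t : R, 0 <= t -> F t `<=` measurable &
      forall s t : R, 0 <= s -> s <= t -> F s `<=` F t].

Definition adapted F X :=
  forall t : R, 0 <= t -> forall B : set R, measurable B -> F t (X t @^-1` B).

Definition as_continuous X :=
  {ae P, forall w, {within `[0, +oo[, continuous (fun t => X t w)}}.

Record wiener_process F W : Prop := WienerProcess {
  wiener_adapted : adapted F W ;
  wiener_init : {ae P, forall w, W 0 w = 0} ;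
  wiener_continuous : as_continuous W ;
  (* the second parameter of normal_prob is the standard deviation *)
  wiener_gaussian : forall s t : R, 0 <= s -> s < t ->
    forall B : set R, measurable B ->
      P ((W t \- W s) @^-1` B) = normal_prob 0 (Num.sqrt (t - s)) B ;
  wiener_independent : forall s t : R, 0 <= s -> s < t ->
    forall (A : set T) (B : set R), F s A -> measurable B ->
      P (A `&` (W t \- W s) @^-1` B) = (P A * P ((W t \- W s)%R @^-1` B))%E }.

Definition cvg_in_probability (Xn : (T -> R)^nat) (X : T -> R) :=
  forall e : R, 0 < e ->
    (P [set w | e <= `|Xn n w - X w|] @[n --> \oo] --> 0%E).

Definition left_riemann_sum (f : R -> R) W (t : R) (n : nat) (w : T) : R :=
  \sum_(k < n.+1)
    f (t * k%:R / n.+1%:R) *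
    (W (t * k.+1%:R / n.+1%:R) w - W (t * k%:R / n.+1%:R) w).

(* I is a version of the stochastic integral of the deterministic integrand f
   against W over [0, t].  The characterisation by left-point sums over the
   uniform partitions is valid for locally bounded left-continuous f with right
   limits, which is the only kind of integrand used below. *)
Definition is_stochastic_integral (f : R -> R) W (t : R) (I : T -> R) :=
  measurable_fun setT I /\ cvg_in_probability (left_riemann_sum f W t) I.

(* dU = b(U) dt + f(t) dW *)
Definition solves_sde (b f : R -> R) W U :=
  exists M : R -> T -> R,
    (forall t : R, 0 <= t -> is_stochastic_integral f W t (M t)) /\
    {ae P, forall w, forall t : R, 0 <= t ->
      U t w = U 0 w + \int[lebesgue_measure]_(s in `[0, t]) b (U s w) + M t w}.

(* dV = g(U) dt *)
Definition solves_ode (g : R -> R) U V :=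
  {ae P, forall w, forall t : R, 0 <= t ->
    V t w = V 0 w + \int[lebesgue_measure]_(s in `[0, t]) g (U s w)}.

Record dry_friction_process (tau0 : R) F W (U1 U2 U3 : R -> T -> R) : Prop :=
  DryFrictionProcess {
  dry_friction_adapted : [/\ adapted F U1, adapted F U2 & adapted F U3] ;
  dry_friction_continuous : as_continuous U1 ;
  dry_friction_init : {ae P, forall w, [/\ U1 0 w = 0, U2 0 w = 0 & U3 0 w = 0]} ;
  (* Num.sg is the sign function with Num.sg 0 = 0 *)
  dry_friction_velocity :
    solves_sde (fun u => - 2 * Num.sg u)
               (fun s => heaviside (tau0 - s) * Num.sqrt 2) W U1 ;
  dry_friction_displacement : solves_ode id U1 U2 ;
  dry_friction_distance : solves_ode (fun u => `|u|) U1 U3 }.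

End processes.

(* Main.v *)
From HB Require Import structures.
Require Import Defs.
From mathcomp Require Import all_boot all_order all_algebra.
From mathcomp Require Import ring lra.
From mathcomp Require Import all_classical all_reals all_analysis.
From mathcomp Require Import measurable_realfun.

Set Implicit Arguments.
Unset Strict Implicit.
Unset Printing Implicit Defensive.

Import Order.TTheory GRing.Theory Num.Theory.
Import numFieldNormedType.Exports.

Local Open Scope classical_set_scope.
Local Open Scope ring_scope.

(** The proof is by duality. Fix a horizon t, let V be the displacement (g u = u) or
    the distance (g u = |u|), so that dV = g(U1) dt, and let L f = f'' - 2 sign f'
    be the generator of the velocity up to time tau0. The generator of (U1, V) maps
    quadratic polynomials in v with coefficients depending on u to polynomials of
    the same kind. Hence, if p is a constant and a(s, u), b(s, u) solve

      a_s = L a + 2 p g,    b_s = L b + g a,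

    then the mean of p V_r^2 + V_r a(t - r, U_r) + b(t - r, U_r) does not depend on
    r in [0, t]. At r = 0 it is b(t, 0), and at r = t it is the mean of
    p V_t^2 + V_t a(0, U_t) + b(0, U_t). The solutions with a(0, .) = b(0, .) = 0 are
    explicit combinations of the functions [erfc_block] and [heat_block], and
    b(t, 0) is then the second moment of V_t in closed form (p = 768 clears the
    denominators). With p = 0 and a constant the same identity gives the means of
    U2 and U3; with a = 4 and b = u^2 + 2 s it gives E U1^2 = 2 t - 4 E U3. The mean
    of U1 is recovered from that of U2, which vanishes at all times.

    The invariance of the mean is proved without stochastic calculus, by comparing
    the times r and r + h ([dual_step], [dual_mean_step]). Up to tau0 the noise is
    sqrt 2 times the Wiener process ([driving_noise]), so that the increment of the
    velocity is an independent Gaussian variable plus a drift of size at most 2 h. In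
    the second order expansion the terms of order sqrt h and h cancel in mean, by
    independence and by the equations. The remaining error is of order h^(3/2),
    except when the velocity is so small that the sign may change during the step;
    the probability of this event is controlled by a small ball estimate
    ([velocity_small_ball]), which makes the error o(h), uniformly away from r = 0.
    Adding up the steps gives [dual_mean_conserved]. Since a and b are not smooth at
    s = 0, the identity is obtained with t + 1 / (n + 1) in place of the horizon t
    and passes to the limit by dominated convergence ([terminal_identity]). *)

(** * Derivation rules and the error function *)

Section derivative_rules.
Context {R : realType}.
Implicit Types (f g : R -> R) (x df dg : R).

(** The rules are restated for functions in applied form, so that the derivative
    of an expression can be assembled along its syntax and compared with the
    expected one in a single algebraic step. *)
Lemma isd_eq f x df dg : is_derive x (1 : R) f df -> df = dg -> is_derive x 1 f dg.
Proof. by move=> h <-. Qed.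

Lemma isd_cst (c x : R) : is_derive x (1 : R) (fun=> c) 0.
Proof. exact: is_derive_cst. Qed.

Lemma isd_id x : is_derive x (1 : R) (fun y => y) 1.
Proof. exact: is_derive_id. Qed.

Lemma isd_add f g x df dg : is_derive x (1 : R) f df -> is_derive x 1 g dg ->
  is_derive x 1 (fun y => f y + g y) (df + dg).
Proof. exact: is_deriveD. Qed.

Lemma isd_opp f x df : is_derive x (1 : R) f df ->
  is_derive x 1 (fun y => - f y) (- df).
Proof. exact: is_deriveN. Qed.

Lemma isd_mul f g x df dg : is_derive x (1 : R) f df -> is_derive x 1 g dg ->
  is_derive x 1 (fun y => f y * g y) (df * g x + f x * dg).
Proof.
by move=> hf hg; apply: is_derive_eq; rewrite addrC /GRing.scale/= mulrC.
Qed.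

Lemma isd_scale (c : R) f x df : is_derive x (1 : R) f df ->
  is_derive x 1 (fun y => c * f y) (c * df).
Proof. exact: is_deriveZ. Qed.

Lemma isd_exprn f n x df : is_derive x (1 : R) f df ->
  is_derive x 1 (fun y => f y ^+ n) (n%:R * f x ^+ n.-1 * df).
Proof.
move=> hf; elim: n => [|n IH].
  by under eq_fun do rewrite expr0; rewrite !mul0r; exact: isd_cst.
under eq_fun do rewrite exprS.
apply: (is_derive_eq (isd_mul hf IH)) => /=.
by case: n {IH} => [|n] /=; rewrite ?expr0 -?natr1 ?exprS; ring.
Qed.

Lemma isd_comp f g x df dg : is_derive (g x) (1 : R) f df ->
  is_derive x (1 : R) g dg -> is_derive x 1 (fun y => f (g y)) (df * dg).
Proof. exact: is_derive1_comp. Qed.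

Lemma isd_expR f x df : is_derive x (1 : R) f df ->
  is_derive x 1 (fun y => expR (f y)) (expR (f x) * df).
Proof. by move=> hf; apply: isd_comp. Qed.

Lemma isd_inv f x df : f x != 0 -> is_derive x (1 : R) f df ->
  is_derive x 1 (fun y => (f y)^-1) (- (f x) ^- 2 * df).
Proof. move=> fx0 hf; exact: is_deriveV. Qed.

Lemma isd_sqrt x : 0 < x ->
  is_derive x 1 (@Num.sqrt R) (2 * Num.sqrt x)^-1.
Proof. exact: is_derive1_sqrt. Qed.

Lemma mvt_is_derive (f df : R -> R) (a b : R) : a <= b ->
  (forall x, a <= x <= b -> is_derive x 1 f (df x)) ->
  exists2 c, a <= c <= b & f b - f a = df c * (b - a).
Proof.
move=> ab fd; have [|c|c cab] := @MVT_segment _ f df a b ab.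
- by move=> x; rewrite in_itv/= => /andP[ax xb]; apply: fd; rewrite !ltW.
- apply: derivable_within_continuous => x; rewrite in_itv/= => xab.
  by have := fd x xab.
- by move=> E; exists c.
Qed.

Lemma ndecr_is_derive (f df : R -> R) (a b : R) : a <= b ->
  (forall x, a <= x <= b -> is_derive x 1 f (df x)) ->
  (forall x, a <= x <= b -> 0 <= df x) -> f a <= f b.
Proof.
move=> ab fd df0; have [c cab E] := mvt_is_derive ab fd.
by rewrite -subr_ge0 E mulr_ge0 ?subr_ge0// df0.
Qed.

End derivative_rules.

Section Erf_theory.
Context {R : realType}.
Local Notation mu := (@lebesgue_measure R).
Implicit Types x y : R.

Lemma integrable_gauss (A : set R) : measurable A ->
  mu.-integrable A (EFin \o @gauss_fun R).
Proof.
move=> mA; apply: (@integrableS _ _ _ _ setT) => //; exact: integrableT_gauss.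
Qed.

(* A primitive on the whole line, so that one formula covers both signs of x. *)
Let G x := \int[mu]_(s in `]-oo, x]) gauss_fun s.

Let GE x : Erf x = 2 / Num.sqrt pi * (G x - G 0).
Proof.
have H a b : a <= b -> \int[mu]_(s in `[a, b]) gauss_fun s = G b - G a.
  move=> ab; rewrite /G Rintegral_itvB//; last exact: integrable_gauss.
  rewrite Rintegral_itv_obnd_cbnd//; exact: integrable_gauss.
have E a b : b < a -> \int[mu]_(s in `[a, b]) gauss_fun s = 0.
  by move=> ab; rewrite set_itv_ge ?Rintegral_set0// bnd_simp -ltNge.
rewrite /Erf -/(gauss_fun _); congr (_ * _).
case: (ltgtP 0 x) => [x0|x0|<-].
- by rewrite (H 0 x (ltW x0)) (E x 0 x0) subr0.
- by rewrite (H x 0 (ltW x0)) (E 0 x x0) sub0r opprB.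
- by rewrite (H 0 0 (lexx _)) !subrr.
Qed.

Lemma is_derive_Erf x : is_derive x 1 (@Erf R) (2 / Num.sqrt pi * expR (- x ^+ 2)).
Proof.
have -> : @Erf R = (2 / Num.sqrt pi) *: (G - cst (G 0)).
  by apply/funext => y; rewrite GE.
have [dG GE'] : derivable G x 1 /\ (G^`())%classic x = gauss_fun x.
  apply: (@continuous_FTC1 R gauss_fun -oo%O x (x + 1)) => //.
  - by rewrite ltrDl.
  - exact: integrable_gauss.
  - by rewrite ltNyr.
  - by apply: continuous_gauss_fun.
have iG : is_derive x 1 G (expR (- x ^+ 2)).
  by apply: DeriveDef; [exact: dG|rewrite -derive1E GE'].
by apply: is_derive_eq; rewrite subr0.
Qed.

Lemma Erf0 : Erf (0 : R) = 0.
Proof. by rewrite GE subrr mulr0. Qed.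

Lemma gauss_cst_gt0 : 0 < 2 / Num.sqrt pi :> R.
Proof. by rewrite divr_gt0// sqrtr_gt0 pi_gt0. Qed.

Lemma le_Erf x y : x <= y -> Erf x <= Erf y.
Proof.
move=> xy; apply: (ndecr_is_derive xy (fun z _ => is_derive_Erf z)) => z _.
by rewrite mulr_ge0 ?expR_ge0// ltW// gauss_cst_gt0.
Qed.

Lemma ErfN x : Erf (- x) = - Erf x.
Proof.
have H z : is_derive (z : R) 1 (fun y : R => Erf (- y) + Erf y) 0.
  have dn : is_derive (z : R) 1 (fun y : R => Erf (- y)) (- (2 / Num.sqrt pi * expR (- z ^+ 2))).
    have := @is_derive1_comp _ (@Erf R) (-%R) z _ _ (is_derive_Erf (- z)) (is_deriveNid z 1).
    by rewrite sqrrN mulrN1.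
  have := is_deriveD dn (is_derive_Erf z).
  by rewrite addNr.
have [] := leP 0 x => [x0|/ltW x0].
  have [c _ ] := mvt_is_derive x0 (fun z _ => H z).
  by rewrite mul0r oppr0 Erf0 add0r subr0 => /eqP; rewrite addr_eq0 => /eqP.
have [c _ ] := mvt_is_derive x0 (fun z _ => H z).
by rewrite mul0r oppr0 Erf0 add0r sub0r => /eqP; rewrite oppr_eq0 addr_eq0 => /eqP.
Qed.

Lemma cvg_Erf : Erf x @[x --> +oo] --> (1 : R).
Proof.
have E : \forall x \near +oo, 2 / Num.sqrt pi *
    Num.sqrt ((@gauss_integral_proof.integral0_gauss R x) ^+ 2) = Erf x.
  near=> x; rewrite sqrtr_sqr ger0_norm ?gauss_integral_proof.integral0_gauss_ge0//.
  have x0 : 0 < x by near: x; exact: nbhs_pinfty_gt.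
  by rewrite /Erf (@set_itv_ge _ _ (BLeft x))// ?Rintegral_set0 ?subr0// bnd_simp -ltNge.
apply: cvg_trans; first exact: near_eq_cvg E.
have E1 : 2 / Num.sqrt pi * Num.sqrt (pi / 4) = 1 :> R.
  rewrite sqrtrM ?pi_ge0// sqrtrV// (_ : 4 = 2 ^+ 2); last by rewrite expr2 -natrM.
  rewrite sqrtr_sqr ger0_norm//.
  have : Num.sqrt (pi : R) != 0 by rewrite gt_eqF// sqrtr_gt0 pi_gt0.
  by move=> ?; field.
suff : 2 / Num.sqrt pi * Num.sqrt ((@gauss_integral_proof.integral0_gauss R x) ^+ 2)
    @[x --> +oo] --> 2 / Num.sqrt pi * Num.sqrt (pi / 4) by rewrite E1.
apply: cvgMr; apply: continuous_cvg; first exact: sqrt_continuous.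
exact: gauss_integral_proof.cvg_integral0_gauss_sqr.
Unshelve. all: end_near. Qed.

Lemma Erf_le1 x : Erf x <= 1.
Proof.
apply: (cvgr_to_ge cvg_Erf).
by near=> y; apply: le_Erf; near: y; apply: nbhs_pinfty_ge; rewrite num_real.
Unshelve. all: end_near. Qed.

Lemma Erfc_ge0 x : 0 <= Erfc x. Proof. by rewrite subr_ge0 Erf_le1. Qed.

Lemma Erfc_le2 x : Erfc x <= 2.
Proof. by rewrite /Erfc; have := Erf_le1 (- x); rewrite ErfN; lra. Qed.

(** The function t |-> Erf x + exp (- x^2) Erf t - Erf (x + t) vanishes at 0 and
    is nondecreasing for t >= 0, since (x + t)^2 >= x^2 + t^2; the bound is its
    limit as t tends to infinity. *)
Lemma Erfc_le_gauss x : 0 <= x -> Erfc x <= expR (- x ^+ 2).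
Proof.
move=> x0.
have H (r : R) : 0 <= r -> Erf (x + r) <= Erf x + expR (- x ^+ 2) * Erf r.
  move=> r0.
  pose f t := Erf x + expR (- x ^+ 2) * Erf t - Erf (x + t).
  have df (t : R) : is_derive t 1 f (expR (- x ^+ 2) * (2 / Num.sqrt pi * expR (- t ^+ 2))
                                - 2 / Num.sqrt pi * expR (- (x + t) ^+ 2)).
    have dx : is_derive t (1 : R) (fun t => x + t) 1.
      by have := isd_add (isd_cst x t) (isd_id t); rewrite add0r.
    have ds := isd_comp (is_derive_Erf (x + t)) dx.
    have d2 := isd_add (isd_cst (Erf x) t) (isd_scale (expR (- x ^+ 2)) (is_derive_Erf t)).
    by have := isd_add d2 (isd_opp ds); rewrite add0r mulr1.
  have : f 0 <= f r.
    apply: (ndecr_is_derive r0 (fun z _ => df z)) => z /andP[z0 _].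
    rewrite subr_ge0 mulrCA ler_pM2l ?gauss_cst_gt0// -expRD ler_expR; nra.
  by rewrite /f Erf0 mulr0 !addr0 subrr subr_ge0.
rewrite lerBlDr.
have L : Erf (x + r) @[r --> +oo%R] --> (1 : R).
  apply: (cvg_comp (fun r => x + r) (@Erf R)); last exact: cvg_Erf.
  exact: cvg_addrl.
apply: (cvgr_to_le L).
near=> r; have r0 : 0 <= r by near: r; apply: nbhs_pinfty_ge; rewrite num_real.
by rewrite (le_trans (H r r0))// addrC lerD2r ler_piMr ?expR_ge0// Erf_le1.
Unshelve. all: end_near. Qed.

End Erf_theory.

(** * Functions built from Erfc and the heat kernel *)

Section heat_blocks.
Context {R : realType}.
Implicit Types s x rho c : R.

(** For every rho this solves f_s = f_xx - 2 f_x, the backward equation of the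
    velocity on the half line where its drift is the constant - 2. *)
Definition erfc_block rho s x : R :=
  expR ((1 + rho) * x + (rho ^+ 2 - 1) * s) *
  (Erfc (x / (2 * Num.sqrt s) + rho * Num.sqrt s) / 2).

(** Half the density of a normal variable of mean 2 s and variance 2 s. It solves
    the same equation and is the term that the derivatives of all the blocks
    have in common. *)
Definition heat_block s x : R :=
  expR (- ((x - 2 * s) ^+ 2 / (4 * s))) / (4 * Num.sqrt (pi * s)).

Let sqrt_neq0 s : 0 < s -> Num.sqrt s != 0.
Proof. by move=> s0; rewrite gt_eqF// sqrtr_gt0. Qed.

(* Differentiating Erfc inside a block leaves a Gaussian factor; completing the
   square shows that it is the same kernel whatever rho. *)
Let gauss_heat rho s x : 0 < s ->
  expR ((1 + rho) * x + (rho ^+ 2 - 1) * s) *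
    (2 / Num.sqrt pi * expR (- (x / (2 * Num.sqrt s) + rho * Num.sqrt s) ^+ 2)) =
  8 * Num.sqrt s * heat_block s x.
Proof.
move=> s0; rewrite /heat_block sqrtrM ?pi_ge0//.
have := sqrt_neq0 s0; have : Num.sqrt (pi : R) != 0 by rewrite gt_eqF// sqrtr_gt0 pi_gt0.
move=> p0 q0.
rewrite mulrCA -expRD.
rewrite (_ : _ + - _ = - ((x - 2 * s) ^+ 2 / (4 * s))); last first.
  by move: (Num.sqrt s) (sqr_sqrtr (ltW s0)) q0 => q <- q0; field.
by field; rewrite ?p0 ?q0.
Qed.

Lemma der_erfc_block_x rho s x : 0 < s ->
  is_derive x 1 (erfc_block rho s)
    ((1 + rho) * erfc_block rho s x - 2 * heat_block s x).
Proof.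
move=> s0; have q0 := sqrt_neq0 s0.
have dz : is_derive x (1 : R) (fun x => x / (2 * Num.sqrt s) + rho * Num.sqrt s)
    (2 * Num.sqrt s)^-1.
  have := isd_add (isd_mul (isd_id x) (isd_cst (2 * Num.sqrt s)^-1 x))
    (isd_cst (rho * Num.sqrt s) x).
  by rewrite mulr0 !addr0 mul1r.
have dE := isd_comp (is_derive_Erf _) dz.
have de := isd_expR (isd_add (isd_mul (isd_cst (1 + rho) x) (isd_id x))
   (isd_cst ((rho ^+ 2 - 1) * s) x)).
apply: (isd_eq (isd_mul de (isd_mul (isd_add (isd_cst 1 x) (isd_opp dE)) (isd_cst (2^-1) x)))).
have := gauss_heat rho x s0; rewrite /erfc_block /Erfc.
set e := expR _; set E := Erf _; set g := _ / _ * expR _; move=> H.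
rewrite (_ : 2 * _ = e * g * (4 * Num.sqrt s)^-1); last by rewrite H; field.
by field.
Qed.

Lemma der_erfc_block_s rho s x : 0 < s ->
  is_derive s 1 (fun s => erfc_block rho s x)
    ((rho ^+ 2 - 1) * erfc_block rho s x
     + heat_block s x * (x / s - 2 * rho)).
Proof.
move=> s0; have q0 := sqrt_neq0 s0.
have ds := isd_sqrt s0.
have q20 : 2 * Num.sqrt s != 0 by rewrite mulf_neq0.
have di := @isd_inv _ (fun s => 2 * Num.sqrt s) s _ q20 (isd_scale 2 ds).
have dz := isd_add (isd_scale x di) (isd_scale rho ds).
have dE := isd_comp (is_derive_Erf _) dz.
have de := isd_expR (isd_add (isd_cst ((1 + rho) * x) s) (isd_mul (isd_cst (rho ^+ 2 - 1) s) (isd_id s))).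
apply: (isd_eq (isd_mul de (isd_mul (isd_add (isd_cst 1 s) (isd_opp dE)) (isd_cst (2^-1) s)))).
have := gauss_heat rho x s0; rewrite /erfc_block /Erfc.
set e := expR _; set E := Erf _; set g := _ / _ * expR _; move=> H.
rewrite (_ : heat_block s x = e * g / (8 * Num.sqrt s)); last by rewrite H; field.
by move: (Num.sqrt s) (sqr_sqrtr (ltW s0)) q0 => q <- q0; field.
Qed.

Lemma der_heat_block_x s x : 0 < s ->
  is_derive x 1 (heat_block s) (heat_block s x * (1 - x / (2 * s))).
Proof.
move=> s0; have sn0 : s != 0 by rewrite gt_eqF.
have d1 := isd_add (isd_id x) (isd_cst (- (2 * s)) x).
apply: (isd_eq (isd_mul (isd_expR (isd_opp (isd_mul (isd_exprn 2 d1) (isd_cst (4 * s)^-1 x))))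
  (isd_cst (4 * Num.sqrt (pi * s))^-1 x))); rewrite /heat_block; set e := expR _.
set p := (4 * Num.sqrt _)^-1.
by field.
Qed.

Lemma der_heat_block_s s x : 0 < s ->
  is_derive s 1 (fun s => heat_block s x)
    (heat_block s x * (x ^+ 2 / (4 * s ^+ 2) - 1 - (2 * s)^-1)).
Proof.
move=> s0; have sn0 : s != 0 by rewrite gt_eqF.
have ps0 : 0 < pi * s by rewrite mulr_gt0// pi_gt0.
have d1 := isd_add (isd_cst x s) (isd_opp (isd_scale 2 (isd_id s))).
have s40 : 4 * s != 0 by rewrite mulf_neq0.
have d2 := @isd_inv _ (fun s => 4 * s) s _ s40 (isd_scale 4 (isd_id s)).
have q0 : 4 * Num.sqrt (pi * s) != 0 by rewrite mulf_neq0// gt_eqF// sqrtr_gt0.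
have d3 := @isd_inv _ (fun s => 4 * Num.sqrt (pi * s)) s _ q0
  (isd_scale 4 (isd_comp (isd_sqrt ps0) (isd_scale pi (isd_id s)))).
apply: (isd_eq (isd_mul (isd_expR (isd_opp (isd_mul (isd_exprn 2 d1) d2))) d3)); rewrite /heat_block; set e := expR _.
rewrite (_ : pi = Num.sqrt (pi * s) ^+ 2 / s); last first.
  by rewrite sqr_sqrtr ?ltW// mulfK.
have : Num.sqrt (pi * s) != 0 by rewrite gt_eqF// sqrtr_gt0.
rewrite -(_ : Num.sqrt (pi * s) = Num.sqrt (Num.sqrt (pi * s) ^+ 2 / s * s)).
  by move: (Num.sqrt _) => w w0; field; rewrite ?sn0 ?w0.
by rewrite divfK// sqr_sqrtr// ltW.
Qed.


Lemma heat_exponent_ge s x : 0 < s -> x - 3 * s <= (x - 2 * s) ^+ 2 / (4 * s).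
Proof.
move=> s0; rewrite ler_pdivlMr ?mulr_gt0//.
by have := sqr_ge0 (x - 4 * s); nra.
Qed.

Lemma erfc_block_ge0 rho s x : 0 <= erfc_block rho s x.
Proof. by rewrite mulr_ge0 ?expR_ge0// divr_ge0// Erfc_ge0. Qed.

Lemma heat_block_ge0 s x : 0 <= heat_block s x.
Proof. by rewrite divr_ge0 ?expR_ge0// mulr_ge0// sqrtr_ge0. Qed.

Lemma erfc_block_le_gauss rho s x : 0 < s ->
  0 <= x / (2 * Num.sqrt s) + rho * Num.sqrt s ->
  erfc_block rho s x <= expR (- ((x - 2 * s) ^+ 2 / (4 * s))).
Proof.
move=> s0 z0; have q0 := sqrt_neq0 s0.
have -> : - ((x - 2 * s) ^+ 2 / (4 * s)) = (1 + rho) * x + (rho ^+ 2 - 1) * s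
    - (x / (2 * Num.sqrt s) + rho * Num.sqrt s) ^+ 2.
  by move: (Num.sqrt s) (sqr_sqrtr (ltW s0)) q0 => q <- q0; field.
rewrite expRD /erfc_block ler_pM2l ?expR_gt0//.
have := Erfc_le_gauss z0; have := Erfc_ge0 (x / (2 * Num.sqrt s) + rho * Num.sqrt s); lra.
Qed.

Lemma heat_exponent_decay s x : 0 < s -> expR (- ((x - 2 * s) ^+ 2 / (4 * s))) <= expR (3 * s - x).
Proof. by move=> s0; rewrite ler_expR; have := heat_exponent_ge x s0; lra. Qed.

(** Where the argument of Erfc is nonnegative, Erfc is below a Gaussian and the
    exponents add up to that of the heat kernel. The argument is negative only
    for rho = - 1 and x < 2 s, and then the right-hand side is at least 1. *)
Lemma erfc_block_le rho s x : 0 < s -> 0 <= x -> [\/ rho = 1, rho = -1 | rho = 0] ->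
  erfc_block rho s x <= expR (3 * s - x).
Proof.
move=> s0 x0 hrho; have q0 : 0 < Num.sqrt s by rewrite sqrtr_gt0.
case: (leP 0 (x / (2 * Num.sqrt s) + rho * Num.sqrt s)) => z0.
  exact: le_trans (erfc_block_le_gauss s0 z0) (heat_exponent_decay _ s0).
have h2 : 0 < 2 * Num.sqrt s by rewrite mulr_gt0.
have zx : 0 <= x / (2 * Num.sqrt s) by rewrite divr_ge0// ltW.
have rhoE : rho = -1.
  case: hrho => E //; move: z0; rewrite E ltNge.
  - by rewrite addr_ge0// mul1r ltW.
  - by rewrite mul0r addr0 zx.
have xs : x < 2 * s.
  move: z0; rewrite rhoE mulN1r subr_lt0 ltr_pdivrMr// => /lt_le_trans; apply.
  by rewrite mulrCA -expr2 sqr_sqrtr// ltW.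
rewrite /erfc_block rhoE subrr mul0r sqrrN expr1n subrr mul0r addr0 expR0 mul1r.
apply: (@le_trans _ _ 1).
  by rewrite ler_pdivrMr// mul1r Erfc_le2.
by have := ler_expR 0 (3 * s - x); rewrite expR0 => ->; lra.
Qed.

Lemma heat_block_le s x : 0 < s ->
  4 * Num.sqrt (pi * s) * heat_block s x <= expR (3 * s - x).
Proof.
move=> s0; rewrite /heat_block mulrC divfK ?heat_exponent_decay//.
by rewrite mulf_neq0// gt_eqF// sqrtr_gt0 mulr_gt0// pi_gt0.
Qed.

Lemma gauss_small s x : 0 < s -> s <= x / 4 ->
  expR (- ((x - 2 * s) ^+ 2 / (4 * s))) <= 16 * s / x ^+ 2.
Proof.
move=> s0 sx; have x0 : 0 < x by nra.
have h : x ^+ 2 / (16 * s) <= (x - 2 * s) ^+ 2 / (4 * s).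
  rewrite ler_pdivlMr ?mulr_gt0// mulrAC ler_pdivrMr ?mulr_gt0//.
  have : 0 <= s * ((x - 2 * s) * 2 - x) * ((x - 2 * s) * 2 + x).
    by rewrite !mulr_ge0//; nra.
  by nra.
rewrite expRN (_ : 16 * s / x ^+ 2 = (x ^+ 2 / (16 * s))^-1); last by rewrite invf_div.
have y0 : 0 < x ^+ 2 / (16 * s) by rewrite divr_gt0// ?exprn_gt0// mulr_gt0.
rewrite lef_pV2 ?posrE ?expR_gt0//.
by have := expR_ge1Dx ((x - 2 * s) ^+ 2 / (4 * s)); lra.
Qed.

Lemma exprn_expRN_le n x : 0 <= x -> x ^+ n * expR (- x) <= n`!%:R.
Proof.
move=> x0; rewrite expRN ler_pdivrMr ?expR_gt0//.
case: n => [|n]; first by rewrite expr0 fact0 mul1r -expR0 ler_expR.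
have := @expR_ge1Dxn _ x n x0; set e := expR x.
have f0 : 0 < (n.+1`!)%:R :> R by rewrite ltr0n fact_gt0.
rewrite -ler_pdivrMl// mulrC; lra.
Qed.

End heat_blocks.

Section forms.
Context {R : realType}.
Implicit Types s x c : R.

Inductive block := BP | BM | BZ | BK | B1.

Definition block_val (b : block) s x : R :=
  match b with
  | BP => erfc_block 1 s x | BM => erfc_block (-1) s x | BZ => erfc_block 0 s x
  | BK => heat_block s x | B1 => 1
  end.

(** The tuple (b, c, i, j, l) stands for c x^i (4 s)^j (4 s)^-l times the block b.
    Sums of such terms are closed under both derivations, which are computed on
    the syntax; a differential equation then becomes a polynomial identity
    between the values of the blocks. The factor 4 keeps the coefficients of the
    dual functions integral. *)
Definition term := (block * R * nat * nat * nat)%type.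

Definition teval s x (t : term) : R :=
  let: (b, c, i, j, l) := t in
  c * x ^+ i * (4 * s) ^+ j * (4 * s)^-1 ^+ l * block_val b s x.

Fixpoint feval (f : seq term) s x : R :=
  if f is t :: f' then teval s x t + feval f' s x else 0.

Definition tdx (t : term) : seq term :=
  let: (b, c, i, j, l) := t in
  (if i is i'.+1 then [:: (b, c * i%:R, i', j, l)] else [::]) ++
  match b with
  | BP => [:: (BP, 2 * c, i, j, l); (BK, - 2 * c, i, j, l)]
  | BM => [:: (BK, - 2 * c, i, j, l)]
  | BZ => [:: (BZ, c, i, j, l); (BK, - 2 * c, i, j, l)]
  | BK => [:: (BK, c, i, j, l); (BK, - 2 * c, i.+1, j, l.+1)]
  | B1 => [::]
  end.

Definition tds (t : term) : seq term :=
  let: (b, c, i, j, l) := t in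
  (if j is j'.+1 then [:: (b, 4 * (c * j%:R), i, j', l)] else [::]) ++
  (if l is l'.+1 then [:: (b, - 4 * (c * l%:R), i, j, l.+1)] else [::]) ++
  match b with
  | BP => [:: (BK, 4 * c, i.+1, j, l.+1); (BK, - 2 * c, i, j, l)]
  | BM => [:: (BK, 4 * c, i.+1, j, l.+1); (BK, 2 * c, i, j, l)]
  | BZ => [:: (BZ, - c, i, j, l); (BK, 4 * c, i.+1, j, l.+1)]
  | BK => [:: (BK, 4 * c, i.+2, j, l.+2); (BK, - c, i, j, l);
             (BK, - 2 * c, i, j, l.+1)]
  | B1 => [::]
  end.

Fixpoint fdx (f : seq term) : seq term :=
  if f is t :: f' then tdx t ++ fdx f' else [::].
Fixpoint fds (f : seq term) : seq term :=
  if f is t :: f' then tds t ++ fds f' else [::].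

Lemma feval_cat f g s x : feval (f ++ g) s x = feval f s x + feval g s x.
Proof. by elim: f => [|t f IH] /=; rewrite ?add0r// IH addrA. Qed.

Lemma der_teval_x s x t : 0 < s -> is_derive x 1 (teval s ^~ t) (feval (tdx t) s x).
Proof.
move=> s0; have sn0 : s != 0 by rewrite gt_eqF.
case: t => [[[[b c] i] j] l].
have db : is_derive x (1 : R) (block_val b s) (match b with
    | BP => 2 * erfc_block 1 s x - 2 * heat_block s x
    | BM => - 2 * heat_block s x
    | BZ => erfc_block 0 s x - 2 * heat_block s x
    | BK => heat_block s x * (1 - x / (2 * s)) | B1 => 0 end).
  case: b => /=.
  - exact: (isd_eq (der_erfc_block_x 1 x s0)).
  - by apply: (isd_eq (der_erfc_block_x (-1) x s0)); ring.
  - by apply: (isd_eq (der_erfc_block_x 0 x s0)); ring.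
  - exact: der_heat_block_x.
  - exact: isd_cst.
have dm := isd_mul (isd_mul (isd_mul (isd_scale c (isd_exprn i (isd_id x)))
  (isd_cst ((4 * s) ^+ j) x)) (isd_cst ((4 * s)^-1 ^+ l) x)) db.
apply: (isd_eq dm) => {dm db}; rewrite !mulr0 !addr0 mulr1.
rewrite /tdx feval_cat; congr (_ + _).
  by case: i => [|i] /=; rewrite ?mul0r ?mulr0 ?mul0r ?addr0//; ring.
by case: b => /=; rewrite ?exprS ?addr0 ?mulr0//; try ring; field.
Qed.

Lemma der_teval_s s x t : 0 < s -> is_derive s 1 (fun s => teval s x t) (feval (tds t) s x).
Proof.
move=> s0; have sn0 : s != 0 by rewrite gt_eqF.
case: t => [[[[b c] i] j] l].
have db : is_derive s (1 : R) (block_val b ^~ x) (match b with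
    | BP => heat_block s x * (x / s - 2)
    | BM => heat_block s x * (x / s + 2)
    | BZ => - erfc_block 0 s x + heat_block s x * (x / s)
    | BK => heat_block s x * (x ^+ 2 / (4 * s ^+ 2) - 1 - (2 * s)^-1) | B1 => 0 end).
  case: b => /=.
  - by apply: (isd_eq (der_erfc_block_s 1 x s0)); ring.
  - by apply: (isd_eq (der_erfc_block_s (-1) x s0)); ring.
  - by apply: (isd_eq (der_erfc_block_s 0 x s0)); ring.
  - exact: der_heat_block_s.
  - exact: isd_cst.
have s40 : 4 * s != 0 by rewrite mulf_neq0.
have ds4 := isd_scale 4 (isd_id s).
have di := @isd_inv _ (fun s => 4 * s) s _ s40 ds4.
have dm := isd_mul (isd_mul (isd_mul (isd_cst (c * x ^+ i) s)
  (isd_exprn j ds4)) (isd_exprn l di)) db.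
apply: (isd_eq dm) => {dm db}; rewrite mul0r add0r.
rewrite /tds !feval_cat mulrDl -addrA; congr (_ + (_ + _)).
- by case: j => [|j] /=; rewrite ?mul0r ?mulr0 ?mul0r ?addr0//; ring.
- case: l => [|l] /=; first by rewrite !mul0r !mulr0 !mul0r.
  by rewrite addr0 !exprS; field.
by case: b => /=; rewrite ?exprS ?addr0 ?mulr0//; try ring; field.
Qed.

Lemma der_feval_x f s x : 0 < s -> is_derive x 1 (feval f s) (feval (fdx f) s x).
Proof.
move=> s0; elim: f => [|t f IH] /=; first exact: isd_cst.
by rewrite feval_cat; apply: isd_add => //; exact: der_teval_x.
Qed.

Lemma der_feval_s f s x : 0 < s -> is_derive s 1 (fun s => feval f s x) (feval (fds f) s x).
Proof.
move=> s0; elim: f => [|t f IH] /=; first exact: isd_cst.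
by rewrite feval_cat; apply: isd_add => //; exact: der_teval_s.
Qed.

End forms.

(** * Growth of the forms *)

Section form_bounds.
Context {R : realType}.
Implicit Types (s x : R) (f : seq (@term R)).

(** For s in a compact subset of ]0, +oo[ every block but the constant one decays
    exponentially in x, so that only the terms without a block can grow. *)
Definition tgrowth (d : nat) (t : @term R) : bool :=
  let: (b, c, i, j, l) := t in if b is B1 then (i <= d)%N else true.

(** The growth bound is uniform down to s = 0 when no negative power of s occurs
    and a power of s compensates the singularity of the heat kernel. *)
Definition tregular (d : nat) (t : @term R) : bool :=
  let: (b, c, i, j, l) := t in
  (l == 0)%N && match b with B1 => (i <= d)%N | BK => (0 < j)%N | _ => true end.

(** At a fixed x > 0 all the blocks but the constant one tend to 0 with s. *)
Definition tvanishing (t : @term R) : bool :=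
  let: (b, c, i, j, l) := t in if b is B1 then (0 < j)%N else true.

Lemma block_val_ge0 b s x : 0 <= @block_val R b s x.
Proof. by case: b => /=; [exact: erfc_block_ge0|exact: erfc_block_ge0|
  exact: erfc_block_ge0|exact: heat_block_ge0|exact: ler01]. Qed.

Lemma block_decay b del S : 0 < del -> b <> B1 -> exists2 B, 0 <= B &
  forall s x, del <= s <= S -> 0 <= x -> block_val b s x <= B * expR (- x).
Proof.
move=> d0 b1.
have e3 s x : s <= S -> expR (3 * s - x) <= expR (3 * S) * expR (- x).
  by move=> sS; rewrite -expRD ler_expR; lra.
have pid : 0 < 4 * Num.sqrt (pi * del) by rewrite mulr_gt0// sqrtr_gt0 mulr_gt0// pi_gt0.
exists (expR (3 * S) * (1 + (4 * Num.sqrt (pi * del))^-1)).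
  by rewrite mulr_ge0 ?expR_ge0// addr_ge0// invr_ge0 ltW.
move=> s x /andP[ds sS] x0; have s0 : 0 < s by exact: lt_le_trans ds.
have H : forall rho, [\/ rho = 1, rho = -1 | rho = 0] -> erfc_block rho s x <=
    expR (3 * S) * (1 + (4 * Num.sqrt (pi * del))^-1) * expR (- x).
  move=> rho hrho; apply: (le_trans (erfc_block_le s0 x0 hrho)).
  apply: (le_trans (e3 _ _ sS)); rewrite ler_wpM2r ?expR_ge0//.
  by rewrite ler_peMr ?expR_ge0// lerDl invr_ge0 ltW.
case: b b1 => //= _; [by apply: H; constructor 1|by apply: H; constructor 2|by apply: H; constructor 3|].
have sq : 0 < 4 * Num.sqrt (pi * s) by rewrite mulr_gt0// sqrtr_gt0 mulr_gt0// pi_gt0.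
have := heat_block_le x s0; rewrite -ler_pdivlMl// => /le_trans; apply.
rewrite mulrAC mulrDr mulr1 mulrC.
apply: (@le_trans _ _ (expR (3 * S) * expR (- x) / (4 * Num.sqrt (pi * del)))).
  apply: ler_pM; rewrite ?expR_ge0 ?invr_ge0 ?(ltW sq) ?e3//.
  by rewrite lef_pV2 ?posrE// ler_pM2l// ler_wsqrtr// ler_pM2l ?pi_gt0.
by rewrite lerDr mulr_ge0 ?expR_ge0.
Qed.

Let x1d d x : 0 <= x -> 1 <= (1 + x) ^+ d.
Proof. by move=> x0; rewrite exprn_ege1// lerDl. Qed.

Let xi_le i d x : (i <= d)%N -> 0 <= x -> x ^+ i <= (1 + x) ^+ d.
Proof.
move=> id x0; apply: (@le_trans _ _ ((1 + x) ^+ i)).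
  by apply: lerXn2r; rewrite ?nnegrE ?addr_ge0 ?lerDr.
by apply: ler_weXn2l; rewrite ?lerDl.
Qed.

Lemma teval_bound d del S t : 0 < del -> tgrowth d t -> exists2 K, 0 <= K &
  forall s x, del <= s <= S -> 0 <= x -> `|teval s x t| <= K * (1 + x) ^+ d.
Proof.
case: t => [[[[b c] i] j] l] d0 /= gr.
have [S0|S0] := ltP S del.
  by exists 0 => // s x /andP[ds sS]; have := le_lt_trans (le_trans ds sS) S0; rewrite ltxx.
have [B B0 HB] : exists2 B, 0 <= B & forall s x, del <= s <= S -> 0 <= x ->
    x ^+ i * block_val b s x <= B * (1 + x) ^+ d.
  have [bE|/eqP b1] := eqVneq (if b is B1 then true else false) true.
    case: b gr bE => //= id _; exists 1 => // s x _ x0.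
    by rewrite mulr1 mul1r xi_le.
  have {}b1 : b <> B1 by case: b b1 {gr}.
  have [B B0 HB] := block_decay S d0 b1.
  exists (B * i`!%:R); first by rewrite mulr_ge0.
  move=> s x sS x0; apply: (@le_trans _ _ (B * i`!%:R)).
    apply: (@le_trans _ _ (x ^+ i * (B * expR (- x)))).
      by rewrite ler_wpM2l ?exprn_ge0// HB.
    by rewrite mulrCA ler_wpM2l// exprn_expRN_le.
  by rewrite ler_peMr ?mulr_ge0// x1d.
exists (`|c| * (4 * S) ^+ j * (4 * del)^-1 ^+ l * B).
  by rewrite !mulr_ge0// exprn_ge0// ?invr_ge0 ?mulr_ge0//; lra.
move=> s x /andP[ds sS] x0; have s0 : 0 < s by exact: lt_le_trans ds.
have -> : `|c * x ^+ i * (4 * s) ^+ j * (4 * s)^-1 ^+ l * block_val b s x| =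
    `|c| * (4 * s) ^+ j * (4 * s)^-1 ^+ l * (x ^+ i * block_val b s x).
  rewrite -!mulrA normrM; congr (_ * _); rewrite ger0_norm; first by ring.
  by rewrite !mulr_ge0 ?exprn_ge0 ?invr_ge0 ?mulr_ge0 ?block_val_ge0 ?(ltW s0).
rewrite -[leRHS]mulrA.
apply: ler_pM; rewrite ?mulr_ge0 ?exprn_ge0 ?invr_ge0 ?mulr_ge0 ?(ltW s0) ?block_val_ge0//; last first.
  by apply: HB => //; rewrite ds.
apply: ler_pM; rewrite ?mulr_ge0 ?exprn_ge0 ?invr_ge0 ?mulr_ge0 ?(ltW s0)//; last first.
  by apply: lerXn2r; rewrite ?nnegrE ?invr_ge0 ?mulr_ge0 ?(ltW s0) ?(ltW d0)// lef_pV2 ?posrE ?mulr_gt0// ler_pM2l.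
rewrite ler_wpM2l//; apply: lerXn2r; rewrite ?nnegrE ?mulr_ge0 ?(ltW s0) ?ler_pM2l//.
by rewrite (le_trans (ltW d0)).
Qed.

Lemma feval_bound d del S f : 0 < del -> all (tgrowth d) f -> exists2 K, 0 <= K &
  forall s x, del <= s <= S -> 0 <= x -> `|feval f s x| <= K * (1 + x) ^+ d.
Proof.
move=> d0; elim: f => [_|t f IH /= /andP[gt /IH[K K0 HK]]].
  by exists 0 => // s x _ _; rewrite normr0 mul0r.
have [B B0 HB] := @teval_bound d del S t d0 gt.
exists (B + K); first exact: addr_ge0.
move=> s x sS x0; rewrite (le_trans (ler_normD _ _))// mulrDl lerD//; [exact: HB|exact: HK].
Qed.

Let heat4 s x : 0 < s -> 4 * s * heat_block s x <= Num.sqrt s * expR (- ((x - 2 * s) ^+ 2 / (4 * s))).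
Proof.
move=> s0; rewrite /heat_block sqrtrM ?pi_ge0//.
have q0 : 0 < Num.sqrt s by rewrite sqrtr_gt0.
have p1 : 1 <= Num.sqrt (pi : R).
  rewrite -sqrtr1 ler_wsqrtr//; have := @pi_ge2 R; lra.
have p0 : 0 < Num.sqrt (pi : R) by rewrite sqrtr_gt0 pi_gt0.
set e := expR _.
rewrite (_ : 4 * s * _ = Num.sqrt s * e / Num.sqrt pi).
  by rewrite ler_pdivrMr// ler_peMr// mulr_ge0 ?expR_ge0// ltW.
rewrite -{1}(sqr_sqrtr (ltW s0)); have := lt0r_neq0 q0; have := lt0r_neq0 p0.
move: (Num.sqrt s) (Num.sqrt pi) => q p; move=> ? ?; field.
by apply/andP.
Qed.

Lemma teval_regular d S t : tregular d t -> exists2 K, 0 <= K &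
  forall s x, 0 < s <= S -> 0 <= x -> `|teval s x t| <= K * (1 + x) ^+ d.
Proof.
case: t => [[[[b c] i] j] l] /= /andP[/eqP -> gr].
have [S0|S0] := leP S 0.
  by exists 0 => // s x /andP[ds sS]; have := lt_le_trans ds (le_trans sS S0); rewrite ltxx.
have [B B0 HB] : exists2 B, 0 <= B & forall s x, 0 < s <= S -> 0 <= x ->
    x ^+ i * ((4 * s) ^+ j * block_val b s x) <= B * (1 + x) ^+ d.
  have S40 : 0 <= 4 * S by rewrite mulr_ge0// ltW.
  have sj s k : 0 < s <= S -> (4 * s) ^+ k <= (4 * S) ^+ k.
    move=> /andP[s0 sS]; apply: lerXn2r; rewrite ?nnegrE// ?mulr_ge0 ?(ltW s0)//.
    by rewrite ler_pM2l.
  have e3 s x : s <= S -> expR (3 * s - x) <= expR (3 * S) * expR (- x).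
    by move=> sS; rewrite -expRD ler_expR; lra.
  have Q rho : [\/ rho = 1, rho = -1 | rho = 0] -> exists2 B, 0 <= B & forall s x, 0 < s <= S -> 0 <= x ->
      x ^+ i * ((4 * s) ^+ j * erfc_block rho s x) <= B * (1 + x) ^+ d.
    move=> hrho; exists ((4 * S) ^+ j * expR (3 * S) * i`!%:R).
      by rewrite !mulr_ge0 ?exprn_ge0 ?expR_ge0.
    move=> s x sS x0; have s0 : 0 < s by case/andP: sS.
    apply: (@le_trans _ _ ((4 * S) ^+ j * expR (3 * S) * i`!%:R)); last first.
      by rewrite ler_peMr ?x1d// !mulr_ge0 ?exprn_ge0 ?expR_ge0.
    apply: (@le_trans _ _ (x ^+ i * ((4 * S) ^+ j * (expR (3 * S) * expR (- x))))).
      apply: ler_wpM2l; rewrite ?exprn_ge0//.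
      apply: ler_pM; rewrite ?exprn_ge0 ?erfc_block_ge0 ?mulr_ge0 ?(ltW s0) ?sj//.
      by apply: (le_trans (erfc_block_le s0 x0 hrho)); apply: e3; case/andP: sS.
    rewrite (_ : x ^+ i * _ = (4 * S) ^+ j * expR (3 * S) * (x ^+ i * expR (- x))); last by ring.
    by rewrite ler_wpM2l ?exprn_expRN_le ?mulr_ge0 ?expR_ge0 ?exprn_ge0.
  case: b gr => /= gr; [by apply: Q; constructor 1|by apply: Q; constructor 2|by apply: Q; constructor 3| |].
    exists ((4 * S) ^+ j.-1 * Num.sqrt S * expR (3 * S) * i`!%:R).
      by rewrite !mulr_ge0 ?exprn_ge0 ?expR_ge0 ?sqrtr_ge0.
    move=> s x sS x0; have s0 : 0 < s by case/andP: sS.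
    apply: (@le_trans _ _ ((4 * S) ^+ j.-1 * Num.sqrt S * expR (3 * S) * i`!%:R)); last first.
      by rewrite ler_peMr ?x1d// !mulr_ge0 ?exprn_ge0 ?expR_ge0 ?sqrtr_ge0.
    apply: (@le_trans _ _ (x ^+ i * ((4 * S) ^+ j.-1 * (Num.sqrt S * (expR (3 * S) * expR (- x)))))).
      apply: ler_wpM2l; rewrite ?exprn_ge0//.
      rewrite -[in leLHS](prednK gr) exprSr -mulrA.
      apply: ler_pM; rewrite ?exprn_ge0 ?heat_block_ge0 ?mulr_ge0 ?heat_block_ge0 ?(ltW s0) ?sj//.
      apply: (le_trans (heat4 x s0)).
      apply: ler_pM; rewrite ?sqrtr_ge0 ?expR_ge0//; first by rewrite ler_wsqrtr//; case/andP: sS.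
      by apply: (le_trans (heat_exponent_decay _ s0)); apply: e3; case/andP: sS.
    rewrite (_ : x ^+ i * _ = (4 * S) ^+ j.-1 * Num.sqrt S * expR (3 * S) * (x ^+ i * expR (- x))); last by ring.
    by rewrite ler_wpM2l ?exprn_expRN_le ?mulr_ge0 ?expR_ge0 ?exprn_ge0 ?sqrtr_ge0.
  exists ((4 * S) ^+ j); first by rewrite exprn_ge0.
  move=> s x sS x0; have s0 : 0 < s by case/andP: sS.
  by rewrite mulr1 mulrC ler_pM ?exprn_ge0 ?mulr_ge0 ?(ltW s0) ?sj ?xi_le.
exists (`|c| * B); first by rewrite mulr_ge0.
move=> s x sS x0; have s0 : 0 < s by case/andP: sS.
rewrite expr0 mulr1 -!mulrA normrM ler_wpM2l// ger0_norm ?HB//.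
by rewrite !mulr_ge0 ?exprn_ge0 ?mulr_ge0 ?block_val_ge0 ?(ltW s0).
Qed.

Lemma feval_regular d S f : all (tregular d) f -> exists2 K, 0 <= K &
  forall s x, 0 < s <= S -> 0 <= x -> `|feval f s x| <= K * (1 + x) ^+ d.
Proof.
elim: f => [_|t f IH /= /andP[gt /IH[K K0 HK]]].
  by exists 0 => // s x _ _; rewrite normr0 mul0r.
have [B B0 HB] := @teval_regular d S t gt.
exists (B + K); first exact: addr_ge0.
move=> s x sS x0; rewrite (le_trans (ler_normD _ _))// mulrDl lerD//; [exact: HB|exact: HK].
Qed.

Lemma teval_vanish d t x : 0 < x -> tregular d t -> tvanishing t ->
  exists2 K, 0 <= K & forall s, 0 < s <= 1 -> s <= x / 4 ->
    `|teval s x t| <= K * Num.sqrt s.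
Proof.
case: t => [[[[b c] i] j] l] x0 /= /andP[/eqP -> gr] vn.
have sqs s : 0 < s <= 1 -> s <= Num.sqrt s.
  move=> /andP[s0 s1]; rewrite -{1}(sqr_sqrtr (ltW s0)) expr2 ler_piMr ?sqrtr_ge0//.
  by rewrite -sqrtr1 ler_wsqrtr.
suff [B B0 HB] : exists2 B, 0 <= B & forall s, 0 < s <= 1 -> s <= x / 4 ->
    (4 * s) ^+ j * block_val b s x <= B * Num.sqrt s.
  exists (`|c| * x ^+ i * B); first by rewrite !mulr_ge0// exprn_ge0// ltW.
  move=> s sS sx; have s0 : 0 < s by case/andP: sS.
  rewrite expr0 mulr1 -!mulrA normrM ler_wpM2l// ger0_norm.
    by rewrite ler_wpM2l ?exprn_ge0 ?(ltW x0)// HB.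
  by rewrite !mulr_ge0 ?exprn_ge0 ?mulr_ge0 ?block_val_ge0 ?(ltW s0) ?(ltW x0).
have s4 s k : 0 < s <= 1 -> (4 * s) ^+ k <= 4 ^+ k.
  by move=> /andP[s0 s1]; apply: lerXn2r; rewrite ?nnegrE// ?mulr_ge0 ?(ltW s0)//; lra.
have Q rho : (forall s, 0 < s <= 1 -> s <= x / 4 -> 0 <= x / (2 * Num.sqrt s) + rho * Num.sqrt s) ->
   exists2 B, 0 <= B & forall s, 0 < s <= 1 -> s <= x / 4 ->
    (4 * s) ^+ j * erfc_block rho s x <= B * Num.sqrt s.
  move=> hz; exists (4 ^+ j * (16 / x ^+ 2)).
    by rewrite mulr_ge0 ?exprn_ge0// divr_ge0 ?exprn_ge0// ltW.
  move=> s s1 sx; have s0 : 0 < s by case/andP: s1.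
  rewrite -mulrA; apply: ler_pM; rewrite ?exprn_ge0 ?erfc_block_ge0 ?mulr_ge0 ?(ltW s0) ?s4//.
  apply: (le_trans (erfc_block_le_gauss s0 (hz _ s1 sx))).
  apply: (le_trans (gauss_small s0 sx)).
  by rewrite mulrAC ler_wpM2l ?sqs// divr_ge0 ?exprn_ge0// ltW.
have zx s : 0 < s -> 0 <= x / (2 * Num.sqrt s).
  by move=> s0; rewrite divr_ge0 ?ltW// mulr_gt0// sqrtr_gt0.
case: b gr vn => /= gr vn.
- by apply: Q => s /andP[s0 _] _; rewrite mul1r addr_ge0 ?zx ?sqrtr_ge0.
- apply: Q => s /andP[s0 _] sx; rewrite mulN1r subr_ge0 ler_pdivlMr ?mulr_gt0 ?sqrtr_gt0//.
  by rewrite mulrCA -expr2 sqr_sqrtr ?(ltW s0)//; lra.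
- by apply: Q => s /andP[s0 _] _; rewrite mul0r addr0 zx.
- exists (4 ^+ j.-1); first by rewrite exprn_ge0.
  move=> s s1 sx; have s0 : 0 < s by case/andP: s1.
  rewrite -[in leLHS](prednK gr) exprSr -mulrA.
  apply: ler_pM; rewrite ?exprn_ge0 ?heat_block_ge0 ?mulr_ge0 ?heat_block_ge0 ?(ltW s0) ?s4//.
  apply: (le_trans (heat4 x s0)); rewrite ler_piMr ?sqrtr_ge0//.
  have := ler_expR (- ((x - 2 * s) ^+ 2 / (4 * s))) 0; rewrite expR0 => ->.
  by rewrite oppr_le0 divr_ge0 ?sqr_ge0// mulr_ge0// ltW.
exists (4 ^+ j); first by rewrite exprn_ge0.
move=> s s1 sx; have s0 : 0 < s by case/andP: s1.
rewrite mulr1 -[in leLHS](prednK vn) exprSr -[in leRHS](prednK vn) exprSr -[leRHS]mulrA.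
apply: ler_pM; rewrite ?exprn_ge0 ?mulr_ge0 ?(ltW s0) ?s4// ler_pM2l//.
exact: sqs.
Qed.

Lemma feval_vanish d f x : 0 < x -> all (tregular d) f -> all tvanishing f ->
  exists2 K, 0 <= K & forall s, 0 < s <= 1 -> s <= x / 4 ->
    `|feval f s x| <= K * Num.sqrt s.
Proof.
move=> x0; elim: f => [_ _|t f IH /= /andP[rt rf] /andP[vt vf]].
  by exists 0 => // s _ _; rewrite normr0 mul0r.
have [K K0 HK] := IH rf vf; have [B B0 HB] := teval_vanish x0 rt vt.
exists (B + K); first exact: addr_ge0.
move=> s sS sx; rewrite (le_trans (ler_normD _ _))// mulrDl lerD//; [exact: HB|exact: HK].
Qed.

End form_bounds.

(** * The explicit dual functions *)

Section dual_forms.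
Context {R : realType}.
Implicit Types s x : R.

(* The dual functions themselves contain no negative power of s. *)
Definition mono (b : block) (i j : nat) (c : R) : term := (b, c, i, j, 0%N).

(** The dual functions on x >= 0, all with zero initial value at s = 0. The two
    forms of index 1 solve f_s = f_xx - 2 f_x + 16 x; the first one vanishes at
    x = 0 and has an odd extension to the line, the second one has slope 0 there
    and an even extension. The forms of index 2 have the source 96 x f, with f the
    form of index 1, and slope 0 at x = 0: both have an even extension, and odd
    or even in their names refers to the function f that drives them. These
    conditions determine the coefficients. *)
Definition odd_form1 : seq (@term R) := [::
  mono BP 0 2 1; mono BP 1 0 (- 4); mono BP 1 1 4; mono BP 2 0 4;
  mono BM 0 2 1; mono BM 1 0 4; mono BM 1 1 (- 4); mono BM 2 0 4;
  mono BK 1 1 (- 8); mono B1 0 2 (- 1); mono B1 1 1 4].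

Definition even_form1 : seq (@term R) := [::
  mono BP 0 0 2; mono BP 0 1 (- 2); mono BP 1 0 (- 4); mono BM 0 0 (- 2);
  mono BM 0 1 2; mono BM 0 2 1; mono BM 1 1 (- 4); mono BM 2 0 4;
  mono BK 0 1 4; mono BK 0 2 2; mono BK 1 1 (- 4); mono B1 0 2 (- 1);
  mono B1 1 1 4].

Definition odd_form2 : seq (@term R) := [::
  mono BP 0 0 (- 888); mono BP 0 1 264; mono BP 0 2 (- 48); mono BP 0 3 12;
  mono BP 1 0 1776; mono BP 1 1 (- 528); mono BP 1 2 96;
  mono BP 2 0 (- 1248); mono BP 2 1 336; mono BP 2 2 (- 24);
  mono BP 3 0 480; mono BP 3 1 (- 96); mono BP 4 0 (- 96);
  mono BM 0 0 (- 648); mono BM 0 1 120; mono BM 0 3 (- 8);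
  mono BM 0 4 (- 3); mono BM 1 3 24; mono BM 2 0 240; mono BM 2 2 (- 48);
  mono BM 3 0 160; mono BM 4 0 48; mono BZ 0 0 1536; mono BZ 1 0 (- 1536);
  mono BK 0 1 (- 240); mono BK 0 2 104; mono BK 0 3 (- 28);
  mono BK 0 4 (- 6); mono BK 1 1 1008; mono BK 1 2 (- 200); mono BK 1 3 36;
  mono BK 2 1 (- 640); mono BK 2 2 24; mono BK 3 1 48; mono B1 0 3 8;
  mono B1 0 4 3; mono B1 1 3 (- 24); mono B1 2 2 48].

Definition even_form2 : seq (@term R) := [::
  mono BP 0 0 (- 504); mono BP 0 1 168; mono BP 0 2 (- 36); mono BP 0 3 12;
  mono BP 1 0 1008; mono BP 1 1 (- 336); mono BP 1 2 72;
  mono BP 2 0 (- 672); mono BP 2 1 192; mono BP 3 0 192;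
  mono BM 0 0 (- 264); mono BM 0 1 24; mono BM 0 2 12; mono BM 0 3 (- 8);
  mono BM 0 4 (- 3); mono BM 1 3 24; mono BM 2 0 48; mono BM 2 1 48;
  mono BM 2 2 (- 48); mono BM 3 0 64; mono BM 4 0 48; mono BZ 0 0 768;
  mono BZ 1 0 (- 768); mono BK 0 1 (- 240); mono BK 0 2 104;
  mono BK 0 3 (- 28); mono BK 0 4 (- 6); mono BK 1 1 624;
  mono BK 1 2 (- 152); mono BK 1 3 36; mono BK 2 1 (- 256);
  mono BK 2 2 (- 24); mono BK 3 1 (- 48); mono B1 0 3 8; mono B1 0 4 3;
  mono B1 1 3 (- 24); mono B1 2 2 48].

Local Ltac expand := cbv beta iota zeta delta
  [feval fdx fds tdx tds teval cat block_val mono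
   odd_form1 even_form1 odd_form2 even_form2].

(* The values of the blocks are generalised: the equations hold as identities of
   rational functions in s, x and these values. *)
Local Ltac pde_by_field s x :=
  expand; move: (erfc_block 1 s x) (erfc_block (-1) s x) (erfc_block 0 s x)
    (heat_block s x) => p m z k; field.

Lemma odd_form1_pde s x : 0 < s -> feval (fds odd_form1) s x =
  feval (fdx (fdx odd_form1)) s x - 2 * feval (fdx odd_form1) s x + 16 * x.
Proof. by move=> s0; have sn0 : s != 0 by [rewrite gt_eqF]; pde_by_field s x. Qed.

Lemma even_form1_pde s x : 0 < s -> feval (fds even_form1) s x =
  feval (fdx (fdx even_form1)) s x - 2 * feval (fdx even_form1) s x + 16 * x.
Proof. by move=> s0; have sn0 : s != 0 by [rewrite gt_eqF]; pde_by_field s x. Qed.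

Lemma odd_form2_pde s x : 0 < s -> feval (fds odd_form2) s x =
  feval (fdx (fdx odd_form2)) s x - 2 * feval (fdx odd_form2) s x
  + 96 * x * feval odd_form1 s x.
Proof. by move=> s0; have sn0 : s != 0 by [rewrite gt_eqF]; pde_by_field s x. Qed.

Lemma even_form2_pde s x : 0 < s -> feval (fds even_form2) s x =
  feval (fdx (fdx even_form2)) s x - 2 * feval (fdx even_form2) s x
  + 96 * x * feval even_form1 s x.
Proof. by move=> s0; have sn0 : s != 0 by [rewrite gt_eqF]; pde_by_field s x. Qed.

Lemma Erfc0 : Erfc (0 : R) = 1. Proof. by rewrite /Erfc Erf0 subr0. Qed.

Lemma blocks_at0 s : 0 < s ->
  [/\ erfc_block 1 s 0 = Erfc (Num.sqrt s) / 2,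
      erfc_block (-1) s 0 = 1 - Erfc (Num.sqrt s) / 2,
      erfc_block 0 s 0 = expR (- s) / 2 &
      heat_block s 0 = Num.sqrt (s / pi) * expR (- s) / (4 * s)].
Proof.
move=> s0; split; rewrite /erfc_block ?mulr0 ?mul0r ?add0r.
- by rewrite expr1n subrr mul0r expR0 !mul1r.
- by rewrite sqrrN expr1n subrr mul0r expR0 mul1r mulN1r /Erfc ErfN; field.
- by rewrite expr0n /= add0r mulN1r Erfc0 mul1r.
rewrite /heat_block sub0r (_ : (- (2 * s)) ^+ 2 / (4 * s) = s); last first.
  by field; rewrite gt_eqF.
rewrite !sqrtrM ?pi_ge0 ?ltW// sqrtrV ?pi_ge0//.
have : Num.sqrt s != 0 by rewrite gt_eqF// sqrtr_gt0.
have : Num.sqrt (pi : R) != 0 by rewrite gt_eqF// sqrtr_gt0 pi_gt0.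
move: (expR (- s)) (Num.sqrt s) (sqr_sqrtr (ltW s0)) (Num.sqrt pi) => e q <- p p0 q0.
by field; rewrite ?p0 ?q0.
Qed.

Local Ltac at0 s s0 :=
  expand; case: (blocks_at0 s0); do 4 (let e := fresh in intro e; rewrite ?e); rewrite /Erfc;
  move: (Erf (Num.sqrt s)) (expR (- s)) (Num.sqrt (s / pi)) => E e K; field.

Lemma odd_form1_at0 s : 0 < s -> feval odd_form1 s 0 = 0.
Proof. by move=> s0; have sn0 : s != 0 by [rewrite gt_eqF]; at0 s s0. Qed.

Lemma even_form1_dx_at0 s : 0 < s -> feval (fdx even_form1) s 0 = 0.
Proof. by move=> s0; have sn0 : s != 0 by [rewrite gt_eqF]; at0 s s0. Qed.

Lemma odd_form2_dx_at0 s : 0 < s -> feval (fdx odd_form2) s 0 = 0.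
Proof. by move=> s0; have sn0 : s != 0 by [rewrite gt_eqF]; at0 s s0. Qed.

Lemma even_form2_dx_at0 s : 0 < s -> feval (fdx even_form2) s 0 = 0.
Proof. by move=> s0; have sn0 : s != 0 by [rewrite gt_eqF]; at0 s s0. Qed.

Lemma even_form1_at0 s : 0 < s -> feval even_form1 s 0 =
  16 * (1 / 8 *
         (2 * (1 + 2 * s) * Num.sqrt (s / pi) * expR (- s)
          - 4 * s ^+ 2 * Erfc (Num.sqrt s)
          + (4 * s - 1) * Erf (Num.sqrt s))).
Proof. by move=> s0; have sn0 : s != 0 by [rewrite gt_eqF]; at0 s s0. Qed.

Lemma odd_form2_at0 s : 0 < s -> feval odd_form2 s 0 =
  768 * (5 / 8 * s - 27 / 32
         + expR (- s) *
           (1 - Num.sqrt (s / pi) *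
                (1 / 2 * s ^+ 3 + 7 / 12 * s ^+ 2 - 13 / 24 * s + 5 / 16))
         + Erfc (Num.sqrt s) *
           (1 / 2 * s ^+ 4 + 5 / 6 * s ^+ 3 - 1 / 2 * s ^+ 2
            + 3 / 8 * s - 5 / 32)).
Proof. by move=> s0; have sn0 : s != 0 by [rewrite gt_eqF]; at0 s s0. Qed.

Lemma even_form2_at0 s : 0 < s -> feval even_form2 s 0 =
  768 * (1 / 4 * s ^+ 2 + 1 / 8 * s - 11 / 32
         + expR (- s) *
           (1 / 2 - Num.sqrt (s / pi) *
                (1 / 2 * s ^+ 3 + 7 / 12 * s ^+ 2 - 13 / 24 * s + 5 / 16))
         + Erfc (Num.sqrt s) *
           (1 / 2 * s ^+ 4 + 5 / 6 * s ^+ 3 - 1 / 2 * s ^+ 2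
            + 3 / 8 * s - 5 / 32)).
Proof. by move=> s0; have sn0 : s != 0 by [rewrite gt_eqF]; at0 s s0. Qed.

Lemma odd_form1_regular : all (tregular 1) odd_form1 && all tvanishing odd_form1.
Proof. by []. Qed.
Lemma even_form1_regular : all (tregular 1) even_form1 && all tvanishing even_form1.
Proof. by []. Qed.
Lemma odd_form2_regular : all (tregular 2) odd_form2 && all tvanishing odd_form2.
Proof. by []. Qed.
Lemma even_form2_regular : all (tregular 2) even_form2 && all tvanishing even_form2.
Proof. by []. Qed.

End dual_forms.

(** * Taylor estimates for even and odd extensions *)

Section taylor.
Context {R : realType}.
Implicit Types (f : R -> R) (x y z M : R).

Lemma mvt_norm f df x y B :
  (forall z, Num.min x y <= z <= Num.max x y -> is_derive z 1 f (df z)) ->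
  (forall z, Num.min x y <= z <= Num.max x y -> `|df z| <= B) ->
  `|f y - f x| <= B * `|y - x|.
Proof.
have [xy|yx] := leP x y => hd hB.
  have [c cxy ->] := mvt_is_derive xy hd.
  by rewrite normrM ler_wpM2r// hB.
have [c cxy E] := mvt_is_derive (ltW yx) hd.
by rewrite distrC E normrM distrC ler_wpM2r// hB.
Qed.

Lemma between_ge0 x y z : 0 <= x -> 0 <= y -> Num.min x y <= z <= Num.max x y -> 0 <= z.
Proof. by move=> x0 y0 /andP[+ _]; apply: le_trans; rewrite le_min x0. Qed.

Lemma between_dist x y z : Num.min x y <= z <= Num.max x y -> `|z - x| <= `|y - x|.
Proof.
have [xy|yx] := leP x y => /andP[xz zy].
  by rewrite !ger0_norm ?subr_ge0// lerD2r.
by rewrite distrC [leRHS]distrC !ger0_norm ?subr_ge0// ?(ltW yx)// lerD2l lerN2.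
Qed.

Lemma taylor1 (P : R -> Prop) f f1 f2 M :
  (forall x y z, P x -> P y -> Num.min x y <= z <= Num.max x y -> P z) ->
  (forall x, P x -> is_derive x 1 f (f1 x)) -> (forall x, P x -> is_derive x 1 f1 (f2 x)) ->
  (forall x, P x -> `|f2 x| <= M) ->
  forall x y, P x -> P y -> `|f y - f x - f1 x * (y - x)| <= M * `|y - x| ^+ 2.
Proof.
move=> hP hf hf1 hM x y x0 y0.
pose g z := f z - f1 x * (z - x).
have hg z : P z -> is_derive z 1 g (f1 z - f1 x).
  move=> z0; have dl := isd_add (isd_id z) (isd_cst (- x) z).
  by apply: (isd_eq (isd_add (hf z z0) (isd_opp (isd_scale (f1 x) dl)))); rewrite addr0 mulr1.
rewrite (_ : _ - _ = g y - g x); last by rewrite /g; ring.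
rewrite expr2 mulrA; apply: (mvt_norm (df := fun z => f1 z - f1 x)).
  by move=> z zxy; apply: hg; exact: hP zxy.
move=> z zxy; apply: (@le_trans _ _ (M * `|z - x|)).
  apply: (mvt_norm (df := f2)) => w wxz.
    by apply: hf1; apply: (hP _ _ _ x0 _ wxz); exact: hP zxy.
  by apply: hM; apply: (hP _ _ _ x0 _ wxz); exact: hP zxy.
apply: ler_wpM2l; last exact: between_dist.
by apply: le_trans (hM _ x0); exact: normr_ge0.
Qed.

Lemma taylor2 f f1 f2 f3 M :
  (forall x, is_derive x 1 f (f1 x)) -> (forall x, is_derive x 1 f1 (f2 x)) ->
  (forall x, is_derive x 1 f2 (f3 x)) ->
  (forall x, 0 <= x -> `|f3 x| <= M) ->
  forall x y, 0 <= x -> 0 <= y ->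
  `|f y - f x - f1 x * (y - x) - f2 x / 2 * (y - x) ^+ 2| <= M * `|y - x| ^+ 3.
Proof.
move=> hf hf1 hf2 hM x y x0 y0.
pose g z := f z - f1 x * (z - x) - f2 x / 2 * (z - x) ^+ 2.
have hg (z : R) : is_derive z 1 g (f1 z - f1 x - f2 x * (z - x)).
  have dl := isd_add (isd_id z) (isd_cst (- x) z).
  apply: (isd_eq (isd_add (isd_add (hf z) (isd_opp (isd_scale (f1 x) dl)))
    (isd_opp (isd_scale (f2 x / 2) (isd_exprn 2 dl))))).
  by rewrite addr0 mulr1 /= expr1; field.
rewrite (_ : _ - _ - _ - _ = g y - g x); last by rewrite /g; field.
rewrite exprSr mulrA; apply: (mvt_norm (df := fun z => f1 z - f1 x - f2 x * (z - x))) => // z zxy.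
have z0 := between_ge0 x0 y0 zxy.
apply: (le_trans (taylor1 (P := fun x => 0 <= x) (M := M) between_ge0
   (fun x _ => hf1 x) (fun x _ => hf2 x) hM x0 z0)).
apply: ler_wpM2l; first by apply: le_trans (hM _ x0); exact: normr_ge0.
by apply: lerXn2r; rewrite ?nnegrE// between_dist.
Qed.

End taylor.

Section parity.
Context {R : realType}.
Implicit Types (f : R -> R) (u v x z M : R).

Lemma norm_same_side u v : `|v - u| < `|u| ->
  Num.sg v = Num.sg u /\ `|v| - `|u| = Num.sg u * (v - u).
Proof.
case: (ltgtP u 0) => [u0|u0|->]; last by rewrite normr0 normr_lt0.
  rewrite [X in _ < X]ltr0_norm// ltr_norml opprK => /andP[h1 h2].
  have v0 : v < 0 by lra.
  by rewrite !ltr0_sg// !ltr0_norm//; split => //; ring.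
rewrite [X in _ < X]gtr0_norm// ltr_norml => /andP[h1 h2].
have v0 : 0 < v by lra.
by rewrite !gtr0_sg// !gtr0_norm//; split => //; ring.
Qed.

Lemma sgr_sqr_neq0 u : u != 0 -> Num.sg u * Num.sg u = 1.
Proof. by move=> u0; rewrite -expr2 sqr_sg u0. Qed.

(** the indicator of the event that a step from u to v may cross the origin *)
Definition crossing u v : R := (`|u| <= `|v - u|)%R%:R.

(** A function that is smooth on either side of the origin and differentiable
    there satisfies the cubic Taylor estimate for steps that do not cross the
    origin. For a crossing step from u to v both |u| and |v| are at most
    twice the step, so that the first order expansion at 0, with slope l,
    gives a quadratic bound, which is what the second summand records. *)
Lemma taylor_crossing (G G1 G2 : R -> R) (l M : R) :
  (forall u v, `|v - u| < `|u| ->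
    `|G v - G u - G1 u * (v - u) - G2 u / 2 * (v - u) ^+ 2| <= M * `|v - u| ^+ 3) ->
  (forall z, `|G z - G 0 - l * z| <= M * `|z| ^+ 2) ->
  (forall u, `|G1 u - l| <= M * `|u|) -> (forall u, `|G2 u| <= M) ->
  forall u v, `|G v - G u - G1 u * (v - u) - G2 u / 2 * (v - u) ^+ 2|
    <= 7 * M * (`|v - u| ^+ 3 + crossing u v * `|v - u| ^+ 2).
Proof.
move=> far near slope hess u v; have M0 : 0 <= M by exact: le_trans (hess 0).
have w0 := normr_ge0 (v - u); have w3 := mulr_ge0 M0 (exprn_ge0 3 w0).
rewrite /crossing; have [cr|sm] := leP `|u| `|v - u|; last first.
  by rewrite mulr0n mul0r addr0 (le_trans (far u v sm))//; lra.
rewrite mulr1n mul1r; set w := `|v - u| in cr w0 w3 *.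
have u0 := normr_ge0 u; have v0 := normr_ge0 v.
have vw : `|v| <= 2 * w.
  rewrite (_ : v = v - u + u); last by ring.
  by rewrite (le_trans (ler_normD _ _))// -/w; lra.
have v2 : M * `|v| ^+ 2 <= M * (4 * w ^+ 2) by rewrite ler_wpM2l//; nra.
have u2 : M * `|u| ^+ 2 <= M * w ^+ 2 by rewrite ler_wpM2l//; nra.
have C1 : `|(G1 u - l) * (v - u)| <= M * w ^+ 2.
  by rewrite normrM -/w expr2 mulrA ler_wpM2r// (le_trans (slope u))// ler_wpM2l.
have C2 : `|G2 u / 2 * (v - u) ^+ 2| <= M * w ^+ 2.
  rewrite normrM normrX -/w ler_wpM2r ?exprn_ge0// normrM [X in _ * X]ger0_norm ?invr_ge0//.
  by have := hess u; have := normr_ge0 (G2 u); lra.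
rewrite (_ : _ - _ - _ - _ = (G v - G 0 - l * v) - (G u - G 0 - l * u)
  - (G1 u - l) * (v - u) - G2 u / 2 * (v - u) ^+ 2); last by ring.
move: (near u) (near v) C1 C2 v2 u2 w3; rewrite !ler_norml.
move=> /andP[? ?] /andP[? ?] /andP[? ?] /andP[? ?] ? ? ?.
by apply/andP; split; lra.
Qed.

Lemma taylor_even f f1 f2 f3 M : f1 (0 : R) = 0 ->
  (forall x, is_derive x 1 f (f1 x)) -> (forall x, is_derive x 1 f1 (f2 x)) ->
  (forall x, is_derive x 1 f2 (f3 x)) ->
  (forall x, 0 <= x -> `|f2 x| <= M) -> (forall x, 0 <= x -> `|f3 x| <= M) ->
  forall u v, `|f `|v| - f `|u| - Num.sg u * f1 `|u| * (v - u)
                - f2 `|u| / 2 * (v - u) ^+ 2|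
    <= 7 * M * (`|v - u| ^+ 3 + crossing u v * `|v - u| ^+ 2).
Proof.
move=> f10 hf hf1 hf2 h2 h3.
apply: (@taylor_crossing (fun u => f `|u|) (fun u => Num.sg u * f1 `|u|)
  (fun u => f2 `|u|) 0) => [u v sm|z|u|u].
- have u0 : u != 0 by rewrite -normr_gt0; exact: le_lt_trans sm.
  have [_ E] := norm_same_side sm.
  have := taylor2 hf hf1 hf2 h3 (normr_ge0 u) (normr_ge0 v).
  rewrite E exprMn normrM normr_sg u0 mul1r (expr2 (Num.sg u)) sgr_sqr_neq0// mul1r.
  by rewrite mulrCA mulrA.
- have := taylor1 (P := fun x => 0 <= x) (@between_ge0 R) (fun x _ => hf x)
    (fun x _ => hf1 x) h2 (lexx 0) (normr_ge0 z).
  by rewrite f10 !mul0r !subr0 normr0 normr_id.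
- rewrite subr0 normrM normr_sg; apply: (@le_trans _ _ `|f1 `|u| |).
    by case: (u != 0); rewrite ?mul1r ?mul0r.
  have := @mvt_norm R f1 f2 0 `|u| M (fun z _ => hf1 z).
  rewrite f10 !subr0 normr_id; apply=> z zz; apply: h2.
  exact: (between_ge0 _ _ zz).
- exact: h2.
Qed.

Lemma taylor_odd f f1 f2 f3 M : f 0 = 0 ->
  (forall x, is_derive x 1 f (f1 x)) -> (forall x, is_derive x 1 f1 (f2 x)) ->
  (forall x, is_derive x 1 f2 (f3 x)) ->
  (forall x, 0 <= x -> `|f2 x| <= M) -> (forall x, 0 <= x -> `|f3 x| <= M) ->
  forall u v, `|Num.sg v * f `|v| - Num.sg u * f `|u| - f1 `|u| * (v - u)
                - Num.sg u * f2 `|u| / 2 * (v - u) ^+ 2|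
    <= 7 * M * (`|v - u| ^+ 3 + crossing u v * `|v - u| ^+ 2).
Proof.
move=> f00 hf hf1 hf2 h2 h3.
apply: (@taylor_crossing (fun u => Num.sg u * f `|u|) (fun u => f1 `|u|)
  (fun u => Num.sg u * f2 `|u|) (f1 0)) => [u v sm|z|u|u].
- have u0 : u != 0 by rewrite -normr_gt0; exact: le_lt_trans sm.
  have [-> E] := norm_same_side sm.
  have := taylor2 hf hf1 hf2 h3 (normr_ge0 u) (normr_ge0 v).
  rewrite E exprMn [X in _ <= M * X ^+ _]normrM normr_sg u0 mul1r (expr2 (Num.sg u)) sgr_sqr_neq0// mul1r => h.
  rewrite (_ : _ - _ - _ - _ = Num.sg u * (f `|v| - f `|u| - f1 `|u| * (Num.sg u * (v - u))
     - f2 `|u| / 2 * (v - u) ^+ 2)); last first.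
    rewrite -[in LHS](mul1r (f1 `|u|)) -(sgr_sqr_neq0 u0); ring.
  by rewrite normrM normr_sg u0 mul1r.
- rewrite sgr0 mul0r subr0 [X in _ - _ * X]numEsg mulrCA -mulrBr normrM normr_sg.
  have := taylor1 (P := fun x => 0 <= x) (@between_ge0 R) (fun x _ => hf x)
    (fun x _ => hf1 x) h2 (lexx 0) (normr_ge0 z).
  rewrite f00 !subr0 normr_id; apply: le_trans.
  by case: (z != 0); rewrite ?mul1r ?mul0r.
- have := @mvt_norm R f1 f2 0 `|u| M (fun z _ => hf1 z).
  rewrite subr0 normr_id; apply=> z zz; apply: h2.
  exact: (between_ge0 _ _ zz).
- rewrite normrM normr_sg; apply: le_trans (h2 _ (normr_ge0 u)).
  by case: (u != 0); rewrite ?mul1r ?mul0r.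
Qed.

Lemma lipschitz_even f f1 M : (forall x, is_derive x 1 f (f1 x)) ->
  (forall x, 0 <= x -> `|f1 x| <= M) ->
  forall u v, `|f `|v| - f `|u| | <= M * `|v - u|.
Proof.
move=> hf h1 u v.
have M0 : 0 <= M by apply: le_trans (h1 0 (lexx _)).
apply: (@le_trans _ _ (M * `| `|v| - `|u| |)).
  apply: (mvt_norm (df := f1)) => // z zz; apply: h1.
  exact: (between_ge0 _ _ zz).
by rewrite ler_wpM2l// ler_dist_dist.
Qed.

Lemma lipschitz_odd f f1 M : f 0 = 0 -> (forall x, is_derive x 1 f (f1 x)) ->
  (forall x, 0 <= x -> `|f1 x| <= M) ->
  forall u v, `|Num.sg v * f `|v| - Num.sg u * f `|u| | <= 3 * M * `|v - u|.
Proof.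
move=> f00 hf h1 u v.
have M0 : 0 <= M by apply: le_trans (h1 0 (lexx _)).
have L x y : 0 <= x -> 0 <= y -> `|f y - f x| <= M * `|y - x|.
  move=> x0 y0; apply: (mvt_norm (df := f1)) => // z zz; apply: h1.
  exact: (between_ge0 _ _ zz).
have L0 x : 0 <= x -> `|f x| <= M * `|x|.
  by move=> x0; have := L 0 x (lexx _) x0; rewrite f00 !subr0.
have [cr|sm] := leP `|u| `|v - u|; last first.
  have [-> _] := norm_same_side sm.
  rewrite -mulrBr normrM normr_sg.
  have := L _ _ (normr_ge0 u) (normr_ge0 v).
  have := ler_dist_dist v u; have := normr_ge0 (v - u).
  have := normr_ge0 (f `|v| - f `|u|).
  by case: (u != 0); rewrite ?mul1r ?mul0r; nra.
have E (z : R) : `|Num.sg z * f `|z| | <= M * `|z|.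
  rewrite normrM normr_sg -[X in _ <= _ * X]normr_id.
  have := L0 _ (normr_ge0 z); have := normr_ge0 (f `|z|).
  by case: (z != 0); rewrite ?mul1r ?mul0r; lra.
apply: (le_trans (ler_normB _ _)).
have Ev := E v; have Eu := E u.
have vw : `|v| <= `|v - u| + `|u|.
  by rewrite -[in leLHS](subrK u v) ler_normD.
have := normr_ge0 (v - u); nra.
Qed.
End parity.

(** * Classes of dual functions *)

Section dual_class.
Context {R : realType}.
Implicit Types (s u x : R) (f : seq (@term R)).

Lemma measurable_sgr : measurable_fun [set: R] (@Num.sg R).
Proof.
rewrite (_ : @Num.sg R = (fun x => (0 < x)%R%:R - (x < 0)%R%:R)); last first.
  apply/funext => x; case: (ltgtP x 0) => [x0|x0|->].
  - by rewrite ltr0_sg// sub0r.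
  - by rewrite gtr0_sg// subr0.
  - by rewrite sgr0 subr0.
apply: measurable_funB.
  apply: (@measurableT_comp _ _ _ _ _ _ (fun b : bool => b%:R : R)) => //.
  exact: measurable_fun_ltr.
apply: (@measurableT_comp _ _ _ _ _ _ (fun b : bool => b%:R : R)) => //.
exact: measurable_fun_ltr.
Qed.

Lemma measurable_indicator_le (d : measure_display) (T : measurableType d) (f : T -> R) (r : R) :
  measurable_fun setT f -> measurable_fun setT (fun w => (f w <= r)%R%:R : R).
Proof.
move=> mf; apply: (@measurableT_comp _ _ _ _ _ _ (fun b : bool => b%:R : R)) => //.
exact: measurable_fun_ler.
Qed.

(** What a time step needs to know about a function c(s, u) with derivatives cs,
    cu and cuu: polynomial growth, an expansion of second order in u that loses
    one order when the step crosses the origin, where cuu may jump, and an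
    expansion of first order in s. *)
Record dual_class (lo hi : R) (d : nat) (K : R) (c cs cu cuu : R -> R -> R) : Prop :=
  DualClass {
  dc_meas : forall s, lo <= s <= hi -> [/\ measurable_fun setT (c s),
    measurable_fun setT (cu s) & measurable_fun setT (cuu s)] ;
  dc_val : forall s u, lo <= s <= hi -> `|c s u| <= K * (1 + `|u|) ^+ d ;
  dc_grad : forall s u, lo <= s <= hi -> `|cu s u| <= K * (1 + `|u|) ^+ d.-1 ;
  dc_hess : forall s u, lo <= s <= hi -> `|cuu s u| <= K ;
  dc_taylor : forall s u v, lo <= s <= hi ->
    `|c s v - c s u - cu s u * (v - u) - cuu s u / 2 * (v - u) ^+ 2|
      <= K * (`|v - u| ^+ 3 + crossing u v * `|v - u| ^+ 2) ;
  dc_time : forall s t u, lo <= s <= hi -> lo <= t <= hi ->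
    `|c t u - c s u - cs s u * (t - s)| <= K * (1 + `|u|) ^+ d * `|t - s| ^+ 2 }.

Definition even_ext f s u : R := feval f s `|u|.
Definition odd_ext f s u : R := Num.sg u * feval f s `|u|.

Let measurable_feval f s : 0 < s -> measurable_fun [set: R] (feval f s).
Proof.
move=> s0; apply: continuous_measurable_fun => x.
by apply: differentiable_continuous; apply/derivable1_diffP; have [] := der_feval_x f x s0.
Qed.

Let measurable_even_ext f s : 0 < s -> measurable_fun [set: R] (even_ext f s).
Proof.
by move=> s0; apply: (measurableT_comp (measurable_feval f s0)); exact: normr_measurable.
Qed.

Let measurable_odd_ext f s : 0 < s -> measurable_fun [set: R] (odd_ext f s).
Proof.
by move=> s0; apply: measurable_funM; [exact: measurable_sgr|exact: measurable_even_ext].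
Qed.

Let norm_odd f s u : `|odd_ext f s u| <= `|feval f s `|u| |.
Proof.
by rewrite /odd_ext normrM normr_sg; case: (u != 0); rewrite ?mul1r ?mul0r.
Qed.

Section class_of_form.
Variables (lo hi : R) (d : nat) (f : seq (@term R)).
Hypotheses (lo0 : 0 < lo) (g0 : all (tgrowth d) f) (g1 : all (tgrowth d.-1) (fdx f))
  (g2 : all (tgrowth 0) (fdx (fdx f))) (g3 : all (tgrowth 0) (fdx (fdx (fdx f))))
  (gs : all (tgrowth d) (fds (fds f))).

Let bounds : exists2 M, 0 <= M & forall s x, lo <= s <= hi -> 0 <= x ->
  [/\ `|feval f s x| <= M * (1 + x) ^+ d, `|feval (fdx f) s x| <= M * (1 + x) ^+ d.-1,
      `|feval (fdx (fdx f)) s x| <= M, `|feval (fdx (fdx (fdx f))) s x| <= M &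
      `|feval (fds (fds f)) s x| <= M * (1 + x) ^+ d].
Proof.
have [M0 M00 H0] := feval_bound hi lo0 g0; have [M1 M10 H1] := feval_bound hi lo0 g1.
have [M2 M20 H2] := feval_bound hi lo0 g2; have [M3 M30 H3] := feval_bound hi lo0 g3.
have [M4 M40 H4] := feval_bound hi lo0 gs.
exists (M0 + M1 + M2 + M3 + M4); first by rewrite !addr_ge0.
move=> s x sI x0; split.
- by apply: (le_trans (H0 s x sI x0)); rewrite ler_wpM2r ?exprn_ge0 ?addr_ge0//; lra.
- by apply: (le_trans (H1 s x sI x0)); rewrite ler_wpM2r ?exprn_ge0 ?addr_ge0//; lra.
- by apply: (le_trans (H2 s x sI x0)); rewrite expr0 mulr1; lra.
- by apply: (le_trans (H3 s x sI x0)); rewrite expr0 mulr1; lra.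
- by apply: (le_trans (H4 s x sI x0)); rewrite ler_wpM2r ?exprn_ge0 ?addr_ge0//; lra.
Qed.

Let timeT M (hM : forall s x, lo <= s <= hi -> 0 <= x ->
    `|feval (fds (fds f)) s x| <= M * (1 + x) ^+ d) s t x :
  lo <= s <= hi -> lo <= t <= hi -> 0 <= x ->
  `|feval f t x - feval f s x - feval (fds f) s x * (t - s)|
     <= M * (1 + x) ^+ d * `|t - s| ^+ 2.
Proof.
move=> sI tI x0.
apply: (@taylor1 _ (fun s => lo <= s <= hi) (feval f ^~ x) (feval (fds f) ^~ x)
  (feval (fds (fds f)) ^~ x)) => //.
- move=> a b z /andP[la ha] /andP[lb hb] /andP[+ +].
  by rewrite ge_min le_max => /orP[] h1 /orP[] h2; apply/andP; split; lra.
- by move=> z /andP[lz _]; apply: der_feval_s; exact: lt_le_trans lz.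
- by move=> z /andP[lz _]; apply: der_feval_s; exact: lt_le_trans lz.
- by move=> z zI; exact: hM.
Qed.

Lemma even_class : (forall s, 0 < s -> feval (fdx f) s 0 = 0) ->
  exists2 K, 0 <= K & dual_class lo hi d K (even_ext f) (even_ext (fds f))
     (odd_ext (fdx f)) (even_ext (fdx (fdx f))).
Proof.
move=> f10; have [M M0 H] := bounds; exists (7 * M); first by rewrite mulr_ge0.
have M7 a : 0 <= a -> M * a <= 7 * M * a by move=> a0; nra.
have sp s : lo <= s <= hi -> 0 < s by move=> /andP[ls _]; exact: lt_le_trans ls.
split.
- by move=> s /sp s0; split; [exact: measurable_even_ext|exact: measurable_odd_ext|exact: measurable_even_ext].
- move=> s u sI; have [h _ _ _ _] := H _ _ sI (normr_ge0 u).
  by apply: (le_trans h); rewrite M7// exprn_ge0// addr_ge0.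
- move=> s u sI; have [_ h _ _ _] := H _ _ sI (normr_ge0 u).
  by apply: (le_trans (norm_odd _ _ _)); apply: (le_trans h); rewrite M7// exprn_ge0// addr_ge0.
- move=> s u sI; have [_ _ h _ _] := H _ _ sI (normr_ge0 u).
  by apply: (le_trans h); have := M7 1 ler01; rewrite !mulr1.
- move=> s u v sI; have s0 := sp _ sI.
  apply: (taylor_even (f10 _ s0) (fun x => der_feval_x f x s0)
     (fun x => der_feval_x _ x s0) (fun x => der_feval_x _ x s0)) => x x0.
    by have [] := H _ _ sI x0.
  by have [] := H _ _ sI x0.
- move=> s t u sI tI; apply: (le_trans (timeT _ sI tI (normr_ge0 u))).
    by move=> ? ? hI h0; have [_ _ _ _ h] := H _ _ hI h0; exact: h.
  rewrite -!mulrA; set a := _ ^+ d * _; rewrite mulrA; apply: M7.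
  by rewrite mulr_ge0 ?exprn_ge0 ?addr_ge0.
Qed.

Lemma odd_class : (forall s, 0 < s -> feval f s 0 = 0) ->
  exists2 K, 0 <= K & dual_class lo hi d K (odd_ext f) (odd_ext (fds f))
     (even_ext (fdx f)) (odd_ext (fdx (fdx f))).
Proof.
move=> f0; have [M M0 H] := bounds; exists (7 * M); first by rewrite mulr_ge0.
have M7 a : 0 <= a -> M * a <= 7 * M * a by move=> a0; nra.
have sp s : lo <= s <= hi -> 0 < s by move=> /andP[ls _]; exact: lt_le_trans ls.
split.
- by move=> s /sp s0; split; [exact: measurable_odd_ext|exact: measurable_even_ext|exact: measurable_odd_ext].
- move=> s u sI; have [h _ _ _ _] := H _ _ sI (normr_ge0 u).
  by apply: (le_trans (norm_odd _ _ _)); apply: (le_trans h); rewrite M7// exprn_ge0// addr_ge0.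
- move=> s u sI; have [_ h _ _ _] := H _ _ sI (normr_ge0 u).
  by apply: (le_trans h); rewrite M7// exprn_ge0// addr_ge0.
- move=> s u sI; have [_ _ h _ _] := H _ _ sI (normr_ge0 u).
  by apply: (le_trans (norm_odd _ _ _)); apply: (le_trans h); have := M7 1 ler01; rewrite !mulr1.
- move=> s u v sI; have s0 := sp _ sI.
  apply: (taylor_odd (f0 _ s0) (fun x => der_feval_x f x s0)
     (fun x => der_feval_x _ x s0) (fun x => der_feval_x _ x s0)) => x x0.
    by have [] := H _ _ sI x0.
  by have [] := H _ _ sI x0.
- move=> s t u sI tI.
  rewrite (_ : _ - _ - _ = Num.sg u * (feval f t `|u| - feval f s `|u|
    - feval (fds f) s `|u| * (t - s))); last by rewrite /odd_ext; ring.
  apply: (@le_trans _ _ `|feval f t `|u| - feval f s `|u| - feval (fds f) s `|u| * (t - s)|).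
    by rewrite normrM normr_sg; case: (u != 0); rewrite ?mul1r ?mul0r.
  apply: (le_trans (timeT _ sI tI (normr_ge0 u))).
    by move=> ? ? hI h0; have [_ _ _ _ h] := H _ _ hI h0; exact: h.
  rewrite -!mulrA; set a := _ ^+ d * _; rewrite mulrA; apply: M7.
  by rewrite mulr_ge0 ?exprn_ge0 ?addr_ge0.
Qed.

End class_of_form.

Lemma even_lipschitz lo hi f : 0 < lo -> all (tgrowth 0) (fdx f) ->
  exists2 K, 0 <= K & forall s u v, lo <= s <= hi ->
    `|even_ext f s v - even_ext f s u| <= K * `|v - u|.
Proof.
move=> lo0 g; have [M M0 H] := feval_bound hi lo0 g; exists M => // s u v sI.
have s0 : 0 < s by case/andP: sI => ls _; exact: lt_le_trans ls.
apply: (lipschitz_even (fun x => der_feval_x f x s0)) => x x0.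
by have := H s x sI x0; rewrite expr0 mulr1.
Qed.

Lemma odd_lipschitz lo hi f : 0 < lo -> all (tgrowth 0) (fdx f) ->
  (forall s, 0 < s -> feval f s 0 = 0) ->
  exists2 K, 0 <= K & forall s u v, lo <= s <= hi ->
    `|odd_ext f s v - odd_ext f s u| <= K * `|v - u|.
Proof.
move=> lo0 g f0; have [M M0 H] := feval_bound hi lo0 g; exists (3 * M); first by rewrite mulr_ge0.
move=> s u v sI; have s0 : 0 < s by case/andP: sI => ls _; exact: lt_le_trans ls.
apply: (lipschitz_odd (f0 s s0) (fun x => der_feval_x f x s0)) => x x0.
by have := H s x sI x0; rewrite expr0 mulr1.
Qed.

(** At u = 0 the drift term is absent on the line because the sign of 0 is 0,
    and on the half line because the slope vanishes. *)
Lemma even_ext_pde f s u h : 0 < s -> feval (fdx f) s 0 = 0 ->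
  feval (fds f) s `|u| = feval (fdx (fdx f)) s `|u| - 2 * feval (fdx f) s `|u| + h ->
  even_ext (fds f) s u = even_ext (fdx (fdx f)) s u - 2 * Num.sg u * odd_ext (fdx f) s u + h.
Proof.
move=> s0 f10 E; rewrite /even_ext /odd_ext E.
have [->|u0] := eqVneq u 0; first by rewrite normr0 f10 !(mulr0, mul0r).
by rewrite mulrA -(mulrA 2) sgr_sqr_neq0// mulr1.
Qed.

Lemma odd_ext_pde f s u h : feval (fds f) s `|u| =
    feval (fdx (fdx f)) s `|u| - 2 * feval (fdx f) s `|u| + h ->
  odd_ext (fds f) s u = odd_ext (fdx (fdx f)) s u - 2 * Num.sg u * even_ext (fdx f) s u + Num.sg u * h.
Proof. by move=> E; rewrite /even_ext /odd_ext E; ring. Qed.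

End dual_class.

(** * Moments of the normal distribution *)

Section gaussian_moments.
Context {R : realType}.
Variable sigma : R.
Hypothesis sigma0 : 0 < sigma.
Local Notation mu := (@lebesgue_measure R).
Local Notation nu := (@normal_prob R 0 sigma).
Local Notation pdf := (normal_pdf 0 sigma).

Let sn0 : sigma != 0. Proof. by rewrite gt_eqF. Qed.

Let e x : R := expR (- (x ^+ 2 / (2 * sigma ^+ 2))).
Let peak : R := normal_peak sigma.

Let pdfE x : pdf x = peak * e x.
Proof.
rewrite normal_pdfE// /normal_fun subr0 /e mulNr -mulr_natl; congr (_ * expR (- (_ / _))).
Qed.

Let peakE : peak = (sigma * Num.sqrt 2 * Num.sqrt pi)^-1.
Proof.
rewrite /peak /normal_peak -mulr_natr -mulrA sqrtrM ?sqr_ge0// sqrtr_sqr gtr0_norm//.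
by rewrite mulrC sqrtrM ?pi_ge0// (mulrC (Num.sqrt pi)) mulrC mulrA.
Qed.

Lemma ge0_integral_normal (f : R -> R) :
  measurable_fun [set: R] f -> (forall x, 0 <= f x) ->
  (\int[nu]_x (f x)%:E = \int[mu]_x (f x * pdf x)%:E)%E.
Proof.
move=> mf f0; have dom := normal_prob_dominates 0 sigma.
have mf' : measurable_fun [set: R] (EFin \o f) by exact/measurable_EFinP.
rewrite -(Radon_Nikodym_SigmaFinite.change_of_variables dom)//=.
under [RHS]eq_integral do rewrite EFinM.
apply: ae_eq_integral => //.
- apply: emeasurable_funM => //; apply: (measurable_int mu).
  exact: Radon_Nikodym_SigmaFinite.f_integrable.
- apply: emeasurable_funM => //; apply/measurable_EFinP; exact: measurable_normal_pdf.
apply: ae_eqe_mul2l; apply: integral_ae_eq => //.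
- exact: Radon_Nikodym_SigmaFinite.f_integrable.
- by apply/measurable_EFinP; exact: measurable_normal_pdf.
- by move=> A _ mA; rewrite -Radon_Nikodym_SigmaFinite.f_integral.
Qed.

Let der_e x : is_derive x (1 : R) e (- (x / sigma ^+ 2) * e x).
Proof.
have d := isd_expR (isd_opp (isd_mul (isd_exprn 2 (isd_id x)) (isd_cst (2 * sigma ^+ 2)^-1 x))).
by apply: (isd_eq d); rewrite -/(e x) /=; field.
Qed.

Let e_decay n x : (n <= 2)%N -> 1 <= x -> x ^+ n * e x <= 8 * sigma ^+ 4 / x.
Proof.
move=> n2 x1; have x0 : 0 < x by exact: lt_le_trans x1.
have s0 : 0 < 2 * sigma ^+ 2 by rewrite mulr_gt0// exprn_gt0.
have t0 : 0 <= x ^+ 2 / (2 * sigma ^+ 2) by rewrite divr_ge0 ?exprn_ge0 ?(ltW x0) ?(ltW s0).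
have := exprn_expRN_le 2 t0; rewrite -/(e x) => h.
rewrite ler_pdivlMr// mulrAC.
apply: (@le_trans _ _ (x ^+ 4 * e x)).
  rewrite ler_wpM2r ?expR_ge0// -exprSr ler_weXn2l//.
  by rewrite (leq_trans (_ : n.+1 <= 3)%N).
rewrite (_ : x ^+ 4 * e x = 4 * sigma ^+ 4 * ((x ^+ 2 / (2 * sigma ^+ 2)) ^+ 2 * e x)); last by field.
rewrite (_ : 8 * sigma ^+ 4 = 4 * sigma ^+ 4 * 2); last by ring.
by rewrite ler_wpM2l// mulr_ge0// exprn_ge0// ltW.
Qed.

Let e_cvg n : (n <= 2)%N -> (x ^+ n * e x) @[x --> +oo%R] --> (0 : R).
Proof.
move=> n2; apply/cvgrPdist_le => eps eps0; near=> x.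
have x1 : 1 <= x by near: x; apply: nbhs_pinfty_ge; rewrite num_real.
have x0 : 0 < x by exact: lt_le_trans x1.
rewrite sub0r normrN ger0_norm ?mulr_ge0 ?exprn_ge0 ?expR_ge0 ?(ltW x0)//.
apply: (le_trans (e_decay n2 x1)); rewrite ler_pdivrMr// -ler_pdivrMl.
  by near: x; apply: nbhs_pinfty_ge; rewrite num_real.
by [].
Unshelve. all: end_near. Qed.

Let cont_der (f df : R -> R) : (forall x : R, is_derive x 1 f (df x)) -> continuous f.
Proof.
by move=> h x; apply: differentiable_continuous; apply/derivable1_diffP; have [] := h x.
Qed.

Let half_integral (f F : R -> R) (l : R) : continuous f -> (forall x, 0 <= x -> 0 <= f x) ->
  (forall x : R, is_derive x 1 F (f x)) -> F x @[x --> +oo%R] --> l ->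
  (\int[mu]_(x in `[0%R, +oo[) (f x)%:E = (l - F 0)%:E)%E.
Proof.
move=> cf f0 dF Fl; have cF := cont_der dF.
rewrite (@ge0_continuous_FTC2y _ f F 0 l)//.
- exact: continuous_subspaceT.
- exact: cvg_at_right_filter (cF 0).
- by move=> x _; rewrite derive1E; have [_ ->] := dF x.
Qed.

Let set0y : [set x | 0 <= x]%R = `[0%R, +oo[%classic :> set R.
Proof. by apply/seteqP; split => x/=; rewrite in_itv/= andbT. Qed.

(** By symmetry this is twice an integral over the half line, for which there is
    an explicit primitive; the other moments are computed in the same way. *)
Lemma integral_normal_sqr : (\int[nu]_x (x ^+ 2)%:E = (sigma ^+ 2)%:E)%E.
Proof.
rewrite ge0_integral_normal//; last by move=> x; exact: sqr_ge0.
have cf : continuous (fun x : R => x ^+ 2 * pdf x).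
  by move=> x; apply: cvgM; [exact: exprn_continuous|exact: continuous_normal_pdf].
rewrite ge0_symfun_integralT//; last first.
  - by move=> x /=; rewrite !pdfE /e sqrrN.
  - by move=> x; rewrite mulr_ge0 ?sqr_ge0 ?normal_pdf_ge0.
rewrite set0y.
pose F x := sigma ^+ 2 * (Erf (x / (sigma * Num.sqrt 2)) / 2 - peak * (x * e x)).
have dF (x : R) : is_derive x 1 F (x ^+ 2 * pdf x).
  have dx := isd_mul (isd_id x) (isd_cst (sigma * Num.sqrt 2)^-1 x).
  have d := isd_scale (sigma ^+ 2) (isd_add
    (isd_mul (isd_comp (is_derive_Erf _) dx) (isd_cst 2^-1 x))
    (isd_opp (isd_scale peak (isd_mul (isd_id x) (der_e x))))).
  apply: (isd_eq d); rewrite pdfE.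
  have -> : - (x / (sigma * Num.sqrt 2)) ^+ 2 = - (x ^+ 2 / (2 * sigma ^+ 2)).
    by rewrite expr_div_n exprMn sqr_sqrtr// (mulrC (sigma ^+ 2)).
  rewrite -/(e x) peakE.
  have := sqr_sqrtr (ler0n R 2).
  have : Num.sqrt (2 : R) != 0 by rewrite gt_eqF// sqrtr_gt0.
  have : Num.sqrt (pi : R) != 0 by rewrite gt_eqF// sqrtr_gt0 pi_gt0.
  move: (Num.sqrt pi) (Num.sqrt 2) (e x) => p q E p0 q0 q2.
  by field; rewrite ?p0 ?q0 ?sn0.
have Fl : F x @[x --> +oo%R] --> sigma ^+ 2 * (1 / 2 - peak * 0).
  apply: cvgMr; apply: cvgB; last first.
    by apply: cvgMr; have := @e_cvg 1%N isT; under eq_fun do rewrite expr1.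
  apply: cvgMl.
  apply: (cvg_comp (fun x => x / (sigma * Num.sqrt 2)) (@Erf R)); last exact: cvg_Erf.
  by apply: gt0_cvgMly; rewrite ?invr_gt0 ?mulr_gt0 ?sqrtr_gt0//; exact: cvg_id.
have f0 x : 0 <= x -> 0 <= x ^+ 2 * pdf x.
  by move=> x0; rewrite mulr_ge0 ?sqr_ge0 ?normal_pdf_ge0.
have -> := half_integral cf f0 dF Fl.
rewrite /F mul0r Erf0 !(mul0r, mulr0) !subr0 mulr0 subr0 -EFinM.
by congr (_%:E); field.
Qed.


Lemma integral_normal_cube : (\int[nu]_x (`|x| ^+ 3)%:E <= (2 * sigma ^+ 3)%:E)%E.
Proof.
rewrite ge0_integral_normal//; last first.
  by apply: measurable_funX; exact: normr_measurable.
have cf : continuous (fun x : R => `|x| ^+ 3 * pdf x).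
  move=> x; apply: cvgM; last exact: continuous_normal_pdf.
  apply: (cvg_comp _ (fun x => x ^+ 3)); last exact: exprn_continuous.
  exact: norm_continuous.
rewrite ge0_symfun_integralT//; last first.
  - by move=> x /=; rewrite !pdfE /e sqrrN normrN.
  - by move=> x; rewrite mulr_ge0 ?exprn_ge0 ?normal_pdf_ge0.
rewrite set0y.
pose F x := - (peak * sigma ^+ 2) * (x ^+ 2 * e x + 2 * sigma ^+ 2 * (x ^+ 0 * e x)).
have -> : (\int[mu]_(x in `[0%R, +oo[) (`|x| ^+ 3 * pdf x)%:E =
    \int[mu]_(x in `[0%R, +oo[) (x ^+ 3 * pdf x)%:E)%E.
  by apply: eq_integral => x; rewrite inE/= in_itv/= andbT => x0; rewrite ger0_norm.
have dF (x : R) : is_derive x 1 F (x ^+ 3 * pdf x).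
  have d := isd_scale (- (peak * sigma ^+ 2)) (isd_add
     (isd_mul (isd_exprn 2 (isd_id x)) (der_e x))
     (isd_scale (2 * sigma ^+ 2) (isd_mul (isd_exprn 0 (isd_id x)) (der_e x)))).
  by apply: (isd_eq d); rewrite pdfE /=; field.
have Fl : F x @[x --> +oo%R] --> - (peak * sigma ^+ 2) * (0 + 2 * sigma ^+ 2 * 0).
  by apply: cvgMr; apply: cvgD; [exact: e_cvg|apply: cvgMr; exact: e_cvg].
have c3 : continuous (fun x : R => x ^+ 3 * pdf x).
  by move=> x; apply: cvgM; [exact: exprn_continuous|exact: continuous_normal_pdf].
have f0 x : 0 <= x -> 0 <= x ^+ 3 * pdf x.
  by move=> x0; rewrite mulr_ge0 ?exprn_ge0 ?normal_pdf_ge0.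
have -> := half_integral c3 f0 dF Fl.
rewrite -EFinM lee_fin /F /e !expr0n /= mul0r mul0r oppr0 expR0 peakE.
have q1 : 2 <= Num.sqrt (2 : R) * Num.sqrt pi.
  rewrite -sqrtrM// -[leLHS](@ger0_norm R)// -sqrtr_sqr ler_wsqrtr//.
  by have := @pi_ge2 R; lra.
rewrite -[sigma * _ * _]mulrA; set q := _ * _ in q1 *.
rewrite [leLHS](_ : _ = 4 * sigma ^+ 3 / q); last first.
  by field; rewrite sn0 andbT gt_eqF//; lra.
rewrite ler_pdivrMr; last lra.
by have := exprn_ge0 3 (ltW sigma0); nra.
Qed.

Lemma integral_normal_pos : (\int[nu]_x (Num.max x 0)%:E = (sigma ^+ 2 * peak)%:E)%E.
Proof.
rewrite ge0_integral_normal//; last 2 first.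
  by apply: measurable_maxr.
  by move=> x; rewrite le_max lexx orbT.
rewrite (_ : (fun x => _) = ((fun x => (Num.max x 0 * pdf x)%:E) \_ `[0%R, +oo[)%E); last first.
  apply/funext => x; rewrite patchE; case: ifPn => //.
  rewrite notin_setE/= in_itv/= andbT => /negP; rewrite -ltNge => x0.
  by rewrite max_r ?mul0r// ltW.
rewrite -integral_mkcond.
have -> : (\int[mu]_(x in `[0%R, +oo[) (Num.max x 0 * pdf x)%:E =
    \int[mu]_(x in `[0%R, +oo[) (x * pdf x)%:E)%E.
  by apply: eq_integral => x; rewrite inE/= in_itv/= andbT => x0; rewrite max_l.
pose F x := - (peak * sigma ^+ 2) * (x ^+ 0 * e x).
have dF (x : R) : is_derive x 1 F (x * pdf x).
  have d := isd_scale (- (peak * sigma ^+ 2)) (isd_mul (isd_exprn 0 (isd_id x)) (der_e x)).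
  by apply: (isd_eq d); rewrite pdfE /=; field.
have Fl : F x @[x --> +oo%R] --> - (peak * sigma ^+ 2) * 0.
  by apply: cvgMr; exact: e_cvg.
have c1 : continuous (fun x : R => x * pdf x).
  by move=> x; apply: cvgM; [exact: cvg_id|exact: continuous_normal_pdf].
have f0 x : 0 <= x -> 0 <= x * pdf x.
  by move=> x0; rewrite mulr_ge0 ?normal_pdf_ge0.
have -> := half_integral c1 f0 dF Fl.
by rewrite /F /e expr0 expr0n /= mul0r oppr0 expR0; congr (_%:E); ring.
Qed.

Lemma integral_normal_neg : (\int[nu]_x (Num.max (- x) 0)%:E = (sigma ^+ 2 * peak)%:E)%E.
Proof.
rewrite -integral_normal_pos !ge0_integral_normal//; last 4 first.
- by apply: measurable_maxr.
- by move=> x; rewrite le_max lexx orbT.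
- by apply: measurable_maxr => //; apply: measurableT_comp.
- by move=> x; rewrite le_max lexx orbT.
rewrite (_ : (fun x => (Num.max (- x) 0 * _)%:E) =
    ((fun x => (Num.max (- x) 0 * pdf x)%:E) \_ `]-oo, (- 0)%R])%E); last first.
  apply/funext => x; rewrite patchE; case: ifPn => //.
  rewrite notin_setE/= in_itv/= oppr0 => /negP; rewrite -ltNge => x0.
  by rewrite max_r ?mul0r// oppr_le0 ltW.
rewrite -integral_mkcond ge0_integration_by_substitutionNy/=; last 2 first.
- apply: continuous_subspaceT => x; apply: cvgM; last exact: continuous_normal_pdf.
  by apply: continuous_max; [exact: opp_continuous|exact: cvg_cst].
- by move=> x _; rewrite mulr_ge0 ?normal_pdf_ge0// le_max lexx orbT.
rewrite integral_mkcond; apply: eq_integral => x _; rewrite patchE; case: ifPn.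
  by move=> _ /=; rewrite opprK !pdfE /e sqrrN.
rewrite notin_setE/= in_itv/= andbT => /negP; rewrite -ltNge => x0.
by rewrite max_r ?mul0r// ltW.
Qed.

(** The density is at most 1 / (sigma sqrt (2 pi)), hence at most 1 / (2 sigma). *)
Lemma normal_prob_ball (x : R) (r : R) : 0 <= r ->
  (nu `[(x - r)%R, (x + r)%R]%classic <= (r / sigma)%:E)%E.
Proof.
move=> r0; apply: (@le_trans _ _ (\int[mu]_(y in `[(x - r)%R, (x + r)%R]) peak%:E)%E).
  apply: ge0_le_integral => //.
  - by move=> y _; rewrite lee_fin normal_pdf_ge0.
  - by apply/measurable_EFinP/measurable_funTS; exact: measurable_normal_pdf.
  - by move=> y _; rewrite lee_fin normal_pdf_ub.
rewrite integral_cst//= lebesgue_measure_itv/= lte_fin.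
have [h|h] := ltP; last by rewrite mule0 lee_fin divr_ge0// ltW.
rewrite -EFinB -EFinM lee_fin peakE.
have q1 : 2 <= Num.sqrt (2 : R) * Num.sqrt pi.
  rewrite -sqrtrM// -[leLHS](@ger0_norm R)// -sqrtr_sqr ler_wsqrtr//.
  by have := @pi_ge2 R; lra.
rewrite -mulrA; set q := _ * _ in q1 *.
rewrite ler_pdivlMr// (_ : _ * _ * _ = 2 * r / q); last first.
  by field; rewrite sn0 /= gt_eqF//; lra.
rewrite ler_pdivrMr; last lra.
by nra.
Qed.

End gaussian_moments.

(** * Expectations of functions of independent variables *)

Section independence.
Local Open Scope ereal_scope.
Context {d : measure_display} {T : measurableType d} {R : realType}.
Variable P : probability T R.

Definition independent_pair (X Y : T -> R) :=
  forall A B : set R, measurable A -> measurable B ->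
    P (X @^-1` A `&` Y @^-1` B) = P (X @^-1` A) * P (Y @^-1` B).

Section rv.
Variables X Y : {mfun T >-> R}.
Hypothesis XY : independent_pair X Y.

Let XYf w := (X w, Y w).

Let mXYf : measurable_fun setT XYf.
Proof. exact: measurable_fun_pair. Qed.

Let XYm : {mfun T >-> (R * R)%type} := HB.pack XYf (isMeasurableFun.Build _ _ _ _ _ mXYf).

(** The joint law is the product of the laws, so that Tonelli's theorem applies. *)
Lemma integral_independent_rv (h : R * R -> \bar R) :
  measurable_fun setT h -> (forall z, 0 <= h z) ->
  \int[P]_w h (X w, Y w) = \int[P]_w \int[P]_w' h (X w, Y w').
Proof.
move=> mh h0.
have -> : \int[P]_w h (X w, Y w) = \int[distribution P XYm]_z h z.
  by rewrite ge0_integral_distribution.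
rewrite (@eq_measure_integral _ _ _ _ (distribution P X \x distribution P Y)); last first.
  move=> A mA _; apply/esym; by apply: product_measure_unique.
rewrite fubini_tonelli1//.
rewrite ge0_integral_distribution; last 2 first.
- exact: measurable_fun_fubini_tonelli_F.
- by move=> x; apply: integral_ge0.
apply: eq_integral => w _; rewrite /fubini_F /=.
by rewrite ge0_integral_distribution//; exact: (measurableT_comp mh).
Qed.

End rv.

Lemma integral_independent (X Y : T -> R) (h : R * R -> \bar R) :
  measurable_fun setT X -> measurable_fun setT Y -> independent_pair X Y ->
  measurable_fun setT h -> (forall z, 0 <= h z) ->
  \int[P]_w h (X w, Y w) = \int[P]_w \int[P]_w' h (X w, Y w').
Proof.
move=> mX mY XY; pose X' : {mfun T >-> R} := HB.pack X (isMeasurableFun.Build _ _ _ _ _ mX).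
pose Y' : {mfun T >-> R} := HB.pack Y (isMeasurableFun.Build _ _ _ _ _ mY).
exact: (@integral_independent_rv X' Y').
Qed.

Lemma integral_independentM (X Y : T -> R) (f g : R -> R) :
  measurable_fun setT X -> measurable_fun setT Y -> independent_pair X Y ->
  measurable_fun setT f -> measurable_fun setT g ->
  (forall x, 0 <= f x)%R -> (forall x, 0 <= g x)%R ->
  \int[P]_w (f (X w) * g (Y w))%:E = \int[P]_w (f (X w))%:E * \int[P]_w (g (Y w))%:E.
Proof.
move=> mX mY XY mf mg f0 g0.
rewrite (@integral_independent X Y (fun z => (f z.1 * g z.2)%:E))//=; last 2 first.
- apply/measurable_EFinP; apply: measurable_funM.
    exact: (measurableT_comp mf).
  exact: (measurableT_comp mg).
- by move=> z; rewrite lee_fin mulr_ge0.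
have mgY : measurable_fun setT (fun w => (g (Y w))%:E).
  by apply/measurable_EFinP; exact: (measurableT_comp mg).
have mfX : measurable_fun setT (fun w => (f (X w))%:E).
  by apply/measurable_EFinP; exact: (measurableT_comp mf).
have inner w : \int[P]_w' (f (X w) * g (Y w'))%:E = (f (X w))%:E * \int[P]_w (g (Y w))%:E.
  under eq_integral do rewrite EFinM.
  by rewrite ge0_integralZl// ?lee_fin// => w' _; rewrite lee_fin.
under eq_integral do rewrite inner.
rewrite ge0_integralZr//; first by move=> ? _; rewrite lee_fin.
by apply: integral_ge0 => ? _; rewrite lee_fin.
Qed.

(** That g(Y) is centred is expressed by its positive and negative parts having
    the same finite mean c: the product is then a combination of four products
    of nonnegative independent variables, and integrability comes for free. *)
Lemma integral_independent0 (X Y : T -> R) (g : R -> R) (c : R) :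
  measurable_fun setT X -> measurable_fun setT Y -> independent_pair X Y ->
  measurable_fun setT g ->
  \int[P]_w `|X w|%:E < +oo ->
  \int[P]_w (Num.max (g (Y w)) 0)%:E = c%:E ->
  \int[P]_w (Num.max (- g (Y w))%R 0)%:E = c%:E ->
  P.-integrable setT (fun w => (X w * g (Y w))%:E) /\
  \int[P]_w (X w * g (Y w))%:E = 0.
Proof.
move=> mX mY XY mg iX gp gn.
have mmax (f : R -> R) : measurable_fun setT f -> measurable_fun setT (fun x => Num.max (f x) 0%R).
  by move=> mf; apply: measurable_maxr.
have mN (f : R -> R) : measurable_fun setT f -> measurable_fun setT (fun x => (- f x)%R).
  by move=> mf; apply: (measurableT_comp (@oppr_measurable R setT)).
pose p (x : R) := Num.max x 0%R; pose q (x : R) := Num.max (- x)%R 0%R.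
have mp : measurable_fun setT p by exact: mmax.
have mq : measurable_fun setT q by apply: mmax; exact: mN.
have p0 x : (0 <= p x)%R by rewrite le_max lexx orbT.
have q0 x : (0 <= q x)%R by rewrite le_max lexx orbT.
have mXf : measurable_fun setT (fun w => (X w)%:E) by exact/measurable_EFinP.
have pX (f : R -> R) (mf : measurable_fun setT f) (f0 : forall x, (0 <= f x)%R)
   (fle : forall x, (f x <= `|x|)%R) : \int[P]_w (f (X w))%:E \is a fin_num.
  rewrite ge0_fin_numE; last by apply: integral_ge0 => ? _; rewrite lee_fin.
  apply: le_lt_trans iX; apply: ge0_le_integral => //.
  - by move=> ? _; rewrite lee_fin.
  - by apply/measurable_EFinP; exact: (measurableT_comp mf).
  - by apply/measurable_EFinP; apply: measurableT_comp.
  - by move=> w _; rewrite lee_fin.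
have ple x : (p x <= `|x|)%R by rewrite ge_max ler_norm normr_ge0.
have qle x : (q x <= `|x|)%R by rewrite ge_max -normrN ler_norm normr_ge0.
have pqE x : (x = p x - q x)%R.
  rewrite /p /q; have [x0|x0] := leP 0%R x.
    by rewrite [X in (_ - X)%R]max_r ?subr0// oppr_le0.
  by rewrite max_l ?sub0r ?opprK// oppr_ge0 ltW.
have part (f f' : R -> R) : measurable_fun setT f -> measurable_fun setT f' ->
   (forall x, 0 <= f x)%R -> (forall x, f x <= `|x|)%R -> (forall x, 0 <= f' x)%R ->
   \int[P]_w (f' (g (Y w)))%:E = c%:E ->
   P.-integrable setT (fun w => (f (X w) * f' (g (Y w)))%:E) /\
   \int[P]_w (f (X w) * f' (g (Y w)))%:E = \int[P]_w (f (X w))%:E * c%:E.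
  move=> mf mf' f0 fle f'0 E.
  have mf'g : measurable_fun setT (fun y => f' (g y)) by exact: (measurableT_comp mf').
  have E2 := integral_independentM mX mY XY mf mf'g f0 (fun y => f'0 (g y)).
  rewrite E2 E; split => //; apply/integrableP; split.
    apply/measurable_EFinP; apply: measurable_funM.
      exact: (measurableT_comp mf).
    exact: (measurableT_comp mf'g).
  under eq_integral do rewrite gee0_abs ?lee_fin ?mulr_ge0//.
  by rewrite E2 E -(fineK (pX f mf f0 fle)) -EFinM ltry.
have [ipp Epp] := part p p mp mp p0 ple p0 gp.
have [iqq Eqq] := part q q mq mq q0 qle q0 gn.
have [ipq Epq] := part p q mp mq p0 ple q0 gn.
have [iqp Eqp] := part q p mq mp q0 qle p0 gp.
have XE : (fun w => (X w * g (Y w))%:E) =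
   (fun w => ((p (X w) * p (g (Y w)))%:E + (q (X w) * q (g (Y w)))%:E)
     - ((p (X w) * q (g (Y w)))%:E + (q (X w) * p (g (Y w)))%:E)).
  apply/funext => w; rewrite -!EFinD; congr (_%:E).
  by rewrite [in LHS](pqE (X w)) [in LHS](pqE (g (Y w))); ring.
rewrite XE; split; first by apply: integrableB => //; apply: integrableD.
rewrite integralB//; [|exact: integrableD..].
rewrite !integralD// Epp Eqq Epq Eqp.
have pf := pX p mp p0 ple; have qf := pX q mq q0 qle.
by rewrite -(fineK pf) -(fineK qf) -!EFinM -!EFinD subrr.
Qed.

End independence.

(** * Riemann sums of continuous functions *)

Section riemann_sums.
Context {R : realType}.
Local Notation mu := (@lebesgue_measure R).
Implicit Types (f : R -> R) (a b c e : R).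

Lemma uniform_continuity_segment f a b e : 0 < e ->
  {within `[a, b], continuous f} ->
  exists2 del, 0 < del & forall x y, a <= x <= b -> a <= y <= b ->
    `|x - y| < del -> `|f x - f y| <= e.
Proof.
move=> e0 cf.
pose Q (del : R) (x : R) := a <= x <= b -> forall y, a <= y <= b -> `|x - y| < del -> `|f x - f y| <= e.
have K : compact `[a, b]%classic by exact: segment_compact.
have [] := (compact_near_coveringP _).1 K R (0^'+) Q.
  move=> x; rewrite /= in_itv/= => xab.
  have : \forall z \near within `[a, b] (nbhs x), `|f x - f z| < e / 2.
    have xA : `[a, b]%classic x by rewrite /= in_itv.
    rewrite (nbhs_subspace_in xA).
    have e20 : 0 < e / 2 by rewrite divr_gt0.
    by have /cvgrPdist_lt/(_ _ e20) := cf x.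
  rewrite near_withinE => /nbhs_ballP[eta /= eta0 Heta].
  exists (ball x (eta / 2), [set d : R | d < eta / 2]).
    split => /=; first by apply: nbhsx_ballx; rewrite divr_gt0.
    by apply: nbhs_right_lt; rewrite divr_gt0.
  move=> [z del] /= [zx dd] zab y yab zy.
  move: zx; rewrite /ball/= => zx.
  have h1 : `|f x - f z| < e / 2.
    by apply: Heta; rewrite /ball/= ?in_itv//=; lra.
  have h2 : `|f x - f y| < e / 2.
    apply: Heta; rewrite /ball/= ?in_itv//=.
    by rewrite (_ : x - y = (x - z) + (z - y)); [have := ler_normD (x - z) (z - y); lra|ring].
  rewrite (_ : f z - f y = - (f x - f z) + (f x - f y)); last by ring.
  by have := ler_normD (- (f x - f z)) (f x - f y); rewrite normrN; lra.
move=> del /= del0 Hdel; exists (del / 2); first by rewrite divr_gt0.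
move=> x y xab yab xy.
apply: (Hdel (del / 2) _ _ x) => //=.
- by rewrite sub0r normrN gtr0_norm; lra.
- by rewrite divr_gt0.
Qed.

Lemma continuous_segment_integrable f a b :
  {within `[a, b], continuous f} -> mu.-integrable `[a, b] (EFin \o f).
Proof. by move=> cf; apply: continuous_compact_integrable => //; exact: segment_compact. Qed.

Lemma Rintegral_segment_cst a b c : a <= b ->
  \int[mu]_(x in `[a, b]) c = c * (b - a).
Proof.
move=> ab; rewrite Rintegral_cst//= lebesgue_measure_itv/= lte_fin.
by move: ab; rewrite le_eqVlt => /predU1P[->|->]//; rewrite ltxx/= subrr.
Qed.

Lemma le_norm_Rintegral_segment f a b c : a <= b ->
  mu.-integrable `[a, b] (EFin \o f) -> (forall x, a <= x <= b -> `|f x| <= c) ->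
  `|\int[mu]_(x in `[a, b]) f x| <= c * (b - a).
Proof.
move=> ab fi fc.
apply: (le_trans (le_normr_Rintegral _ fi)) => //.
apply: (@le_trans _ _ (\int[mu]_(x in `[a, b]) c)).
  apply: le_Rintegral => //.
  - exact: integrable_norm.
  - apply: continuous_segment_integrable; apply: continuous_subspaceT => x; exact: cvg_cst.
by rewrite Rintegral_segment_cst.
Qed.

Lemma Rintegral_segmentD f a b c : a <= b -> b <= c ->
  mu.-integrable `[a, c] (EFin \o f) ->
  \int[mu]_(x in `[a, c]) f x = \int[mu]_(x in `[a, b]) f x + \int[mu]_(x in `[b, c]) f x.
Proof.
move=> ab bc fi.
have := @Rintegral_itvB R f (BLeft a) (BRight c) b fi.
rewrite !bnd_simp => /(_ ab bc) => H.
rewrite -[X in _ = _ + X]Rintegral_itv_obnd_cbnd.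
  by rewrite -H; ring.
apply: (integrableS _ _ _ fi) => //.
by apply: subset_itvr; rewrite bnd_simp.
Qed.

(** The integral of a path is thereby a limit of finite sums of random variables,
    which gives access to its measurability and to its second moment. *)
Lemma riemann_sum_cvg f a b : a < b -> {within `[a, b], continuous f} ->
  (\sum_(i < n.+1) (b - a) / n.+1%:R * f (a + (b - a) / n.+1%:R * i%:R)) @[n --> \oo]
   --> \int[mu]_(x in `[a, b]) f x.
Proof.
move=> ab cf; apply/cvgrPdist_le => e e0.
have ba0 : 0 < b - a by rewrite subr_gt0.
have [del del0 Hdel] := uniform_continuity_segment (divr_gt0 e0 ba0) cf.
have fi := continuous_segment_integrable cf.
near=> n.
set h := (b - a) / n.+1%:R.
have h0 : 0 < h by rewrite divr_gt0// ltr0n.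
have hn : h * n.+1%:R = b - a by rewrite /h divfK// pnatr_eq0.
have hd : h < del.
  rewrite /h ltr_pdivrMr ?ltr0n// -ltr_pdivrMl//.
  apply: (@lt_trans _ _ n%:R); last by rewrite ltr_nat.
  by near: n; exact: nbhs_infty_gtr.
have step (k : nat) : (k <= n.+1)%N ->
  `|\int[mu]_(x in `[a, a + h * k%:R]) f x - \sum_(i < k) h * f (a + h * i%:R)|
     <= e / (b - a) * (h * k%:R).
  elim: k => [_|k IH kn].
    by rewrite big_ord0 mulr0 addr0 mulr0 subr0 set_itv1 Rintegral_set1 normr0.
  have hk0 : 0 <= h * k%:R by rewrite mulr_ge0// ltW.
  have hkb : a + h * k.+1%:R <= b.
    by rewrite -lerBrDl -hn ler_pM2l// ler_nat.
  have kS : h * k.+1%:R = h * k%:R + h by rewrite -natr1 mulrDr mulr1.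
  have xk : a + h * k%:R <= a + h * k.+1%:R by rewrite lerD2l kS lerDl ltW.
  have fik : mu.-integrable `[a, a + h * k.+1%:R] (EFin \o f).
    apply: (integrableS _ _ _ fi) => //; apply: subset_itvl; by rewrite bnd_simp.
  have fik2 : mu.-integrable `[a + h * k%:R, a + h * k.+1%:R] (EFin \o f).
    apply: (integrableS _ _ _ fik) => //; apply: subset_itvr; by rewrite bnd_simp lerDl.
  rewrite (@Rintegral_segmentD f a (a + h * k%:R))//; last by rewrite lerDl.
  rewrite big_ord_recr /=.
  set A := Rintegral _ _ _; set B := Rintegral _ _ _; set S := bigop.body _ _ _.
  have -> : A + B - (S + h * f (a + h * k%:R)) = (A - S) + (B - h * f (a + h * k%:R)) by ring.
  apply: (le_trans (ler_normD _ _)); rewrite kS mulrDr; apply: lerD; first exact: IH (ltnW kn).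
  have -> : B - h * f (a + h * k%:R) =
     \int[mu]_(x in `[a + h * k%:R, a + h * k.+1%:R]) (f x - f (a + h * k%:R)).
    rewrite RintegralB//; last first.
      apply: continuous_segment_integrable; apply: continuous_subspaceT => x; exact: cvg_cst.
    by rewrite Rintegral_segment_cst// kS /B kS; congr (_ - _); ring.
  have -> : e / (b - a) * h = e / (b - a) * (a + h * k.+1%:R - (a + h * k%:R)).
    by rewrite kS; ring.
  apply: le_norm_Rintegral_segment => //.
    have cf' : {within `[a + h * k%:R, a + h * k.+1%:R], continuous f}.
      apply: continuous_subspaceW cf; apply: subset_itv; by rewrite bnd_simp// lerDl.
    apply: continuous_segment_integrable => x.
    by apply: cvgB; [exact: cf'|exact: cvg_cst].
  move=> x /andP[x1 x2]; apply: Hdel.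
  - by apply/andP; split; lra.
  - by apply/andP; split; lra.
  - by rewrite ger0_norm; move: x2; rewrite kS; lra.
have := step n.+1 (leqnn _); rewrite hn (_ : a + (b - a) = b); last by ring.
by rewrite divfK// gt_eqF.
Unshelve. all: end_near. Qed.

End riemann_sums.

(** * Square of a path integral *)

Section square_of_a_path_integral.
Context {d : measure_display} {T : measurableType d} {R : realType}.
Variable P : probability T R.
Local Notation mu := (@lebesgue_measure R).

Lemma sqr_sum_le (x : nat -> R) n :
  (\sum_(i < n) x i) ^+ 2 <= n%:R * \sum_(i < n) x i ^+ 2.
Proof.
elim: n => [|n IH]; first by rewrite !big_ord0 expr0n mulr0.
rewrite [\sum_(i < _) x i]big_ord_recr [X in _ * X]big_ord_recr/= -natr1.
have [->|n0] := posnP n; first by rewrite !big_ord0 mulr0n !add0r mul1r.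
have {}n0 : (0 : R) < n%:R by rewrite ltr0n.
move: (\sum_(i < n) x i) (\sum_(i < n) x i ^+ 2) IH => S Q IH.
have : 0 <= n%:R * (Q + n%:R * x n ^+ 2 - 2 * S * x n).
  by have := sqr_ge0 (S - n%:R * x n); nra.
by rewrite pmulr_rge0// => H; nra.
Qed.

(** Fatou's lemma for the squares of the Riemann sums. Their lower limit serves as
    Q: it is measurable everywhere, while the square of the path integral agrees
    with it only almost surely. *)
Lemma path_integral_sqr (X : R -> T -> R) (t h c : R) : 0 < h ->
  (forall r : R, t <= r <= t + h -> measurable_fun setT (X r)) ->
  {ae P, forall w, {within `[t, t + h], continuous (X^~ w)}} ->
  (forall r : R, t <= r <= t + h -> (\int[P]_w (X r w ^+ 2)%:E <= c%:E)%E) ->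
  exists Q : T -> R, [/\ measurable_fun setT Q, forall w, 0 <= Q w,
    {ae P, forall w, (\int[mu]_(r in `[t, t + h]) X r w) ^+ 2 <= Q w} &
    (\int[P]_w (Q w)%:E <= (c * h ^+ 2)%:E)%E].
Proof.
move=> h0 mX cX EX.
pose r (n i : nat) : R := t + h / n.+1%:R * i%:R.
have rI n (i : 'I_n.+1) : t <= r n i <= t + h.
  have dn : 0 <= h / n.+1%:R by rewrite divr_ge0// ltW.
  rewrite /r lerDl mulr_ge0//= lerD2l mulrAC ler_pdivrMr ?ltr0n//.
  by rewrite ler_pM2l// ler_nat ltnW.
pose S n w : R := \sum_(i < n.+1) h / n.+1%:R * X (r n i) w.
have mS n : measurable_fun setT (S n).
  apply: measurable_sum => i; apply: measurable_funM => //; exact: mX.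
have mS2 n : measurable_fun setT (fun w => (S n w ^+ 2)%:E).
  by apply/measurable_EFinP; apply: measurable_funX.
pose L w : \bar R := limn_einf (fun n => (S n w ^+ 2)%:E).
have mL : measurable_fun setT L.
  rewrite (_ : L = (fun w => - limn_esup (fun n => - (S n w ^+ 2)%:E))%E); last first.
    apply/funext => w; rewrite /L -[in LHS](oppeK (limn_einf _)) -limn_esupN.
    by [].
  apply: measurableT_comp => //; apply: measurable_fun_limn_esup => n.
  by apply: measurableT_comp.
have LE : {ae P, forall w, L w = ((\int[mu]_(r in `[t, t + h]) X r w) ^+ 2)%:E}.
  apply: filterS cX => w cw.
  have tth : t < t + h by rewrite ltrDl.
  have /= H := riemann_sum_cvg tth cw.
  rewrite /L; have [] := @cvg_limn_einf_sup _ (fun n => (S n w ^+ 2)%:E) ((\int[mu]_(r in `[t, t + h]) X r w) ^+ 2)%:E => //.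
  apply: cvg_EFin; first by near=> n.
  apply: (@cvg_comp _ _ _ (fun n => S n w) (fun x => x ^+ 2)); last exact: exprn_continuous.
  by move: H; rewrite (_ : t + h - t = h)//; ring.
have L0 w : (0 <= L w)%E.
  rewrite /L limn_einf_lim; apply: lime_ge; first exact: is_cvg_einfs.
  near=> n; apply: le_ereal_inf_tmp => _ [m _ <-]; rewrite lee_fin; exact: sqr_ge0.
exists (fine \o L); split.
- by apply: measurableT_comp.
- by move=> w /=; apply: fine_ge0.
- by apply: filterS LE => w /= ->.
rewrite (@ge0_ae_eq_integral _ _ _ P setT _ L)//; last 3 first.
- by apply/measurable_EFinP; apply: measurableT_comp.
- by move=> w _; rewrite lee_fin; apply: fine_ge0.
- by apply: filterS LE => w /= E _; rewrite E.
apply: (le_trans (fatou _ _ _ _)) => //.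
  by move=> n w _; rewrite lee_fin sqr_ge0.
rewrite limn_einf_lim; apply: lime_le; first exact: is_cvg_einfs.
near=> n.
apply: (@le_trans _ _ (\int[P]_w (S n w ^+ 2)%:E)%E).
  by apply: ereal_inf_lbound; exists n => /=.
have hn : 0 <= h / n.+1%:R by rewrite divr_ge0// ltW.
apply: (@le_trans _ _ (\int[P]_w ((h * (h / n.+1%:R))%:E * \sum_(i < n.+1) (X (r n i) w ^+ 2)%:E))%E).
  apply: ge0_le_integral => //.
  - by move=> w _; rewrite lee_fin sqr_ge0.
  - apply: measurable_funeM; apply: emeasurable_sum => i.
    by apply/measurable_EFinP; apply: measurable_funX; exact: mX.
  - move=> w _; rewrite sumEFin -EFinM lee_fin /S -mulr_sumr exprMn.
    have := sqr_sum_le (fun i => X (r n i) w) n.+1.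
    have n0 : (0 : R) < n.+1%:R by rewrite ltr0n.
    move: (\sum_(i < _) _) (\sum_(i < _) _) n0 => a b; move: n.+1%:R => m m0 ab.
    have -> : h * (h / m) * a = (h / m) ^+ 2 * (m * a) by field; exact: lt0r_neq0.
    by rewrite ler_wpM2l// sqr_ge0.
have mXi (i : 'I_n.+1) : measurable_fun setT (fun w => (X (r n i) w ^+ 2)%:E).
  by apply/measurable_EFinP; apply: measurable_funX; exact: mX.
rewrite ge0_integralZl//; last 3 first.
- exact: emeasurable_sum.
- by move=> w _; apply: sume_ge0 => i _; rewrite lee_fin sqr_ge0.
- by rewrite lee_fin mulr_ge0// ltW.
rewrite ge0_integral_sum//; last by move=> i w _; rewrite lee_fin sqr_ge0.
apply: (@le_trans _ _ ((h * (h / n.+1%:R))%:E * \sum_(i < n.+1) c%:E)%E).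
  apply: lee_wpmul2l; first by rewrite lee_fin mulr_ge0// ltW.
  by apply: lee_sum => i _; exact: EX.
rewrite sumEFin -EFinM lee_fin sumr_const card_ord -[c *+ _]mulr_natr.
have : (0 : R) < n.+1%:R by rewrite ltr0n.
move: n.+1%:R => m m0; rewrite le_eqVlt; apply/orP; left; apply/eqP; field.
exact: lt0r_neq0.
Unshelve. all: end_near. Qed.

End square_of_a_path_integral.

(** * Increments of the Wiener process *)

Section wiener_increments.
Context {d : measure_display} {T : measurableType d} {R : realType}.
Variable P : probability T R.

(** Measurability with respect to a sub-sigma-algebra, without changing the
    measurable structure of T. *)
Definition measurable_for (G : set (set T)) (X : T -> R) :=
  forall B : set R, measurable B -> G (X @^-1` B).

Lemma measurable_for_comp2 (G : set (set T)) (X Y : T -> R) (f : R * R -> R) :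
  sigma_algebra setT G -> measurable_for G X -> measurable_for G Y ->
  measurable_fun setT f -> measurable_for G (fun w => f (X w, Y w)).
Proof.
move=> sG mX mY mf B mB.
have mG (Z : T -> R) : measurable_for G Z ->
    measurable_fun setT (Z : g_sigma_algebraType G -> R).
  move=> mZ _ A mA; rewrite setTI /measurable/= sigma_algebra_id//.
  exact: mZ.
have : measurable_fun setT (fun w : g_sigma_algebraType G => (X w, Y w)).
  by apply/measurable_fun_pairP; split; exact: mG.
move=> /(measurableT_comp mf) /(_ measurableT B mB).
by rewrite setTI /measurable/= sigma_algebra_id.
Qed.

Variables (F : R -> set (set T)) (W : R -> T -> R).
Hypotheses (hF : filtration F) (hW : wiener_process P F W).

Lemma adapted_measurable X t : 0 <= t -> adapted F X -> measurable_fun setT (X t).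
Proof.
move=> t0 aX _ B mB; rewrite setTI; have [_ + _] := hF.
by move/(_ t t0); apply; exact: aX.
Qed.

Lemma measurable_wiener t : 0 <= t -> measurable_fun setT (W t).
Proof. by move=> t0; exact: adapted_measurable (wiener_adapted hW). Qed.

Definition increment (t h : R) : T -> R := W (t + h) \- W t.

Lemma measurable_increment t h : 0 <= t -> 0 <= h -> measurable_fun setT (increment t h).
Proof.
by move=> t0 h0; apply: measurable_funB; apply: measurable_wiener => //; exact: addr_ge0.
Qed.

Lemma integral_increment t h (f : R -> R) : 0 <= t -> 0 < h ->
  measurable_fun setT f -> (forall x, 0 <= f x) ->
  (\int[P]_w (f (increment t h w))%:E = \int[normal_prob 0 (Num.sqrt h)]_x (f x)%:E)%E.
Proof.
move=> t0 h0 mf f0.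
have mY : @measurable_fun _ _ T (measurableTypeR R) setT (increment t h).
  by move=> ? A mA; exact: measurable_increment (ltW h0) _ _ mA.
pose Y : {mfun T >-> measurableTypeR R} := HB.pack (increment t h : T -> measurableTypeR R) (isMeasurableFun.Build _ _ _ _ _ mY).
transitivity (\int[distribution P Y]_x (f x)%:E)%E.
  rewrite (@ge0_integral_distribution _ _ _ (measurableTypeR R) R P Y (EFin \o f))//.
  by move=> ? A mA; have /measurable_EFinP := mf; exact.
have E (A : set (measurableTypeR R)) : measurable A -> A `<=` setT ->
    distribution P Y A = normal_prob 0 (Num.sqrt h) A.
  move=> mA _; have tth : t < t + h by rewrite ltrDl.
  rewrite /distribution/= /pushforward /=.
  have := wiener_gaussian hW t0 tth mA.
  by rewrite (_ : t + h - t = h)//; ring.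
by rewrite (@eq_measure_integral _ (measurableTypeR R) R setT
  [the probability _ _ of normal_prob 0 (Num.sqrt h)] (distribution P Y) _ E).
Qed.

Lemma integral_increment_sqr t h : 0 <= t -> 0 < h ->
  (\int[P]_w (increment t h w ^+ 2)%:E = h%:E)%E.
Proof.
move=> t0 h0; rewrite (integral_increment (f := fun x => x ^+ 2) t0 h0)//; last first.
  by move=> x; exact: sqr_ge0.
by rewrite integral_normal_sqr ?sqrtr_gt0// sqr_sqrtr// ltW.
Qed.

Lemma integral_increment_cube t h : 0 <= t -> 0 < h ->
  (\int[P]_w (`|increment t h w| ^+ 3)%:E <= (2 * Num.sqrt h ^+ 3)%:E)%E.
Proof.
move=> t0 h0; rewrite (integral_increment (f := fun x => `|x| ^+ 3) t0 h0)//; last 1 first.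
- by apply: measurable_funX; exact: normr_measurable.
- by apply: integral_normal_cube; rewrite sqrtr_gt0.
Qed.

Lemma increment_independent t h (X : T -> R) : 0 <= t -> 0 < h ->
  measurable_for (F t) X -> independent_pair P X (increment t h).
Proof.
move=> t0 h0 mX A B mA mB; have tth : t < t + h by rewrite ltrDl.
exact: (wiener_independent hW t0 tth (mX A mA) mB).
Qed.

Section martingale_terms.
Variables (t h : R) (X : T -> R).
Hypotheses (t0 : 0 <= t) (h0 : 0 < h) (mX : measurable_for (F t) X).
Hypothesis iX : P.-integrable setT (EFin \o X).

Let mXT : measurable_fun setT X.
Proof. by have /measurable_int/measurable_EFinP := iX. Qed.

Let X_abs : (\int[P]_w `|X w|%:E < +oo)%E.
Proof. by have /integrableP[_] := iX. Qed.

(** The two terms of a second order expansion that are of order sqrt h and h have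
    mean 0, because their first factor depends on the past only. *)
Lemma integral_mul_increment :
  P.-integrable setT (fun w => (X w * increment t h w)%:E) /\
  (\int[P]_w (X w * increment t h w)%:E = 0)%E.
Proof.
apply: (@integral_independent0 _ _ _ P X (increment t h) id).
- by [].
- exact: measurable_increment (ltW h0).
- exact: increment_independent.
- by [].
- exact: X_abs.
- rewrite (integral_increment (f := fun x => Num.max x 0) t0 h0).
  + by rewrite integral_normal_pos ?sqrtr_gt0.
  + exact: measurable_maxr.
  + by move=> x; rewrite le_max lexx orbT.
- rewrite (integral_increment (f := fun x => Num.max (- x) 0) t0 h0).
  + by rewrite integral_normal_neg ?sqrtr_gt0.
  + by apply: measurable_maxr => //; exact: measurableT_comp.
  + by move=> x; rewrite le_max lexx orbT.
Qed.

Lemma integral_mul_compensated_square :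
  P.-integrable setT (fun w => (X w * (increment t h w ^+ 2 - h))%:E) /\
  (\int[P]_w (X w * (increment t h w ^+ 2 - h))%:E = 0)%E.
Proof.
pose pos (x : R) := Num.max (x ^+ 2 - h) 0.
pose neg (x : R) := Num.max (- (x ^+ 2 - h)) 0.
have mY := measurable_increment t0 (ltW h0).
have msq : measurable_fun setT (fun x : R => x ^+ 2 - h).
  by apply: measurable_funB => //; exact: measurable_funX.
have mpos : measurable_fun setT pos by exact: measurable_maxr.
have mneg : measurable_fun setT neg by apply: measurable_maxr => //; exact: measurableT_comp.
have pos0 x : 0 <= pos x by rewrite le_max lexx orbT.
have neg0 x : 0 <= neg x by rewrite le_max lexx orbT.
have negh x : neg x <= h.
  by rewrite ge_max (ltW h0) andbT; have := sqr_ge0 x; lra.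
pose A := (\int[P]_w (pos (increment t h w))%:E)%E.
pose B := (\int[P]_w (neg (increment t h w))%:E)%E.
have mp : measurable_fun setT (fun w => (pos (increment t h w))%:E).
  by apply/measurable_EFinP; exact: measurableT_comp.
have mn : measurable_fun setT (fun w => (neg (increment t h w))%:E).
  by apply/measurable_EFinP; exact: measurableT_comp.
have Bh : (B <= h%:E)%E.
  apply: (@le_trans _ _ (\int[P]_w h%:E)%E).
    by apply: ge0_le_integral => // w _; rewrite lee_fin.
  by rewrite integral_cst//= probability_setT mule1.
(* positive and negative part have the same integral since E Y^2 = h *)
have AB : (A + h%:E = B + h%:E)%E.
  rewrite -[in RHS](integral_increment_sqr t0 h0).
  have -> : h%:E = (\int[P]_w h%:E)%E by rewrite integral_cst//= probability_setT mule1.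
  have nn (g : R -> R) : (forall x, 0 <= g x) ->
      forall w, setT w -> (0 <= (g (increment t h w))%:E)%E by move=> g0 w _; rewrite lee_fin.
  have nh w : setT w -> ((0 : \bar R) <= (cst h%:E) (w : T))%E by rewrite lee_fin ltW.
  rewrite /A /B -(ge0_integralD _ _ (nn _ pos0) mp nh)//.
  rewrite -(ge0_integralD _ _ (nn _ neg0) mn (nn _ (@sqr_ge0 _)))//; last first.
    by apply/measurable_EFinP; exact: measurable_funX.
  apply: eq_integral => w _; rewrite -!EFinD; congr EFin.
  rewrite /pos /neg; case: (leP (increment t h w ^+ 2) h) => H.
    by rewrite max_r ?max_l; lra.
  by rewrite max_l ?max_r; lra.
have Bf : B \is a fin_num.
  rewrite ge0_fin_numE; first exact: le_lt_trans Bh (ltry _).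
  by apply: integral_ge0 => w _; rewrite lee_fin.
have AB' : A = B.
  by move: AB => /(congr1 (fun z => z - h%:E)%E); rewrite !addeK.
apply: (@integral_independent0 _ _ _ P X (increment t h) (fun x => x ^+ 2 - h) (fine B)) => //.
- exact: increment_independent.
- by rewrite fineK// -AB'.
- by rewrite fineK.
Qed.

End martingale_terms.

Lemma integral_mul_function_of_increment t h (X : T -> R) (f g : R -> R) : 0 <= t -> 0 < h ->
  measurable_for (F t) X -> measurable_fun setT X ->
  measurable_fun setT f -> measurable_fun setT g ->
  (forall x, 0 <= f x) -> (forall x, 0 <= g x) ->
  (\int[P]_w (f (X w) * g (increment t h w))%:E =
   \int[P]_w (f (X w))%:E * \int[P]_w (g (increment t h w))%:E)%E.
Proof.
move=> t0 h0 aX mX mf mg f0 g0; apply: integral_independentM => //.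
- exact: measurable_increment (ltW h0).
- exact: increment_independent.
Qed.

End wiener_increments.

(** * Paths of the velocity *)

Section path_estimates.
Context {R : realType}.
Local Notation mu := (@lebesgue_measure R).

Lemma integrable_segmentB (f g : R -> R) a b : mu.-integrable `[a, b] (EFin \o f) ->
  mu.-integrable `[a, b] (EFin \o g) -> mu.-integrable `[a, b] (EFin \o (fun x => f x - g x)).
Proof.
move=> fi gi; rewrite (_ : EFin \o _ = (EFin \o f) \- (EFin \o g))%E//.
exact: integrableB.
Qed.

Lemma integrable_segmentD (f g : R -> R) a b : mu.-integrable `[a, b] (EFin \o f) ->
  mu.-integrable `[a, b] (EFin \o g) -> mu.-integrable `[a, b] (EFin \o (fun x => f x + g x)).
Proof.
move=> fi gi; rewrite (_ : EFin \o _ = (EFin \o f) \+ (EFin \o g))%E//.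
exact: integrableD.
Qed.

Lemma integrable_segmentZ (f : R -> R) a b c : mu.-integrable `[a, b] (EFin \o f) ->
  mu.-integrable `[a, b] (EFin \o (fun x => c * f x)).
Proof.
move=> fi; rewrite (_ : EFin \o _ = (fun x => c%:E * (EFin \o f) x))%E//.
exact: integrableZl.
Qed.

End path_estimates.

Section path_estimates.
Context {R : realType}.
Local Notation mu := (@lebesgue_measure R).
Variables (u : R -> R) (t h : R).
Hypotheses (cu : {within `[0, +oo[, continuous u}) (t0 : 0 <= t) (h0 : 0 <= h).

Lemma continuous_path_segment a b : 0 <= a -> {within `[a, b], continuous u}.
Proof.
move=> a0; apply: continuous_subspaceW cu => x /=.
by rewrite !in_itv/= andbT => /andP[/(le_trans a0)].
Qed.

Let tth : t <= t + h. Proof. by rewrite lerDl. Qed.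

Lemma integrable_sgr_path a b : 0 <= a ->
  mu.-integrable `[a, b] (EFin \o (fun r => Num.sg (u r))).
Proof.
move=> a0; apply: measurable_bounded_integrable => //.
- by apply: compact_finite_measure; exact: segment_compact.
- apply: (@measurable_comp _ _ _ _ _ _ setT) => //; first exact: measurable_sgr.
  apply: subspace_continuous_measurable_fun => //; exact: continuous_path_segment.
- exists 1; split => //= M M1 x _; apply: le_trans (ltW M1).
  by rewrite normr_sg; case: (_ != _).
Qed.

Lemma continuous_comp_path (g : R -> R) a b : 0 <= a -> continuous g ->
  {within `[a, b], continuous (fun r => g (u r))}.
Proof.
move=> a0 cg x.
by apply: (@cvg_comp _ _ _ u g); [exact: continuous_path_segment a0 x|exact: cg].
Qed.

Lemma integrable_comp_path (g : R -> R) a b : 0 <= a -> continuous g ->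
  mu.-integrable `[a, b] (EFin \o (fun r => g (u r))).
Proof.
by move=> a0 cg; apply: continuous_segment_integrable; exact: continuous_comp_path.
Qed.

Lemma continuous_distance (y : R) : continuous (fun x : R => `|x - y|).
Proof.
move=> x; apply: (@cvg_comp _ _ _ (fun x => x - y) (fun x => `|x|)); last exact: norm_continuous.
by apply: cvgB; [exact: cvg_id|exact: cvg_cst].
Qed.

(** The error made by freezing the velocity at its value at time t, for any drift
    that is Lipschitz in the velocity. *)
Definition deviation : R := \int[mu]_(r in `[t, t + h]) `|u r - u t|.

Let integrable_deviation :
  mu.-integrable `[t, t + h] (EFin \o (fun r => `|u r - u t|)).
Proof.
exact: (integrable_comp_path _ t0 (@continuous_distance (u t))).
Qed.

Lemma deviation_ge0 : 0 <= deviation.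
Proof. by apply: Rintegral_ge0. Qed.

Let integrable_cst_segment (c : R) : mu.-integrable `[t, t + h] (EFin \o (fun=> c)).
Proof. by apply: continuous_segment_integrable; apply: continuous_subspaceT => x; exact: cvg_cst. Qed.

Lemma lipschitz_deviation (g : R -> R) : (forall x y, `|g x - g y| <= `|x - y|) ->
  `|\int[mu]_(r in `[t, t + h]) g (u r) - h * g (u t)| <= deviation.
Proof.
move=> lg; have cg : continuous g.
  move=> x; apply/cvgrPdist_le => e e0; near=> y.
  apply: (le_trans (lg _ _)); near: y; exact: cvgr_dist_le.
have ig := integrable_comp_path (t + h) t0 cg.
rewrite (_ : h * g (u t) = \int[mu]_(r in `[t, t + h]) g (u t)); last first.
  by rewrite Rintegral_segment_cst//; ring.
rewrite -RintegralB//.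
have iB : mu.-integrable `[t, t + h] (EFin \o (fun r => g (u r) - g (u t))).
  exact: integrable_segmentB.
apply: (le_trans (le_normr_Rintegral _ iB)) => //.
apply: le_Rintegral => //.
by have := integrable_norm iB.
Unshelve. all: end_near. Qed.

Lemma integral_sgr_path_le : `|\int[mu]_(r in `[t, t + h]) Num.sg (u r)| <= h.
Proof.
have := @le_norm_Rintegral_segment R (fun r => Num.sg (u r)) t (t + h) 1 tth
  (integrable_sgr_path (t + h) t0).
rewrite mul1r (_ : t + h - t = h); last by ring.
by apply=> x _; rewrite normr_sg; case: (_ != _).
Qed.

(** The sign can differ from its frozen value only if the velocity was within e of
    0, or if it has moved by more than e; in the latter case the difference is at
    most 2 |u r - u t| / e. *)
Lemma sgr_deviation (e : R) : 0 < e ->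
  `|\int[mu]_(r in `[t, t + h]) Num.sg (u r) - h * Num.sg (u t)|
    <= 2 * h * (`|u t| <= e)%R%:R + 2 / e * deviation.
Proof.
move=> e0; have ig := integrable_sgr_path (t + h) t0.
rewrite (_ : h * Num.sg (u t) = \int[mu]_(r in `[t, t + h]) Num.sg (u t)); last first.
  by rewrite Rintegral_segment_cst//; ring.
rewrite -RintegralB//.
have iB : mu.-integrable `[t, t + h] (EFin \o (fun r => Num.sg (u r) - Num.sg (u t))).
  exact: integrable_segmentB.
apply: (le_trans (le_normr_Rintegral _ iB)) => //.
pose c : R := 2 * (`|u t| <= e)%R%:R.
have iZ : mu.-integrable `[t, t + h] (EFin \o (fun r => 2 / e * `|u r - u t|)).
  exact: integrable_segmentZ.
have iS : mu.-integrable `[t, t + h] (EFin \o (fun r => c + 2 / e * `|u r - u t|)).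
  exact: integrable_segmentD.
apply: (@le_trans _ _ (\int[mu]_(r in `[t, t + h]) (c + 2 / e * `|u r - u t|))).
  apply: le_Rintegral => //; first by have := integrable_norm iB.
  move=> r _; rewrite /c.
  have s1 (x : R) : `|Num.sg x| <= 1 by rewrite normr_sg; case: (_ != _).
  have d2 : `|Num.sg (u r) - Num.sg (u t)| <= 2.
    by have := ler_normB (Num.sg (u r)) (Num.sg (u t)); have := s1 (u r); have := s1 (u t); lra.
  have q0 : 0 <= 2 / e * `|u r - u t| by rewrite mulr_ge0// divr_ge0// ltW.
  have [ue|ue] := leP `|u t| e; first by rewrite mulr1; lra.
  rewrite mulr0 add0r; have [->|ne] := eqVneq (Num.sg (u r)) (Num.sg (u t)).
    by rewrite subrr normr0.
  apply: (le_trans d2); rewrite mulrAC ler_pdivlMr// ler_pM2l//.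
  apply: (le_trans (ltW ue)).
  have [tp|tn|tz] := ltgtP (u t) 0; last by move: ue; rewrite tz normr0; lra.
  - rewrite ltr0_norm//; have : 0 <= u r.
      by rewrite leNgt; apply: contra_neqN ne => rn; rewrite !ltr0_sg.
    by move=> ?; rewrite ger0_norm; lra.
  - rewrite gtr0_norm//; have : u r <= 0.
      by rewrite leNgt; apply: contra_neqN ne => rn; rewrite !gtr0_sg.
    by move=> ?; rewrite ler0_norm; lra.
rewrite RintegralD// Rintegral_segment_cst// RintegralZl// /c.
by rewrite (_ : t + h - t = h) /deviation; lra.
Qed.

End path_estimates.

Section friction_paths.
Context {d : measure_display} {T : measurableType d} {R : realType}.
Variable P : probability T R.
Variables (F : R -> set (set T)) (W U : R -> T -> R) (tau0 : R).
Local Notation mu := (@lebesgue_measure R).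
Hypotheses (hF : filtration F) (hW : wiener_process P F W).
Hypotheses (aU : adapted F U) (cU : as_continuous P U).
Hypothesis dU : solves_sde P (fun u => - 2 * Num.sg u)
  (fun s => heaviside (tau0 - s) * Num.sqrt 2) W U.

(** Up to time tau0 the integrand is the constant sqrt 2 and the left sums
    telescope: a constant sequence that converges in probability is almost surely
    equal to its limit. *)
Lemma driving_noise (M : T -> R) (t : R) : 0 <= t -> t <= tau0 ->
  is_stochastic_integral P (fun s => heaviside (tau0 - s) * Num.sqrt 2) W t M ->
  {ae P, forall w, M w = Num.sqrt 2 * (W t w - W 0 w)}.
Proof.
move=> t0 tT [mM Mcv].
have sumE n w : left_riemann_sum (fun s => heaviside (tau0 - s) * Num.sqrt 2) W t n w =
    Num.sqrt 2 * (W t w - W 0 w).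
  rewrite /left_riemann_sum.
  under eq_bigr => k _.
    rewrite /heaviside (_ : 0 <= tau0 - _); last first.
      rewrite subr_ge0; apply: le_trans tT; rewrite ler_pdivrMr ?ltr0n//.
      by rewrite ler_wpM2l// ler_nat ltnW.
    rewrite mul1r; over.
  rewrite -mulr_sumr; congr (_ * _).
  rewrite -(big_mkord xpredT (fun k => W (t * k.+1%:R / n.+1%:R) w - W (t * k%:R / n.+1%:R) w)).
  rewrite telescope_sumr// mulr0 mul0r mulfK ?pnatr_eq0//.
pose c w := Num.sqrt 2 * (W t w - W 0 w).
have null (e : R) : 0 < e -> P [set w | e <= `|c w - M w|] = 0%E.
  move=> e0; have := Mcv e e0.
  rewrite (_ : (fun n => _) = (fun=> P [set w | e <= `|c w - M w|])); last first.
    by apply/funext => n; congr (P _); apply/seteqP; split=> w /=; rewrite sumE.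
  by move/cvg_lim => <-//; rewrite lim_cst.
have mc : measurable_fun setT (fun w => `|c w - M w|).
  apply: measurableT_comp => //; apply: measurable_funB => //.
  apply: measurable_funM => //; apply: measurable_funB; exact: (measurable_wiener hF hW).
have : P.-negligible (\bigcup_n [set w | n.+1%:R^-1 <= `|c w - M w|]).
  apply: negligible_bigcup => n; apply/negligibleP.
    by rewrite -[X in measurable X]setTI; apply: measurable_fun_le.
  by apply: null; rewrite invr_gt0 ltr0n.
apply: negligibleS => w /= /eqP; rewrite eq_sym -subr_eq0 -normr_gt0 => cM.
have [n Hn] := ltr_add_invr cM; exists n => //=.
by rewrite add0r in Hn; exact: ltW.
Qed.

Lemma velocity_increment (t h : R) : 0 <= t -> 0 <= h -> t + h <= tau0 ->
  {ae P, forall w, {within `[0, +oo[, continuous (U^~ w)} /\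
    U (t + h) w - U t w =
    - 2 * \int[mu]_(r in `[t, t + h]) Num.sg (U r w) + Num.sqrt 2 * increment W t h w}.
Proof.
move=> t0 h0 tT; have [M [MI MU]] := dU.
have th0 : 0 <= t + h by exact: addr_ge0.
have tle : t <= tau0 by apply: le_trans tT; rewrite lerDl.
have M1 := driving_noise t0 tle (MI t t0); have M2 := driving_noise th0 tT (MI _ th0).
apply: filterS3 (filterI cU MU) M1 M2 => w [cw Uw] E1 E2; split => //.
rewrite (Uw t t0) (Uw (t + h) th0) E1 E2 !RintegralZl//; try exact: integrable_sgr_path.
rewrite (@Rintegral_segmentD _ _ 0 t (t + h)) ?lerDl//; last exact: integrable_sgr_path.
by rewrite /increment /=; ring.
Qed.

Lemma measurable_velocity t : 0 <= t -> measurable_fun setT (U t).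
Proof. by move=> t0; exact: (adapted_measurable hF t0 aU). Qed.

Lemma velocity_increment_sqr (t h : R) : 0 <= t -> 0 <= h -> t + h <= tau0 ->
  (\int[P]_w (`|U (t + h) w - U t w| ^+ 2)%:E <= (8 * h ^+ 2 + 4 * h)%:E)%E.
Proof.
move=> t0; rewrite le_eqVlt => /predU1P[<- _|h0 tT].
  rewrite addr0; under eq_integral do rewrite subrr normr0 expr0n.
  by rewrite integral0 lee_fin; lra.
have mU : measurable_fun setT (fun w => U (t + h) w - U t w).
  by apply: measurable_funB; apply: measurable_velocity => //; apply: addr_ge0 => //; exact: ltW.
have mY := measurable_increment hF hW t0 (ltW h0).
apply: (@le_trans _ _ (\int[P]_w ((8 * h ^+ 2)%:E + 4%:E * (increment W t h w ^+ 2)%:E))%E).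
  apply: ae_ge0_le_integral.
  - exact: measurableT.
  - by move=> w _; rewrite lee_fin sqr_ge0.
  - by apply/measurable_EFinP; apply: measurable_funX; exact: measurableT_comp.
  - by move=> w _; rewrite -EFinM -EFinD lee_fin addr_ge0// mulr_ge0// sqr_ge0.
  - apply: emeasurable_funD => //; apply: measurable_funeM; apply/measurable_EFinP.
    exact: measurable_funX.
  apply: filterS (velocity_increment t0 (ltW h0) tT) => w [cw E] _.
  rewrite -EFinM -EFinD lee_fin E real_normK ?num_real//.
  have := integral_sgr_path_le cw t0 (ltW h0).
  set D := Rintegral _ _ _; rewrite ler_norml => /andP[D1 D2].
  have : D ^+ 2 <= h ^+ 2 by nra.
  have := sqr_ge0 (2 * D + Num.sqrt 2 * increment W t h w).
  have : Num.sqrt 2 ^+ 2 = 2 :> R by rewrite sqr_sqrtr.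
  move: (Num.sqrt 2) (increment W t h w) => s y s2.
  by rewrite !expr2 in s2 *; nra.
have nn w : setT w -> (0 <= (increment W t h w ^+ 2)%:E)%E.
  by move=> _; rewrite lee_fin sqr_ge0.
have mY2 : measurable_fun setT (fun w => (increment W t h w ^+ 2)%:E).
  by apply/measurable_EFinP; exact: measurable_funX.
rewrite (ge0_integralD P measurableT); first last.
- exact: measurable_funeM.
- by move=> w /nn H; rewrite mule_ge0.
- exact: measurable_cst.
- by move=> w _; rewrite lee_fin mulr_ge0// sqr_ge0.
rewrite integral_cst//= probability_setT mule1 ge0_integralZl_EFin//.
by rewrite (integral_increment_sqr hF hW)// -EFinM -EFinD lexx.
Qed.

Lemma deviation_sqr (t h : R) : 0 <= t -> 0 < h -> t + h <= tau0 ->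
  exists Q : T -> R, [/\ measurable_fun setT Q, forall w, 0 <= Q w,
    {ae P, forall w, deviation (U^~ w) t h ^+ 2 <= Q w} &
    (\int[P]_w (Q w)%:E <= ((8 * h ^+ 2 + 4 * h) * h ^+ 2)%:E)%E].
Proof.
move=> t0 h0 tT.
apply: (@path_integral_sqr _ _ _ P (fun r w => `|U r w - U t w|)) => //.
- move=> r /andP[tr _]; apply: measurableT_comp => //.
  by apply: measurable_funB; apply: measurable_velocity => //; exact: le_trans tr.
- apply: filterS cU => w cw.
  exact: (continuous_comp_path cw t0 (@continuous_distance _ (U t w))).
- move=> r /andP[tr rh]; have r0 : 0 <= r - t by rewrite subr_ge0.
  have := @velocity_increment_sqr t (r - t) t0 r0.
  rewrite (_ : t + (r - t) = r); last by ring.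
  move=> /(_ (le_trans rh tT)) /le_trans; apply; rewrite lee_fin.
  by have : r - t <= h by [lra]; nra.
Qed.

End friction_paths.

(** * One step of the process, moments and small balls *)

Section friction_moments.
Context {d : measure_display} {T : measurableType d} {R : realType}.
Variable P : probability T R.
Variables (F : R -> set (set T)) (W U V : R -> T -> R) (g : R -> R) (tau0 : R).
Local Notation mu := (@lebesgue_measure R).
Hypotheses (hF : filtration F) (hW : wiener_process P F W).
Hypotheses (aU : adapted F U) (cU : as_continuous P U) (U0 : {ae P, forall w, U 0 w = 0}).
Hypothesis dU : solves_sde P (fun u => - 2 * Num.sg u)
  (fun s => heaviside (tau0 - s) * Num.sqrt 2) W U.
Hypotheses (aV : adapted F V) (V0 : {ae P, forall w, V 0 w = 0}) (dV : solves_ode P g U V).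
Hypotheses (g_lipschitz : forall x y, `|g x - g y| <= `|x - y|) (g0 : g 0 = 0).

Let continuous_g : continuous g.
Proof.
move=> x; apply/cvgrPdist_le => e e0; near=> y.
apply: (le_trans (g_lipschitz _ _)); near: y; exact: cvgr_dist_le.
Unshelve. all: end_near. Qed.

Lemma position_increment (t h : R) : 0 <= t -> 0 <= h ->
  {ae P, forall w, {within `[0, +oo[, continuous (U^~ w)} /\
    V (t + h) w - V t w = \int[mu]_(r in `[t, t + h]) g (U r w)}.
Proof.
move=> t0 h0; have th0 : 0 <= t + h by exact: addr_ge0.
apply: filterS2 cU dV => w cw Vw; split => //.
rewrite (Vw t t0) (Vw (t + h) th0).
rewrite (@Rintegral_segmentD _ _ 0 t (t + h)) ?lerDl//; first by ring.
exact: (integrable_comp_path cw).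
Qed.

(** Here j is the deviation of the velocity over the step; only its square occurs
    later on, and Q bounds it with a mean of order h^3. *)
Lemma one_step (t h : R) : 0 <= t -> 0 < h -> t + h <= tau0 ->
  exists Q : T -> R, [/\ measurable_fun setT Q, forall w, 0 <= Q w,
    (\int[P]_w (Q w)%:E <= ((8 * h ^+ 2 + 4 * h) * h ^+ 2)%:E)%E &
    {ae P, forall w, exists j, [/\ 0 <= j, j ^+ 2 <= Q w,
      `|U (t + h) w - U t w - Num.sqrt 2 * increment W t h w| <= 2 * h,
      forall e, 0 < e -> `|U (t + h) w - U t w - Num.sqrt 2 * increment W t h w
         + 2 * h * Num.sg (U t w)| <= 4 * h * (`|U t w| <= e)%R%:R + 4 / e * j &
      `|V (t + h) w - V t w - h * g (U t w)| <= j]}].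
Proof.
move=> t0 h0 tT; have [Q [mQ Q0 QJ iQ]] := deviation_sqr hF hW aU cU dU t0 h0 tT.
exists Q; split => //.
have H1 := velocity_increment hF hW cU dU t0 (ltW h0) tT.
have H2 := position_increment t0 (ltW h0).
apply: filterS3 QJ H1 H2 => w jQ [cw EU] [_ EV].
have n2 : `|-2 : R| = 2 by rewrite normrN ger0_norm.
exists (deviation (U^~ w) t h); split => //.
- exact: deviation_ge0.
- rewrite EU addrK normrM n2.
  by have := integral_sgr_path_le cw t0 (ltW h0); lra.
- move=> e e0; rewrite EU.
  have := sgr_deviation cw t0 (ltW h0) e0.
  set S := Rintegral _ _ _ => H.
  have -> : -2 * S + Num.sqrt 2 * increment W t h w - Num.sqrt 2 * increment W t h w +
    2 * h * Num.sg (U t w) = - 2 * (S - h * Num.sg (U t w)) by ring.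
  rewrite normrM n2.
  have -> : 4 / e * deviation (U^~ w) t h = 2 * (2 / e * deviation (U^~ w) t h) by ring.
  by lra.
- by rewrite EV; exact: (lipschitz_deviation cw t0 (ltW h0)).
Qed.

Lemma measurable_position t : 0 <= t -> measurable_fun setT (V t).
Proof. by move=> t0; exact: (adapted_measurable hF t0 aV). Qed.

Lemma velocity_sqr t : 0 <= t -> t <= tau0 ->
  (\int[P]_w (U t w ^+ 2)%:E <= (8 * t ^+ 2 + 4 * t)%:E)%E.
Proof.
move=> t0 tT; have := @velocity_increment_sqr _ _ _ P F W U tau0 hF hW aU cU dU 0 t (lexx 0) t0.
rewrite add0r => /(_ tT); apply: le_trans.
have mU := measurable_velocity hF aU t0.
have mU0 := measurable_velocity hF aU (lexx 0).
rewrite (@ge0_ae_eq_integral _ _ _ P setT (fun w => (U t w ^+ 2)%:E)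
  (fun w => (`|U t w - U 0 w| ^+ 2)%:E))//.
- by apply/measurable_EFinP; exact: measurable_funX.
- apply/measurable_EFinP; apply: measurable_funX; apply: measurableT_comp => //.
  exact: measurable_funB.
- by move=> w _; rewrite lee_fin sqr_ge0.
- by apply: filterS U0 => w /= -> _; rewrite subr0 real_normK ?num_real.
Qed.

Lemma position_sqr t : 0 <= t -> t <= tau0 ->
  (\int[P]_w (V t w ^+ 2)%:E <= ((8 * t ^+ 2 + 4 * t) * t ^+ 2)%:E)%E.
Proof.
move=> t0 tT; have mV := measurable_position t0.
have mV2 : measurable_fun setT (fun w => (V t w ^+ 2)%:E).
  by apply/measurable_EFinP; exact: measurable_funX.
have V2ge0 w : setT w -> (0 <= (V t w ^+ 2)%:E)%E by rewrite lee_fin sqr_ge0.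
move: t0; rewrite le_eqVlt => /predU1P[t00|t0].
  rewrite (@ge0_ae_eq_integral _ _ _ P setT _ (cst 0%E))//.
    by rewrite integral0 lee_fin -t00; lra.
  by apply: filterS V0 => w /= V0w _; rewrite -t00 V0w expr0n.
have := @one_step 0 t (lexx 0) t0; rewrite add0r => /(_ tT)[Q [mQ Q0 + H]].
apply: le_trans; apply: ae_ge0_le_integral => //.
- by move=> w _; rewrite lee_fin.
- exact/measurable_EFinP.
- apply: filterS3 H U0 V0 => w [j [j0 jQ _ _ Vj]] U0w V0w _.
  rewrite lee_fin; move: Vj; rewrite U0w V0w g0 mulr0 !subr0 => Vj.
  rewrite (le_trans _ jQ)// -real_normK ?num_real//.
  by rewrite lerXn2r ?nnegrE.
Qed.

(** the weight 1 + |V| + |U| bounds the growth of all the functions involved *)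
Definition weight t w : R := 1 + `|V t w| + `|U t w|.

Lemma weight_ge1 t w : 1 <= weight t w.
Proof. by rewrite /weight -addrA lerDl addr_ge0. Qed.

Lemma measurable_weight t : 0 <= t -> measurable_fun setT (weight t).
Proof.
move=> t0; apply: measurable_funD; first apply: measurable_funD => //.
  by apply: measurableT_comp => //; exact: measurable_position.
by apply: measurableT_comp => //; exact: (measurable_velocity hF aU).
Qed.

Lemma weight_sqr : exists2 K : R, 0 <= K & forall t, 0 <= t -> t <= tau0 ->
  (\int[P]_w (weight t w ^+ 2)%:E <= K%:E)%E.
Proof.
pose B := 8 * tau0 ^+ 2 + 4 * tau0.
exists (3 * (1 + `|B * tau0 ^+ 2| + `|B|)); first by rewrite mulr_ge0// !addr_ge0.
move=> t t0 tT.
have mV := measurable_position t0; have mU := measurable_velocity hF aU t0.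
have mV2 : measurable_fun setT (fun w => (V t w ^+ 2)%:E).
  by apply/measurable_EFinP; exact: measurable_funX.
have mU2 : measurable_fun setT (fun w => (U t w ^+ 2)%:E).
  by apply/measurable_EFinP; exact: measurable_funX.
apply: (@le_trans _ _ (\int[P]_w (3%:E * (1%:E + (V t w ^+ 2)%:E + (U t w ^+ 2)%:E)))%E).
  apply: ge0_le_integral => //.
  - by move=> w _; rewrite lee_fin sqr_ge0.
  - by apply/measurable_EFinP; apply: measurable_funX; exact: measurable_weight.
  - apply: measurable_funeM; apply: emeasurable_funD => //.
    exact: emeasurable_funD.
  - move=> w _; rewrite -!EFinD -EFinM lee_fin /weight.
    rewrite -[V t w ^+ 2]real_normK ?num_real// -[U t w ^+ 2]real_normK ?num_real//.
    move: `|V t w| `|U t w| => a b.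
    by have := sqr_ge0 (a - b); have := sqr_ge0 (1 - a); have := sqr_ge0 (1 - b); nra.
have n2 (X : T -> R) w : setT w -> (0 <= (X w ^+ 2)%:E)%E by rewrite lee_fin sqr_ge0.
rewrite ge0_integralZl_EFin//; first last.
- by apply: emeasurable_funD => //; exact: emeasurable_funD.
- by move=> w _; rewrite !adde_ge0 ?lee_fin ?sqr_ge0.
rewrite (ge0_integralD P measurableT _ _ (n2 (U t)) mU2); first last.
- exact: emeasurable_funD.
- by move=> w _; rewrite adde_ge0 ?lee_fin ?sqr_ge0.
rewrite (ge0_integralD P measurableT _ _ (n2 (V t)) mV2)//.
rewrite integral_cst//= probability_setT mule1 [leRHS]EFinM lee_pmul2l//.
have tt : t ^+ 2 <= tau0 ^+ 2 by rewrite lerXn2r ?nnegrE//; exact: le_trans tT.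
have Bt : 8 * t ^+ 2 + 4 * t <= B by rewrite /B; lra.
have B0 : 0 <= 8 * t ^+ 2 + 4 * t by have := sqr_ge0 t; lra.
rewrite !EFinD; apply: leeD; first apply: leeD => //.
- apply: le_trans (position_sqr t0 tT) _; rewrite lee_fin.
  by apply: le_trans (ler_norm _); apply: ler_pM => //; exact: sqr_ge0.
- apply: le_trans (velocity_sqr t0 tT) _; rewrite lee_fin.
  exact: le_trans (ler_norm _).
Qed.

(** The velocity at time t is within 2 del of the sum of its value at time t - del
    and of sqrt 2 times the increment in between, and the increment, which is
    independent of the past, has a density bounded by a multiple of
    1 / sqrt del. *)
Lemma velocity_small_ball (t del e : R) : 0 < del -> del <= t -> t <= tau0 -> 0 <= e ->
  (\int[P]_w ((`|U t w| <= e)%R%:R)%:E <= ((e + 2 * del) / Num.sqrt del)%:E)%E.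
Proof.
move=> del0 dt tT e0; pose s := t - del.
have s0 : 0 <= s by rewrite subr_ge0.
have sE : s + del = t by rewrite /s; ring.
have mU := measurable_velocity hF aU (le_trans (ltW del0) dt).
have mUs := measurable_velocity hF aU s0.
have mY := measurable_increment hF hW s0 (ltW del0).
pose r := e + 2 * del.
pose k (z : R * R) : R := (`|z.1 + Num.sqrt 2 * z.2| <= r)%R%:R.
have mk : measurable_fun setT k.
  apply: measurable_indicator_le; apply: measurableT_comp => //; apply: measurable_funD => //.
  exact: measurable_funM.
have XY : independent_pair P (U s) (increment W s del).
  by apply: (increment_independent hW) => //; exact: aU.
apply: (@le_trans _ _ (\int[P]_w (k (U s w, increment W s del w))%:E)%E).
  apply: ae_ge0_le_integral => //.
  - apply/measurable_EFinP; apply: measurable_indicator_le.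
    exact: measurableT_comp.
  - by move=> w _; rewrite lee_fin.
  - by apply/measurable_EFinP; apply: (measurableT_comp mk); exact/measurable_fun_pairP.
  - have := @velocity_increment _ _ _ P F W U tau0 hF hW cU dU s del s0 (ltW del0).
    rewrite sE => /(_ tT); apply: filterS => w [cw EU] _; rewrite lee_fin /k /=.
    have [Ue|_] := leP `|U t w| e; last by [].
    rewrite (_ : `|_| <= r)//.
    have := integral_sgr_path_le cw s0 (ltW del0).
    rewrite sE in EU *; move: EU; set S := Rintegral _ _ _ => EU S1.
    have -> : U s w + Num.sqrt 2 * increment W s del w = U t w + 2 * S by lra.
    apply: (le_trans (ler_normD _ _)); rewrite normrM [`|2|]ger0_norm// /r; lra.
rewrite (integral_independent mUs mY XY (h := fun z => (k z)%:E)); first last.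
- by move=> z; rewrite lee_fin.
- exact/measurable_EFinP.
have mkx x : measurable_fun setT (fun y => k (x, y)).
  rewrite /k/=; apply: measurable_indicator_le; apply: measurableT_comp => //; apply: measurable_funD => //.
have inner (x : R) : (\int[P]_w (k (x, increment W s del w))%:E <= (r / Num.sqrt del)%:E)%E.
  have s2 : 1 <= Num.sqrt 2 :> R by rewrite -[leLHS]sqrtr1 ler_sqrt//; lra.
  rewrite (integral_increment hF hW (f := fun y => k (x, y)) s0 del0)//.
  have sd : 0 < Num.sqrt del by rewrite sqrtr_gt0.
  have r0 : 0 <= r by rewrite /r; lra.
  apply: le_trans (normal_prob_ball sd (- x / Num.sqrt 2) r0).
  rewrite -[X in normal_prob _ _ X]setIT -integral_indic//.
  apply: ge0_le_integral => //.
  - by move=> y _; rewrite lee_fin.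
  - move=> ? A mA; have /measurable_EFinP := mkx x; exact.
  - by apply/measurable_EFinP; exact: measurable_indic.
  - move=> y _; rewrite lee_fin /k indicE /=.
    have [H|] := leP `|x + Num.sqrt 2 * y| r; last by [].
    rewrite mem_set//= in_itv/=.
    have s0' : 0 < Num.sqrt 2 :> R by lra.
    have : `|y - (- x / Num.sqrt 2)| <= r.
      rewrite -(ler_pM2l s0') -{1}[Num.sqrt 2]gtr0_norm// -normrM.
      have -> : Num.sqrt 2 * (y - - x / Num.sqrt 2) = x + Num.sqrt 2 * y.
        by field; exact: lt0r_neq0.
      by apply: (le_trans H); nra.
    by rewrite ler_distl.
apply: (@le_trans _ _ (\int[P]_w (r / Num.sqrt del)%:E)%E).
  apply: ge0_le_integral => //.
  - by move=> w _; apply: integral_ge0 => w' _; rewrite lee_fin.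
  - apply: (@measurableT_comp _ _ _ _ _ _ (fun x => \int[P]_w (k (x, increment W s del w))%:E)%E) => //.
    apply: (measurable_fun_fubini_tonelli_F (fun z => (k (z.1, increment W s del z.2))%:E)).
    + rewrite /k/=; apply/measurable_EFinP; apply: measurable_indicator_le; apply: measurableT_comp => //.
      apply: measurable_funD => //; apply: measurable_funM => //.
      exact: measurableT_comp.
    + by move=> z; rewrite lee_fin.
by rewrite integral_cst//= probability_setT mule1.
Qed.

End friction_moments.

(** * Error terms of one step *)

Section dual_step.
Context {R : realType}.

Lemma norm_mul_le (x y A B : R) : `|x| <= A -> `|y| <= B -> `|x * y| <= A * B.
Proof. by move=> xA yB; rewrite normrM ler_pM. Qed.

Lemma dual_class_weaken lo hi n (K K' : R) c cs cu cuu : K <= K' ->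
  dual_class lo hi n K c cs cu cuu -> dual_class lo hi n K' c cs cu cuu.
Proof.
move=> KK [H1 H2 H3 H4 H5 H6].
have w (x : R) : 0 <= x -> K * x <= K' * x by move=> x0; rewrite ler_wpM2r.
have pos (u : R) m : 0 <= (1 + `|u|) ^+ m by rewrite exprn_ge0// addr_ge0.
split => //.
- by move=> s u sI; rewrite (le_trans (H2 s u sI))// w.
- by move=> s u sI; rewrite (le_trans (H3 s u sI))// w.
- by move=> s u sI; rewrite (le_trans (H4 s u sI)).
- move=> s u v sI; rewrite (le_trans (H5 s u v sI))// w// addr_ge0// ?exprn_ge0//.
  by rewrite mulr_ge0 ?exprn_ge0// /crossing; case: (_ <= _).
- move=> s t u sI tI; rewrite (le_trans (H6 s t u sI tI))// -!mulrA w//.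
Qed.

Lemma sqrt2_le : Num.sqrt 2 <= 3 / 2 :> R.
Proof. by rewrite -[leRHS]ger0_norm// -sqrtr_sqr ler_sqrt//; lra. Qed.

Lemma displacement_powers (y D h : R) : 0 <= h -> `|D| <= 2 * h ->
  [/\ `|Num.sqrt 2 * y + D| <= 2 * h + 2 * `|y|,
    `|Num.sqrt 2 * y + D| ^+ 2 <= 8 * h ^+ 2 + 8 * `|y| ^+ 2 &
    `|Num.sqrt 2 * y + D| ^+ 3 <= 32 * (h ^+ 3 + `|y| ^+ 3)].
Proof.
move=> h0 D2; have Y0 : 0 <= `|y| := normr_ge0 y.
have dB : `|Num.sqrt 2 * y + D| <= 2 * h + 2 * `|y|.
  rewrite (le_trans (ler_normD _ _))// normrM (ger0_norm (sqrtr_ge0 _)) addrC lerD//.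
  by rewrite ler_wpM2r//; have := sqrt2_le; lra.
have B0 : 0 <= 2 * h + 2 * `|y| by lra.
split=> //.
- apply: (@le_trans _ _ ((2 * h + 2 * `|y|) ^+ 2)); first by rewrite lerXn2r ?nnegrE.
  by have := sqr_ge0 (h - `|y|); lra.
- apply: (@le_trans _ _ ((2 * h + 2 * `|y|) ^+ 3)); first by rewrite lerXn2r ?nnegrE.
  have : 0 <= (h + `|y|) * (h - `|y|) ^+ 2 by rewrite mulr_ge0 ?sqr_ge0//; lra.
  by lra.
Qed.

(** The summands on the left are what remains of the expansion of the dual function
    over a step once its equations have been used. The increment of the velocity
    is d = sqrt 2 y + D with y the noise; x and z are the errors made by freezing
    the position and the drift, Ra, Rb and Ta, Tb are the remainders of the
    expansions in u and in s, and I is the indicator of a velocity within e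
    of 0, which is the only case where a small step can cross the origin. *)
Lemma step_errors (K M h e I j y D z x u v p gu A Au Auu B Bu Buu Ra Ta Rb Tb d cr La : R) :
  1 <= K -> 1 <= M -> 0 < h -> h <= 1 -> 0 < e -> e <= 1 -> 0 <= I -> 0 <= j ->
  `|u| <= M -> `|v| <= M -> 1 + `|u| <= M -> `|p| <= K -> `|gu| <= M ->
  `|x| <= j -> `|D| <= 2 * h -> `|z| <= 4 * h * I + 4 / e * j ->
  d = Num.sqrt 2 * y + D -> 0 <= cr -> cr * `|d| ^+ 2 <= I * `|d| ^+ 2 + `|d| ^+ 3 / e ->
  `|A| <= K * (1 + `|u|) -> `|Au| <= K -> `|Auu| <= K ->
  `|Bu| <= K * (1 + `|u|) -> `|Buu| <= K ->
  `|Ra| <= K * (`|d| ^+ 3 + cr * `|d| ^+ 2) -> `|Rb| <= K * (`|d| ^+ 3 + cr * `|d| ^+ 2) ->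
  `|Ta| <= K * (1 + `|u|) * h ^+ 2 -> `|Tb| <= K * (1 + `|u|) ^+ 2 * h ^+ 2 ->
  `|La| <= K * `|d| ->
  `|2 * p * (v * x) + p * (h * gu + x) ^+ 2 + v * Au * z + Bu * z
    + (v * Auu + Buu) * (Num.sqrt 2 * y * D + D ^+ 2 / 2)
    + v * Ra + Rb - v * Ta - Tb + x * A + (h * gu + x) * La|
  <= 128 * K * (M * j / e + h ^+ 2 * M ^+ 2 + j ^+ 2 + M * h * I + M * h * `|y|
       + M * (h ^+ 3 + `|y| ^+ 3) / e + M * I * y ^+ 2 + j * `|y|).
Proof.
move=> K1 M1 h0 h1 e0 e1 I0 j0 uM vM u1M pK gM xj D2 zB dE cr0 crB AB AuB AuuB BuB BuuB RaB RbB TaB TbB LaB.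
have K0 : 0 <= K by exact: le_trans K1.
have M0 : 0 <= M by exact: le_trans M1.
have ie : 1 <= e^-1 by rewrite invf_ge1.
have s20 : 0 <= Num.sqrt 2 :> R by [].
have s2 := sqrt2_le.
have Y0 : 0 <= `|y| := normr_ge0 y.
have [] := displacement_powers y (ltW h0) D2; rewrite -dE => dB d2B d3B.
have AB' : `|A| <= K * M by rewrite (le_trans AB)// ler_wpM2l.
have BuB' : `|Bu| <= K * M by rewrite (le_trans BuB)// ler_wpM2l.
have TaB' : `|Ta| <= K * M * h ^+ 2.
  by rewrite (le_trans TaB)// ler_wpM2r ?sqr_ge0// ler_wpM2l.
have TbB' : `|Tb| <= K * M ^+ 2 * h ^+ 2.
  rewrite (le_trans TbB)// ler_wpM2r ?sqr_ge0// ler_wpM2l//.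
  by rewrite lerXn2r ?nnegrE// addr_ge0.
pose G := 64 * ((h ^+ 3 + `|y| ^+ 3) / e) + I * (8 * h ^+ 2 + 8 * `|y| ^+ 2).
have h3 : 0 <= h ^+ 3 by rewrite exprn_ge0// ltW.
have Y3 : 0 <= `|y| ^+ 3 by rewrite exprn_ge0.
have GB : `|d| ^+ 3 + cr * `|d| ^+ 2 <= G.
  rewrite /G; have : I * `|d| ^+ 2 <= I * (8 * h ^+ 2 + 8 * `|y| ^+ 2) by rewrite ler_wpM2l.
  have : `|d| ^+ 3 / e <= 32 * (h ^+ 3 + `|y| ^+ 3) / e by rewrite ler_wpM2r// invr_ge0 ltW.
  have : `|d| ^+ 3 <= 32 * ((h ^+ 3 + `|y| ^+ 3) / e).
    by rewrite (le_trans d3B)// ler_pM2l// -[leLHS]mulr1 ler_wpM2l// addr_ge0.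
  by move: crB; clear; lra.
have RaB' : `|Ra| <= K * G by rewrite (le_trans RaB)// ler_wpM2l.
have RbB' : `|Rb| <= K * G by rewrite (le_trans RbB)// ler_wpM2l.
have G0 : 0 <= K * G by rewrite (le_trans _ RaB').
have LaB' : `|La| <= K * (2 * h + 2 * `|y|) by rewrite (le_trans LaB)// ler_wpM2l.
have gxB : `|h * gu + x| <= h * M + j.
  by rewrite (le_trans (ler_normD _ _))// lerD// normrM gtr0_norm// ler_wpM2l// (ltW h0).
have t1 : `|2 * p * (v * x)| <= 2 * K * (M * j).
  by apply: norm_mul_le; [rewrite normrM ger0_norm// ler_wpM2l|exact: norm_mul_le].
have t2 : `|p * (h * gu + x) ^+ 2| <= K * (h * M + j) ^+ 2.
  apply: norm_mul_le => //; rewrite normrX lerXn2r ?nnegrE//.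
  by rewrite (le_trans _ gxB).
have t3 : `|v * Au * z| <= M * K * (4 * h * I + 4 / e * j).
  by apply: norm_mul_le => //; exact: norm_mul_le.
have t4 : `|Bu * z| <= K * M * (4 * h * I + 4 / e * j) by apply: norm_mul_le.
have t5 : `|(v * Auu + Buu) * (Num.sqrt 2 * y * D + D ^+ 2 / 2)|
    <= (2 * K * M) * (3 * `|y| * h + 2 * h ^+ 2).
  apply: norm_mul_le.
    rewrite (le_trans (ler_normD _ _))//.
    have := norm_mul_le vM AuuB; have : K <= K * M by rewrite ler_peMr.
    by move: BuuB; clear; lra.
  rewrite (le_trans (ler_normD _ _))//; apply: lerD.
    have -> : 3 * `|y| * h = (3 / 2 * `|y|) * (2 * h) by field.
    apply: norm_mul_le => //; rewrite normrM (ger0_norm s20).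
    by rewrite ler_wpM2r.
  rewrite normrM normrX [`|2^-1|]ger0_norm// ler_pdivrMr//.
  have -> : 2 * h ^+ 2 * 2 = (2 * h) ^+ 2 by ring.
  by rewrite lerXn2r ?nnegrE// mulr_ge0// ltW.
have t6 : `|v * Ra| <= M * (K * G) by apply: norm_mul_le.
have t6' : `|Rb| <= M * (K * G) by rewrite (le_trans RbB')// ler_peMl.
have t7 : `|v * Ta| <= M * (K * M * h ^+ 2) by apply: norm_mul_le.
have t8 : `|x * A| <= j * (K * M) by apply: norm_mul_le.
have t9 : `|(h * gu + x) * La| <= (h * M + j) * (K * (2 * h + 2 * `|y|)) by apply: norm_mul_le.
have sumB : `|2 * p * (v * x) + p * (h * gu + x) ^+ 2 + v * Au * z + Bu * z
    + (v * Auu + Buu) * (Num.sqrt 2 * y * D + D ^+ 2 / 2)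
    + v * Ra + Rb - v * Ta - Tb + x * A + (h * gu + x) * La| <=
   K * (2 * (M * j) + (h * M + j) ^+ 2 + 2 * M * (4 * h * I + 4 / e * j)
     + 2 * M * (3 * `|y| * h + 2 * h ^+ 2) + 2 * M * G + 2 * M ^+ 2 * h ^+ 2 + j * M
     + (h * M + j) * (2 * h + 2 * `|y|)).
  move: t1 t2 t3 t4 t5 t6 t6' t7 TbB' t8 t9; clear; rewrite !ler_norml.
  do 11![move=> /andP[? ?]].
  by apply/andP; split; lra.
apply: (le_trans sumB); rewrite [128 * K]mulrC -[leRHS]mulrA ler_wpM2l//.
rewrite -[y ^+ 2]real_normK ?num_real// /G.
have Mj : M * j <= M * j / e by rewrite -[leLHS]mulr1 ler_wpM2l// mulr_ge0.
have hM : h ^+ 2 * M <= h ^+ 2 * M ^+ 2.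
  by rewrite ler_wpM2l ?sqr_ge0// expr2 ler_peMr.
have hjM : j * h <= M * j.
  by rewrite mulrC ler_wpM2r// (le_trans h1).
have hI : M * (h ^+ 2 * I) <= M * h * I.
  rewrite mulrA ler_wpM2r// ler_wpM2l// expr2 -[leRHS]mulr1 ler_wpM2l//; exact: ltW.
have P1 : 0 <= M * h * I by rewrite !mulr_ge0// ltW.
have P2 : 0 <= M * h * `|y| by rewrite !mulr_ge0// ltW.
have P3 : 0 <= M * I * `|y| ^+ 2 by rewrite !mulr_ge0// sqr_ge0.
have P4 : 0 <= j * `|y| by rewrite !mulr_ge0.
have P5 : 0 <= h ^+ 2 * M ^+ 2 by rewrite mulr_ge0// sqr_ge0.
have P6 := sqr_ge0 (h * M - j); have P7 := sqr_ge0 j.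
have -> : M * j / e = e^-1 * (M * j) by ring.
have -> : 4 / e * j = 4 * (e^-1 * j) by ring.
have Mj' : M * j <= e^-1 * (M * j) by rewrite ler_peMl// mulr_ge0.
have Mj0 : 0 <= M * j by rewrite mulr_ge0.
set E := e^-1 in Mj' *.
have hjM' : h * j <= M * j by rewrite mulrC.
move: Mj0 Mj' hM hjM hI P1 P2 P3 P4 P5 P6 P7 hjM'; clear; lra.
Qed.

End dual_step.

(** * Dual systems *)

Section pathwise_step.
Context {R : realType}.

(** A polynomial of degree 2 in the position v, with coefficients depending on the
    time to go s and on the velocity u. *)
Definition dual_fun (p : R) (a b : R -> R -> R) s u v : R := p * v ^+ 2 + v * a s u + b s u.

(** The equations say that the derivative of the dual function in s is its image
    under the generator of the pair (velocity, position): the position moves with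
    speed g(u), so that g times the derivative in v, 2 p v + a, feeds the
    equations for a and b. *)
Record dual_system (lo hi K p : R) (g : R -> R) (a as_ au auu b bs bu buu : R -> R -> R) : Prop :=
  DualSystem {
  ds_a : dual_class lo hi 1 K a as_ au auu ;
  ds_b : dual_class lo hi 2 K b bs bu buu ;
  ds_lipschitz : forall s u v, lo <= s <= hi -> `|a s v - a s u| <= K * `|v - u| ;
  ds_K : 1 <= K ;
  ds_p : `|p| <= K ;
  ds_g : forall x y, `|g x - g y| <= `|x - y| ;
  ds_g0 : g 0 = 0 ;
  ds_pde_a : forall s u, lo <= s <= hi ->
    as_ s u = auu s u - 2 * Num.sg u * au s u + 2 * p * g u ;
  ds_pde_b : forall s u, lo <= s <= hi ->
    bs s u = buu s u - 2 * Num.sg u * bu s u + g u * a s u }.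

Section one_dual_step.
Variables (lo hi K p : R) (g : R -> R) (a as_ au auu b bs bu buu : R -> R -> R).
Hypothesis ds : dual_system lo hi K p g a as_ au auu b bs bu buu.

Lemma ds_g_le u : `|g u| <= `|u|.
Proof. by have := ds_g ds u 0; rewrite (ds_g0 ds) !subr0. Qed.

Lemma crossing_split (u d e : R) : 0 < e ->
  crossing u (u + d) * `|d| ^+ 2 <= (`|u| <= e)%R%:R * `|d| ^+ 2 + `|d| ^+ 3 / e.
Proof.
move=> e0; rewrite /crossing addrC addKr.
have d3 : 0 <= `|d| ^+ 3 / e by rewrite mulr_ge0 ?exprn_ge0// invr_ge0 ltW.
have d2 : 0 <= `|d| ^+ 2 by exact: sqr_ge0.
have [ue|eu] := leP `|u| e; first by case: (`|u| <= `|d|); rewrite ?mul1r ?mul0r; lra.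
have [ud|_] := leP `|u| `|d|; last by rewrite !mul0r add0r.
rewrite mul1r mul0r add0r ler_pdivlMr// [leRHS]exprSr ler_wpM2l//.
exact: le_trans (ltW eu) ud.
Qed.

(** The two subtracted terms are the ones that have mean 0. *)
Lemma dual_step (s h e j u v u' v' y M : R) : M = 1 + `|v| + `|u| ->
  lo <= s <= hi -> lo <= s - h <= hi -> 0 < h -> h <= 1 -> 0 < e -> e <= 1 -> 0 <= j ->
  `|u' - u - Num.sqrt 2 * y| <= 2 * h ->
  `|u' - u - Num.sqrt 2 * y + 2 * h * Num.sg u| <= 4 * h * (`|u| <= e)%R%:R + 4 / e * j ->
  `|v' - v - h * g u| <= j ->
  `|dual_fun p a b (s - h) u' v' - dual_fun p a b s u v
    - (Num.sqrt 2 * (v * au (s - h) u + bu (s - h) u)) * y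
    - (v * auu (s - h) u + buu (s - h) u) * (y ^+ 2 - h)| <=
  128 * K * (M * j / e + h ^+ 2 * M ^+ 2 + j ^+ 2 + M * h * (`|u| <= e)%R%:R + M * h * `|y|
       + M * (h ^+ 3 + `|y| ^+ 3) / e + M * (`|u| <= e)%R%:R * y ^+ 2 + j * `|y|).
Proof.
move=> ME sI sI' h0 h1 e0 e1 j0 D2 zB xB.
have u0 := normr_ge0 u; have v0 := normr_ge0 v.
have K1 := ds_K ds; have pB := ds_p ds.
have [M1 uM vM u1M] : [/\ 1 <= M, `|u| <= M, `|v| <= M & 1 + `|u| <= M].
  by rewrite ME; split; lra.
have gM : `|g u| <= M by rewrite (le_trans (ds_g_le u)).
have cr0 : 0 <= crossing u u' by rewrite /crossing ler0n.
set D := u' - u - Num.sqrt 2 * y in D2 zB.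
set z := D + 2 * h * Num.sg u in zB; set x := v' - v - h * g u in xB.
pose d := Num.sqrt 2 * y + D.
have u'E : u' = u + d by rewrite /d /D; ring.
have v'E : v' = v + (h * g u + x) by rewrite /x; ring.
pose Ra := a (s - h) u' - a (s - h) u - au (s - h) u * d - auu (s - h) u / 2 * d ^+ 2.
pose Rb := b (s - h) u' - b (s - h) u - bu (s - h) u * d - buu (s - h) u / 2 * d ^+ 2.
pose Ta := a s u - a (s - h) u - as_ (s - h) u * h.
pose Tb := b s u - b (s - h) u - bs (s - h) u * h.
pose La := a (s - h) u' - a (s - h) u.
have dE : u' - u = d by rewrite u'E; ring.
have sE : s - (s - h) = h by ring.
have RaB := dc_taylor (ds_a ds) u u' sI'; have RbB := dc_taylor (ds_b ds) u u' sI'.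
have TaB := dc_time (ds_a ds) u sI' sI; have TbB := dc_time (ds_b ds) u sI' sI.
have LaB := ds_lipschitz ds u u' sI'.
rewrite dE in RaB RbB LaB; rewrite sE (ger0_norm (ltW h0)) in TaB TbB.
have := @step_errors R K M h e (`|u| <= e)%R%:R j y D z x u v p (g u)
  (a (s - h) u) (au (s - h) u) (auu (s - h) u) 0 (bu (s - h) u) (buu (s - h) u)
  Ra Ta Rb Tb d (crossing u u') La.
rewrite (_ : 2 * p * (v * x) + _ + _ + _ + _ + _ + _ - _ - _ + _ + _ =
  dual_fun p a b (s - h) u' v' - dual_fun p a b s u v
    - (Num.sqrt 2 * (v * au (s - h) u + bu (s - h) u)) * y
    - (v * auu (s - h) u + buu (s - h) u) * (y ^+ 2 - h)); last first.
  rewrite /Ra /Rb /Ta /Tb /La /dual_fun v'E (ds_pde_a ds u sI') (ds_pde_b ds u sI').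
  have -> : z = d - Num.sqrt 2 * y + 2 * h * Num.sg u by rewrite /z /d; ring.
  have -> : D = d - Num.sqrt 2 * y by rewrite /d; ring.
  have r2 : Num.sqrt 2 ^+ 2 = 2 :> R by rewrite sqr_sqrtr.
  have -> : (v * auu (s - h) u + buu (s - h) u) * (y ^+ 2 - h) =
      (v * auu (s - h) u + buu (s - h) u) * (Num.sqrt 2 ^+ 2 * y ^+ 2 / 2 - h).
    by rewrite r2; field.
  by field.
apply => //.
- by rewrite u'E; exact: crossing_split.
- by have := dc_val (ds_a ds) u sI'; rewrite expr1.
- by have := dc_grad (ds_a ds) u sI'; rewrite expr0 mulr1.
- exact: dc_hess (ds_a ds) _ _ sI'.
- by have := dc_grad (ds_b ds) u sI'; rewrite expr1.
- exact: dc_hess (ds_b ds) _ _ sI'.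
Qed.

End one_dual_step.

(** With q the square root of the time step, the products of M, j, I and y, which
    have no known joint law, are replaced by products of a function of the past
    and a function of the increment y. *)
Lemma young_step (q M j Q I e n y : R) : 0 < q -> q <= 1 -> 1 <= M -> 0 <= j -> j ^+ 2 <= Q ->
  I ^+ 2 = I -> 0 < e -> e <= 1 -> 0 < n ->
  M * j / e + (q ^+ 2) ^+ 2 * M ^+ 2 + j ^+ 2 + M * q ^+ 2 * I + M * q ^+ 2 * `|y|
    + M * ((q ^+ 2) ^+ 3 + `|y| ^+ 3) / e + M * I * y ^+ 2 + j * `|y| <=
  3 * (Q / (q ^+ 3 * e) + M ^+ 2 * (q ^+ 3 + q * y ^+ 2 + `|y| ^+ 3) / e
     + (n * M ^+ 2 + I / n) * (q ^+ 2 + y ^+ 2)).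
Proof.
move=> q0 q1 M1 j0 jQ II e0 e1 n0; rewrite -[y ^+ 2]real_normK ?num_real//.
have := normr_ge0 y; move: `|y| => {}y y0.
have M0 : 0 <= M by exact: le_trans M1.
have E1 : 1 <= e^-1 by rewrite invf_ge1.
have q3 : 0 < q ^+ 3 by rewrite exprn_gt0.
have q3i : 1 <= (q ^+ 3)^-1 by rewrite invf_ge1// exprn_ile1// ltW.
set J := Q / (q ^+ 3 * e).
have Q0 : 0 <= Q by rewrite (le_trans _ jQ)// sqr_ge0.
have JE : J = Q / q ^+ 3 / e by rewrite /J; field; rewrite !gt_eqF.
have J1 : Q / q ^+ 3 <= J by rewrite JE ler_peMr// divr_ge0// ltW.
have J2 : Q <= Q / q ^+ 3 by rewrite ler_peMr.
have M2 : M <= M ^+ 2 by rewrite expr2 ler_peMr.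
have qM : 0 <= q ^+ 3 * M ^+ 2 by rewrite mulr_ge0// ?sqr_ge0// ltW.
(* Young's inequality for each of the mixed terms *)
have T1 : M * j / e <= (q ^+ 3 * M ^+ 2 / e + J) / 2.
  rewrite JE -mulrDl ler_pdivlMr// mulrAC ler_wpM2r ?invr_ge0 ?(ltW e0)//.
  have : j ^+ 2 / q ^+ 3 <= Q / q ^+ 3 by rewrite ler_wpM2r// invr_ge0 ltW.
  have : M * j * 2 <= q ^+ 3 * M ^+ 2 + j ^+ 2 / q ^+ 3.
    rewrite -(ler_pM2r q3) mulrDl divfK ?gt_eqF//.
    by have := sqr_ge0 (q ^+ 3 * M - j); clear; lra.
  by lra.
have MM : 0 <= M ^+ 2 by exact: sqr_ge0.
have pE x : 0 <= x -> x <= x / e by move=> x0; rewrite ler_peMr.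
have T2 : (q ^+ 2) ^+ 2 * M ^+ 2 <= q ^+ 3 * M ^+ 2 / e.
  apply: le_trans (pE _ qM); rewrite ler_wpM2r// -exprM.
  by rewrite [leLHS]exprS ler_piMl// ltW.
have MI : M * I <= n * M ^+ 2 + I / n.
  rewrite -(ler_pM2r n0) mulrDl divfK ?gt_eqF//.
  have I0 : 0 <= I by rewrite -II sqr_ge0.
  have : 0 <= (n * M) * I by rewrite !mulr_ge0// ltW.
  by have := sqr_ge0 (n * M - I); rewrite sqrrB II; clear -I0; lra.
have T3 : M * q ^+ 2 * I + M * I * y ^+ 2 <= (n * M ^+ 2 + I / n) * (q ^+ 2 + y ^+ 2).
  rewrite (_ : _ + _ = M * I * (q ^+ 2 + y ^+ 2)); last by ring.
  by rewrite ler_wpM2r// addr_ge0// sqr_ge0.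
have qy : 0 <= q * y ^+ 2 * M ^+ 2 by rewrite !mulr_ge0// ?sqr_ge0// ltW.
have y3 : 0 <= y ^+ 3 by exact: exprn_ge0.
have T4 : M * q ^+ 2 * y <= (q ^+ 3 * M ^+ 2 / e + q * y ^+ 2 * M ^+ 2 / e) / 2.
  apply: (@le_trans _ _ ((q ^+ 3 * M ^+ 2 + q * y ^+ 2 * M ^+ 2) / 2)); last first.
    by have := pE _ qM; have := pE _ qy; clear; lra.
  apply: (@le_trans _ _ (M ^+ 2 * ((q ^+ 3 + q * y ^+ 2) / 2))); last by clear; lra.
  rewrite -mulrA; apply: ler_pM => //; first by rewrite mulr_ge0// sqr_ge0.
  have : 0 <= q * (q - y) ^+ 2 by rewrite mulr_ge0 ?sqr_ge0// ltW.
  by clear; lra.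
have T5 : M * ((q ^+ 2) ^+ 3 + y ^+ 3) / e <= M ^+ 2 * (q ^+ 3 + y ^+ 3) / e.
  rewrite ler_wpM2r ?invr_ge0 ?(ltW e0)//; apply: ler_pM => //.
    by rewrite addr_ge0// exprn_ge0// sqr_ge0.
  rewrite lerD2r -exprM (_ : 2 * 3 = 3 + 3)%N// exprD ler_piMr ?(ltW q3)//.
  by rewrite exprn_ile1// ltW.
have T6 : j * y <= (q * y ^+ 2 * M ^+ 2 / e + J) / 2.
  have : j * y * 2 <= q * y ^+ 2 + j ^+ 2 / q.
    rewrite -(ler_pM2r q0) mulrDl divfK ?gt_eqF//.
    by have := sqr_ge0 (q * y - j); clear; lra.
  have : j ^+ 2 / q <= J.
    apply: le_trans J1; apply: ler_pM => //; first exact: sqr_ge0.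
      by rewrite invr_ge0 ltW.
    rewrite lef_pV2 ?posrE// exprS ler_piMr// ?(ltW q0)//.
    by rewrite exprn_ile1// ltW.
  have : q * y ^+ 2 <= q * y ^+ 2 * M ^+ 2.
    rewrite ler_peMr// ?mulr_ge0 ?sqr_ge0 ?(ltW q0)//.
    by rewrite (le_trans M1).
  by have := pE _ qy; clear; lra.
have T7 : j ^+ 2 <= J by apply: le_trans J1; apply: le_trans J2.
have J0 : 0 <= J by rewrite (le_trans _ J1)// divr_ge0// ltW.
have Z1 : 0 <= q ^+ 3 * M ^+ 2 / e by rewrite (le_trans qM)// pE.
have Z2 : 0 <= q * y ^+ 2 * M ^+ 2 / e by rewrite (le_trans qy)// pE.
have Z3 : 0 <= M ^+ 2 * y ^+ 3 / e by rewrite divr_ge0 ?mulr_ge0// ltW.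
have Z4 : 0 <= (n * M ^+ 2 + I / n) * (q ^+ 2 + y ^+ 2).
  rewrite mulr_ge0// ?addr_ge0 ?sqr_ge0// ?mulr_ge0 ?invr_ge0 ?(ltW n0)//.
  by rewrite -II sqr_ge0.
move: T1 T2 T3 T4 T5 T6 T7 J0 Z1 Z2 Z3 Z4; clear; lra.
Qed.

End pathwise_step.

(** * Mean of one step *)

Section mean_bounds.
Context {d : measure_display} {T : measurableType d} {R : realType}.
Variable P : probability T R.

(** Bounds in mean for nonnegative variables, in a form closed under sums and
    multiples. *)
Definition mean_le (X : T -> R) (c : R) :=
  [/\ measurable_fun setT X, forall w, 0 <= X w & (\int[P]_w (X w)%:E <= c%:E)%E].

Lemma mean_le_ge0 X c : mean_le X c -> 0 <= c.
Proof.
move=> [_ X0 /(le_trans _) H]; rewrite -lee_fin; apply: H.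
by apply: integral_ge0 => w _; rewrite lee_fin.
Qed.

Lemma mean_le_cst c : 0 <= c -> mean_le (fun=> c) c.
Proof. by move=> c0; split => //; rewrite integral_cst//= probability_setT mule1. Qed.

Lemma mean_leD X Y c c' : mean_le X c -> mean_le Y c' -> mean_le (fun w => X w + Y w) (c + c').
Proof.
move=> [mX X0 Xc] [mY Y0 Yc]; split.
- exact: measurable_funD.
- by move=> w; rewrite addr_ge0.
- under eq_integral do rewrite EFinD.
  rewrite (ge0_integralD P measurableT); first by rewrite EFinD leeD.
  + by move=> w _; rewrite lee_fin.
  + exact/measurable_EFinP.
  + by move=> w _; rewrite lee_fin.
  + exact/measurable_EFinP.
Qed.

Lemma mean_leZ X c k : 0 <= k -> mean_le X c -> mean_le (fun w => k * X w) (k * c).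
Proof.
move=> k0 [mX X0 Xc]; split.
- exact: measurable_funM.
- by move=> w; rewrite mulr_ge0.
- under eq_integral do rewrite EFinM.
  rewrite ge0_integralZl_EFin//; first by rewrite EFinM lee_wpmul2l.
  + by move=> w _; rewrite lee_fin.
  + exact/measurable_EFinP.
Qed.

Lemma mean_le_weaken X c c' : c <= c' -> mean_le X c -> mean_le X c'.
Proof. by move=> cc [mX X0 Xc]; split => //; rewrite (le_trans Xc). Qed.

Lemma integrable_mean_le (f X : T -> R) c : measurable_fun setT f ->
  (forall w, `|f w| <= X w) -> mean_le X c -> P.-integrable setT (EFin \o f).
Proof.
move=> mf fX [mX X0 Xc]; apply/integrableP; split; first exact/measurable_EFinP.
apply: (le_lt_trans _ (le_lt_trans Xc (ltry c))).
apply: ge0_le_integral => //.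
- by apply/measurable_EFinP; exact: measurableT_comp.
- exact/measurable_EFinP.
- by move=> w _; rewrite lee_fin fX.
Qed.

Lemma integrable_EFinB (f k : T -> R) : P.-integrable setT (EFin \o f) ->
  P.-integrable setT (EFin \o k) -> P.-integrable setT (EFin \o (fun w => f w - k w)).
Proof.
move=> fi ki; rewrite (_ : EFin \o _ = (EFin \o f) \- (EFin \o k))%E//.
exact: integrableB.
Qed.

Lemma norm_mean_le (f X : T -> R) c : P.-integrable setT (EFin \o f) ->
  {ae P, forall w, `|f w| <= X w} -> mean_le X c -> `|\int[P]_w f w| <= c.
Proof.
move=> fi fX [mX X0 Xc]; have /measurable_int/measurable_EFinP mf := fi.
apply: (le_trans (le_normr_Rintegral measurableT fi)).
rewrite -lee_fin fineK; last first.
  apply: integrable_fin_num => //; exact: (integrable_norm fi).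
apply: le_trans Xc; apply: ae_ge0_le_integral => //.
- by apply/measurable_EFinP; exact: measurableT_comp.
- by move=> w _; rewrite lee_fin.
- exact/measurable_EFinP.
- by apply: filterS fX => w H _; rewrite lee_fin.
Qed.

End mean_bounds.

Section sliding.
Context {d : measure_display} {T : measurableType d} {R : realType}.
Variable P : probability T R.

(** The velocity U together with one of the two positions V driven by it. *)
Record sliding (F : R -> set (set T)) (W : R -> T -> R) (tau0 : R) (g : R -> R)
    (U V : R -> T -> R) : Prop := Sliding {
  sl_filtration : filtration F ;
  sl_wiener : wiener_process P F W ;
  sl_adapted : adapted F U ;
  sl_continuous : as_continuous P U ;
  sl_init : {ae P, forall w, U 0 w = 0} ;
  sl_velocity : solves_sde P (fun u => - 2 * Num.sg u)
    (fun s => heaviside (tau0 - s) * Num.sqrt 2) W U ;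
  sl_adapted_position : adapted F V ;
  sl_init_position : {ae P, forall w, V 0 w = 0} ;
  sl_position : solves_ode P g U V }.

Variables (F : R -> set (set T)) (W : R -> T -> R) (tau0 : R) (g : R -> R) (U V : R -> T -> R).
Hypothesis sl : sliding F W tau0 g U V.
Let hF := sl_filtration sl.
Let hW := sl_wiener sl.
Let aU := sl_adapted sl.
Let aV := sl_adapted_position sl.

Variables (lo hi K p : R) (a as_ au auu b bs bu buu : R -> R -> R).
Hypothesis ds : dual_system lo hi K p g a as_ au auu b bs bu buu.
Let g_lip := ds_g ds.
Let g_0 := ds_g0 ds.

Let K0 : 0 <= K. Proof. exact: le_trans (ds_K ds). Qed.

Lemma mean_weight_sqr : exists2 m, 1 <= m & forall t, 0 <= t -> t <= tau0 ->
  mean_le P (fun w => weight U V t w ^+ 2) m.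
Proof.
have [m m0 H] := weight_sqr hF hW aU (sl_continuous sl) (sl_init sl) (sl_velocity sl) aV
  (sl_init_position sl) (sl_position sl) g_lip g_0.
exists (1 + m); first by rewrite lerDl.
move=> t t0 tT; apply: (@mean_le_weaken _ _ _ _ _ m); first by rewrite lerDr.
split; [|by move=> w; exact: sqr_ge0|exact: H].
by apply: measurable_funX; exact: (measurable_weight hF aU aV).
Qed.

Local Notation Phi s t w := (dual_fun p a b s (U t w) (V t w)).

Let mU t : 0 <= t -> measurable_fun setT (U t).
Proof. by move=> t0; exact: (adapted_measurable hF t0 aU). Qed.
Let mV t : 0 <= t -> measurable_fun setT (V t).
Proof. by move=> t0; exact: (adapted_measurable hF t0 aV). Qed.

Lemma measurable_dual_fun s t : lo <= s <= hi -> 0 <= t -> measurable_fun setT (fun w => Phi s t w).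
Proof.
move=> sI t0; have [ma _ _] := dc_meas (ds_a ds) sI; have [mb _ _] := dc_meas (ds_b ds) sI.
have mUt := mU t0; have mVt := mV t0.
apply: measurable_funD; first apply: measurable_funD.
- by apply: measurable_funM => //; exact: measurable_funX.
- by apply: measurable_funM => //; exact: measurableT_comp.
- exact: measurableT_comp.
Qed.

Lemma dual_fun_le s t w : lo <= s <= hi -> `|Phi s t w| <= 3 * K * weight U V t w ^+ 2.
Proof.
move=> sI; have := dc_val (ds_a ds) (U t w) sI; have := dc_val (ds_b ds) (U t w) sI.
rewrite expr1 /weight /dual_fun; have := normr_ge0 (U t w); have := normr_ge0 (V t w).
set u := `|U t w|; set v := `|V t w| => v0 u0 bB aB.
have aB' : `|a s (U t w)| <= K * (1 + v + u) by rewrite (le_trans aB)// ler_wpM2l//; lra.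
have bB' : `|b s (U t w)| <= K * (1 + v + u) ^+ 2.
  by rewrite (le_trans bB)// ler_wpM2l// lerXn2r ?nnegrE//; lra.
have vM : v <= 1 + v + u by lra.
have vv : `|p * V t w ^+ 2| <= K * (1 + v + u) ^+ 2.
  apply: norm_mul_le; first exact: (ds_p ds).
  by rewrite normrX lerXn2r ?nnegrE//; lra.
have va : `|V t w * a s (U t w)| <= (1 + v + u) * (K * (1 + v + u)).
  exact: norm_mul_le.
have -> : 3 * K * (1 + v + u) ^+ 2 =
  K * (1 + v + u) ^+ 2 + (1 + v + u) * (K * (1 + v + u)) + K * (1 + v + u) ^+ 2 by ring.
apply: (le_trans (ler_normD _ _)); apply: lerD => //.
by apply: (le_trans (ler_normD _ _)); apply: lerD.
Qed.

Lemma integrable_dual_fun s t : lo <= s <= hi -> 0 <= t -> t <= tau0 ->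
  P.-integrable setT (EFin \o (fun w => Phi s t w)).
Proof.
move=> sI t0 tT; have [m m1 mm] := mean_weight_sqr.
apply: (integrable_mean_le (X := fun w => 3 * K * weight U V t w ^+ 2)).
- exact: measurable_dual_fun.
- by move=> w; exact: dual_fun_le.
- by apply: mean_leZ; [rewrite mulr_ge0|exact: mm].
Qed.

Lemma mean_increment_powers q t : 0 < q -> 0 <= t ->
  mean_le P (fun w => q ^+ 3 + q * increment W t (q ^+ 2) w ^+ 2 +
    `|increment W t (q ^+ 2) w| ^+ 3) (4 * q ^+ 3).
Proof.
move=> q0 t0; have h0 : 0 < q ^+ 2 by rewrite exprn_gt0.
have mY := measurable_increment hF hW t0 (ltW h0).
rewrite (_ : 4 * q ^+ 3 = q ^+ 3 + q * q ^+ 2 + 2 * q ^+ 3); last by ring.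
apply: mean_leD; first apply: mean_leD.
- by apply: mean_le_cst; rewrite exprn_ge0// ltW.
- apply: mean_leZ; first exact: ltW.
  split; [exact: measurable_funX|by move=> w; exact: sqr_ge0|].
  by rewrite (integral_increment_sqr hF hW).
- split; [by apply: measurable_funX; exact: measurableT_comp|by move=> w; exact: exprn_ge0|].
  have := integral_increment_cube hF hW t0 h0.
  by rewrite sqrtr_sqr gtr0_norm.
Qed.

Lemma mean_le_mul_increment h t (X : T -> R) (f k : R -> R) (c c' : R) : 0 < h -> 0 <= t ->
  measurable_for (F t) X -> measurable_fun setT f -> measurable_fun setT k ->
  (forall x, 0 <= f x) -> (forall x, 0 <= k x) ->
  mean_le P (fun w => f (X w)) c -> mean_le P (fun w => k (increment W t h w)) c' ->
  measurable_fun setT X ->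
  mean_le P (fun w => f (X w) * k (increment W t h w)) (c * c').
Proof.
move=> h0 t0 aX mf mk f0 k0 [mfX _ fXc] [mkY _ kYc] mX; split.
- exact: measurable_funM.
- by move=> w; rewrite mulr_ge0.
- rewrite (integral_mul_function_of_increment hF hW t0 h0)// EFinM.
  by apply: lee_pmul => //; apply: integral_ge0 => w _; rewrite lee_fin.
Qed.

Let measurable_for_pair t (k : R * R -> R) : 0 <= t -> measurable_fun setT k ->
  measurable_for (F t) (fun w => k (U t w, V t w)).
Proof.
move=> t0 mk; have [sF _ _] := hF.
by apply: measurable_for_comp2 => //; [exact: sF|exact: aU|exact: aV].
Qed.

Let measurable_for_weight t : 0 <= t -> measurable_for (F t) (weight U V t).
Proof.
move=> t0; apply: (@measurable_for_pair t (fun z => 1 + `|z.2| + `|z.1|)) => //.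
by apply: measurable_funD; [apply: measurable_funD => //|]; exact: measurableT_comp.
Qed.

Let integrable_pair t (k : R * R -> R) : 0 <= t -> t <= tau0 -> measurable_fun setT k ->
  (forall u v, `|k (u, v)| <= 4 * K * (1 + `|v| + `|u|) ^+ 2) ->
  P.-integrable setT (EFin \o (fun w => k (U t w, V t w))).
Proof.
move=> t0 tT mk kB; have [m m1 mm] := mean_weight_sqr.
apply: (integrable_mean_le (X := fun w => 4 * K * weight U V t w ^+ 2)) => //.
- apply: (measurableT_comp mk); apply/measurable_fun_pairP; split; [exact: mU|exact: mV].
- by apply: mean_leZ; [rewrite mulr_ge0|exact: mm].
Qed.

Let noise_coefficients s : lo <= s <= hi ->
  let k1 (z : R * R) := Num.sqrt 2 * (z.2 * au s z.1 + bu s z.1) in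
  let k2 (z : R * R) := z.2 * auu s z.1 + buu s z.1 in
  [/\ measurable_fun setT k1, measurable_fun setT k2,
    forall u v, `|k1 (u, v)| <= 4 * K * (1 + `|v| + `|u|) ^+ 2 &
    forall u v, `|k2 (u, v)| <= 4 * K * (1 + `|v| + `|u|) ^+ 2].
Proof.
move=> sI; have [ma mau mauu] := dc_meas (ds_a ds) sI; have [mb mbu mbuu] := dc_meas (ds_b ds) sI.
split.
- apply: measurable_funM => //; apply: measurable_funD; first apply: measurable_funM => //.
    exact: measurableT_comp.
  exact: measurableT_comp.
- apply: measurable_funD; first apply: measurable_funM => //.
    exact: measurableT_comp.
  exact: measurableT_comp.
- move=> u v /=; have u0 := normr_ge0 u; have v0 := normr_ge0 v.
  have := dc_grad (ds_a ds) u sI; have := dc_grad (ds_b ds) u sI.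
  rewrite expr1 expr0 mulr1 => buB auB.
  rewrite normrM (ger0_norm (sqrtr_ge0 _)).
  have M1 : 1 <= 1 + `|v| + `|u| by lra.
  have MM : 1 + `|v| + `|u| <= (1 + `|v| + `|u|) ^+ 2 by rewrite expr2 ler_peMr//; lra.
  have KM := ler_wpM2l K0 MM.
  have va : `|v * au s u| <= `|v| * K by exact: norm_mul_le.
  have S := ler_normD (v * au s u) (bu s u).
  have : `|v * au s u + bu s u| <= K * (1 + `|v| + `|u|) by lra.
  have s2 : Num.sqrt 2 <= 3 / 2 :> R by exact: sqrt2_le.
  move: s2; have := sqrtr_ge0 (2 : R).
  have := normr_ge0 (v * au s u + bu s u).
  move: KM; set A := `|_ + _|; set B := K * _; set C := K * (_ ^+ 2).
  rewrite (_ : 4 * K * _ = 4 * C); last by rewrite /C; ring.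
  move=> BC A0 r0 r2 AB; apply: (@le_trans _ _ (3 / 2 * B)); last by lra.
  exact: ler_pM.
- move=> u v /=; have u0 := normr_ge0 u; have v0 := normr_ge0 v.
  have := dc_hess (ds_a ds) u sI; have := dc_hess (ds_b ds) u sI => buB auB.
  have M1 : 1 <= 1 + `|v| + `|u| by lra.
  have MM : 1 + `|v| + `|u| <= (1 + `|v| + `|u|) ^+ 2 by rewrite expr2 ler_peMr//; lra.
  have KM := ler_wpM2l K0 MM.
  have va : `|v * auu s u| <= `|v| * K by exact: norm_mul_le.
  have S := ler_normD (v * auu s u) (buu s u).
  have Ku : 0 <= K * `|u| by rewrite mulr_ge0.
  have : `|v * auu s u + buu s u| <= K * (1 + `|v| + `|u|) by lra.
  by have := normr_ge0 (v * auu s u + buu s u); lra.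
Qed.

(** The bound is small compared with h as soon as n, pi / n and sqrt h / e are:
    the free parameters e and n allow for that when pi, the probability that the
    velocity is within e of the discontinuity of the drift, tends to 0 with e. *)
Lemma dual_mean_step : exists2 C, 0 <= C & forall s t h e n pi,
  lo <= s <= hi -> lo <= s - h <= hi -> 0 <= t -> 0 < h -> h <= 1 -> t + h <= tau0 ->
  0 < e -> e <= 1 -> 0 < n ->
  mean_le P (fun w => (`|U t w| <= e)%R%:R) pi ->
  `|\int[P]_w Phi (s - h) (t + h) w - \int[P]_w Phi s t w|
     <= C * (Num.sqrt h ^+ 3 / e + h * (n + pi / n)).
Proof.
have [m m1 mm] := mean_weight_sqr.
have m0 : 0 <= m by exact: le_trans m1.
have C0 : 0 <= 384 * K * (12 + 4 * m).
  exact: mulr_ge0 (mulr_ge0 (ler0n _ _) K0) (addr_ge0 (ler0n _ _) (mulr_ge0 (ler0n _ _) m0)).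
exists (384 * K * (12 + 4 * m)) => // s t h e n pi sI sI' t0 h0 h1 tT e0 e1 n0 smallB.
have tT' : t <= tau0 by apply: le_trans tT; rewrite lerDl ltW.
have th0 : 0 <= t + h by rewrite addr_ge0// ltW.
pose q := Num.sqrt h; have q0 : 0 < q by rewrite sqrtr_gt0.
have hq : h = q ^+ 2 by rewrite sqr_sqrtr// ltW.
have q1 : q <= 1 by rewrite -[leRHS]sqrtr1 ler_sqrt.
have [Q [mQ Q0 iQ Hstep]] := one_step hF hW aU (sl_continuous sl) (sl_velocity sl)
  (sl_position sl) g_lip t0 h0 tT.
have [mk1 mk2 k1B k2B] := noise_coefficients sI'.
have i1 := integrable_dual_fun sI' th0 tT.
have i2 := integrable_dual_fun sI t0 tT'.
have [i3 e3] := integral_mul_increment hF hW t0 h0 (measurable_for_pair t0 mk1)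
  (integrable_pair t0 tT' mk1 k1B).
have [i4 e4] := integral_mul_compensated_square hF hW t0 h0 (measurable_for_pair t0 mk2)
  (integrable_pair t0 tT' mk2 k2B).
pose Y w := increment W t h w.
pose f3 w := Num.sqrt 2 * (V t w * au (s - h) (U t w) + bu (s - h) (U t w)) * Y w.
pose f4 w := (V t w * auu (s - h) (U t w) + buu (s - h) (U t w)) * (Y w ^+ 2 - h).
have i12 := integrable_EFinB i1 i2.
have i123 := integrable_EFinB i12 i3.
have i1234 := integrable_EFinB i123 i4.
have -> : \int[P]_w Phi (s - h) (t + h) w - \int[P]_w Phi s t w =
    \int[P]_w (Phi (s - h) (t + h) w - Phi s t w - f3 w - f4 w).
  rewrite (RintegralB measurableT i123 i4) (RintegralB measurableT i12 i3) (RintegralB measurableT i1 i2).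
  by rewrite /Rintegral [X in _ = _ - fine X - _]e3 [X in _ = _ - fine X]e4 !subr0.
pose M w := weight U V t w; pose I w : R := (`|U t w| <= e)%R%:R.
pose E w := Q w / (q ^+ 3 * e) + M w ^+ 2 * (q ^+ 3 + q * Y w ^+ 2 + `|Y w| ^+ 3) / e
     + (n * M w ^+ 2 + I w / n) * (q ^+ 2 + Y w ^+ 2).
have q3 : 0 < q ^+ 3 by rewrite exprn_gt0.
have EB : mean_le P E ((q ^+ 3 * e)^-1 * (12 * q ^+ 6) + e^-1 * (m * (4 * q ^+ 3))
    + (n * (m * (2 * h)) + n^-1 * (pi * (2 * h)))).
  have powers := mean_increment_powers q0 t0; rewrite -hq in powers.
  have squares : mean_le P (fun w => q ^+ 2 + Y w ^+ 2) (2 * h).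
    rewrite (_ : 2 * h = q ^+ 2 + h); last by rewrite -hq; ring.
    apply: mean_leD; first by apply: mean_le_cst; exact: sqr_ge0.
    split; last by rewrite (integral_increment_sqr hF hW).
      by apply: measurable_funX; exact: (measurable_increment hF hW t0 (ltW h0)).
    by move=> w; exact: sqr_ge0.
  have -> : E = (fun w => (q ^+ 3 * e)^-1 * Q w +
     e^-1 * (M w ^+ 2 * (q ^+ 3 + q * Y w ^+ 2 + `|Y w| ^+ 3)) +
     (n * (M w ^+ 2 * (q ^+ 2 + Y w ^+ 2)) + n^-1 * (I w * (q ^+ 2 + Y w ^+ 2)))).
    by apply/funext => w; rewrite /E; ring.
  have mW := measurable_weight hF aU aV t0.
  apply: mean_leD; apply: mean_leD; apply: mean_leZ.
  - by rewrite invr_ge0 mulr_ge0// ltW.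
  - split => //; apply: (le_trans iQ); rewrite lee_fin hq.
    have -> : 12 * q ^+ 6 = (8 * q ^+ 2 + 4) * q ^+ 2 * (q ^+ 2) ^+ 2 +
      8 * (1 - q ^+ 2) * q ^+ 6 by ring.
    have -> : 8 * q ^+ 2 ^+ 2 + 4 * q ^+ 2 = (8 * q ^+ 2 + 4) * q ^+ 2 by ring.
    by rewrite lerDl mulr_ge0 ?exprn_ge0 ?(ltW q0)// mulr_ge0// subr_ge0 -hq.
  - by rewrite invr_ge0 ltW.
  - apply: (mean_le_mul_increment (f := fun x => x ^+ 2)
      (k := fun y => q ^+ 3 + q * y ^+ 2 + `|y| ^+ 3)) => //.
    + exact: measurable_for_weight.
    + apply: measurable_funD; first by apply: measurable_funD => //; apply: measurable_funM.
      by apply: measurable_funX; exact: normr_measurable.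
    + by move=> x; exact: sqr_ge0.
    + by move=> x; rewrite !addr_ge0 ?exprn_ge0// ?(ltW q0)// mulr_ge0 ?sqr_ge0// ltW.
    + exact: mm.
  - exact: ltW.
  - apply: (mean_le_mul_increment (f := fun x => x ^+ 2) (k := fun y => q ^+ 2 + y ^+ 2)) => //.
    + exact: measurable_for_weight.
    + by apply: measurable_funD => //; exact: measurable_funX.
    + by move=> x; exact: sqr_ge0.
    + by move=> x; rewrite addr_ge0// sqr_ge0.
    + exact: mm.
  - by rewrite invr_ge0 ltW.
  - apply: (mean_le_mul_increment (f := fun x => (`|x| <= e)%R%:R) (k := fun y => q ^+ 2 + y ^+ 2)) => //.
    + exact: aU.
    + by apply: measurable_indicator_le; exact: normr_measurable.
    + by apply: measurable_funD => //; exact: measurable_funX.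
    + by move=> x; rewrite addr_ge0// sqr_ge0.
    + exact: mU.
have pi0 := mean_le_ge0 smallB.
have K3 : 0 <= 384 * K := mulr_ge0 (ler0n _ _) K0.
apply: (@le_trans _ _ (384 * K * ((q ^+ 3 * e)^-1 * (12 * q ^+ 6) + e^-1 * (m * (4 * q ^+ 3))
    + (n * (m * (2 * h)) + n^-1 * (pi * (2 * h)))))).
  apply: norm_mean_le i1234 _ (mean_leZ K3 EB).
  apply: filterS Hstep => w [j [j0 jQ D2 zB xB]].
  have ME : weight U V t w = 1 + `|V t w| + `|U t w| by [].
  have := dual_step ds ME sI sI' h0 h1 e0 e1 j0 D2 (zB e e0) xB.
  move=> /le_trans; apply.
  have -> : 384 * K * E w = 128 * K * (3 * E w) by ring.
  apply: ler_wpM2l; first exact: mulr_ge0 (ler0n _ _) K0.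
  have II : I w ^+ 2 = I w by rewrite /I; case: (_ <= _); rewrite ?expr1n ?expr0n.
  by have := young_step (Y w) q0 q1 (weight_ge1 U V t w) j0 jQ II e0 e1 n0; rewrite -{1 2 3 4}hq.
rewrite -[leRHS]mulrA; apply: ler_wpM2l K3 _ _ _; rewrite -/q.
have -> : (q ^+ 3 * e)^-1 * (12 * q ^+ 6) = 12 * (q ^+ 3 / e).
  by field; rewrite !gt_eqF.
have -> : e^-1 * (m * (4 * q ^+ 3)) = 4 * m * (q ^+ 3 / e) by ring.
have -> : n * (m * (2 * h)) + n^-1 * (pi * (2 * h)) = 2 * h * (m * n + pi / n) by ring.
have A0 : 0 <= q ^+ 3 / e by rewrite divr_ge0// ltW.
have B0 : 0 <= pi / n by rewrite divr_ge0// ltW.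
have hB : 0 <= h * (pi / n) by rewrite mulr_ge0// ltW.
have hn : 0 <= h * n by rewrite mulr_ge0// ltW.
have mhn : h * n <= m * (h * n) by rewrite ler_peMl.
have mhB : h * (pi / n) <= m * (h * (pi / n)) by rewrite ler_peMl.
by rewrite !(mulrDl, mulrDr); lra.
Qed.

End sliding.

(** * Conservation of the dual mean *)

Section conservation.
Context {d : measure_display} {T : measurableType d} {R : realType}.
Variable P : probability T R.
Variables (F : R -> set (set T)) (W : R -> T -> R) (tau0 : R) (g : R -> R) (U V : R -> T -> R).
Hypothesis sl : sliding P F W tau0 g U V.
Let hF := sl_filtration sl.
Let hW := sl_wiener sl.
Let aU := sl_adapted sl.

Lemma mean_small_velocity t e : 0 < e -> e <= t -> t <= tau0 ->
  mean_le P (fun w => (`|U t w| <= e)%R%:R) (3 * Num.sqrt e).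
Proof.
move=> e0 et tT; have t0 : 0 <= t by exact: le_trans (ltW e0) et.
split.
- apply: measurable_indicator_le; apply: measurableT_comp => //.
  exact: (adapted_measurable hF t0 aU).
- by move=> w; exact: ler0n.
- have := velocity_small_ball hF hW aU (sl_continuous sl) (sl_velocity sl) e0 et tT (ltW e0).
  move=> /le_trans; apply; rewrite lee_fin.
  have s0 : 0 < Num.sqrt e by rewrite sqrtr_gt0.
  rewrite ler_pdivrMr// -mulrA -expr2 sqr_sqrtr ?(ltW e0)//; lra.
Qed.

Lemma velocity_neq0 t : 0 < t -> t <= tau0 -> {ae P, forall w, U t w != 0}.
Proof.
move=> t0 tT; have mUt := adapted_measurable hF (ltW t0) aU.
have mA : measurable [set w | U t w = 0].
  by rewrite -[X in measurable X]setTI; exact: mUt _ [set 0] _.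
exists [set w | U t w = 0]; split => //; last by move=> w /= /negP; rewrite negbK => /eqP.
apply/eqP; rewrite eq_le measure_ge0 andbT; apply/lee_addgt0Pr => e e0; rewrite add0e.
pose r := Num.min t ((e / 3) ^+ 2).
have r0 : 0 < r by rewrite lt_min t0 exprn_gt0// divr_gt0.
have rt : r <= t by rewrite /r ge_min lexx.
have [mI _ Ie] := mean_small_velocity r0 rt tT.
apply: (@le_trans _ _ (\int[P]_w ((`|U t w| <= r)%R%:R)%:E)%E).
  rewrite -[X in P X]setIT -integral_indic//.
  apply: ge0_le_integral => //.
  - by apply/measurable_EFinP; exact: measurable_indic.
  - exact/measurable_EFinP.
  - move=> w _; rewrite lee_fin indicE; have [/set_mem/= -> |_] := boolP (w \in _).
      by rewrite normr0 (ltW r0).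
    exact: ler0n.
apply: (le_trans Ie); rewrite lee_fin -ler_pdivlMl// mulrC.
rewrite -[leRHS]ger0_norm ?divr_ge0 ?(ltW e0)// -sqrtr_sqr ler_wsqrtr//.
by rewrite /r ge_min lexx orbT.
Qed.

Variables (lo hi K p : R) (a as_ au auu b bs bu buu : R -> R -> R).
Hypothesis ds : dual_system lo hi K p g a as_ au auu b bs bu buu.
Local Notation Phi s t w := (dual_fun p a b s (U t w) (V t w)).

Lemma dual_mean_init s : lo <= s <= hi -> 0 <= tau0 -> \int[P]_w Phi s 0 w = b s 0.
Proof.
move=> sI T0; rewrite /Rintegral.
have -> : (\int[P]_w (Phi s 0 w)%:E = \int[P]_w (b s 0)%:E)%E.
  apply: ae_eq_integral => //.
  - by apply/measurable_EFinP; exact: (measurable_dual_fun sl ds sI).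
  - apply: filterS2 (sl_init sl) (sl_init_position sl) => w /= -> -> _.
    by rewrite /dual_fun expr0n mulr0 mul0r !add0r.
by rewrite integral_cst//= probability_setT mule1.
Qed.

(** The one-step errors are summed over a partition. Up to a small time t0 the
    choice e = n = 1 bounds the total by a multiple of t0. After t0, with e = r^4
    and n = r, the small ball probability is at most 3 r^2, and steps h <= r^10
    contribute at most 5 C r h each. *)
Lemma dual_mean_conserved s0 t : lo <= s0 -> s0 + t <= hi -> 0 <= t -> t <= tau0 ->
  \int[P]_w Phi s0 t w = b (s0 + t) 0.
Proof.
move=> ls sh + tT; rewrite le_eqVlt => /predU1P[t00|t0].
  by rewrite -t00 addr0 in sh tT *; rewrite dual_mean_init// ls.
have T0 : 0 <= tau0 by rewrite (le_trans _ tT)// ltW.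
have [C C0 step] := dual_mean_step sl ds.
pose e r := \int[P]_w Phi (s0 + t - r) r w.
have sI r : 0 <= r -> r <= t -> lo <= s0 + t - r <= hi by move=> ? ?; apply/andP; split; lra.
rewrite -(@dual_mean_init (s0 + t)) ?T0//; last by apply/andP; split; lra.
have -> : \int[P]_w Phi s0 t w = e t by rewrite /e addrK.
have -> : \int[P]_w Phi (s0 + t) 0 w = e 0 by rewrite /e subr0.
have estep r h ep n pi : 0 <= r -> 0 < h -> h <= 1 -> r + h <= t -> 0 < ep -> ep <= 1 ->
    0 < n -> mean_le P (fun w => (`|U r w| <= ep)%R%:R) pi ->
    `|e (r + h) - e r| <= C * (Num.sqrt h ^+ 3 / ep + h * (n + pi / n)).
  move=> r0 h0 h1 rt ep0 ep1 n0 B.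
  have := step (s0 + t - r) r h ep n pi.
  rewrite (_ : s0 + t - r - h = s0 + t - (r + h)); last by ring.
  apply => //; [apply: sI|apply: sI|]; lra.
apply/eqP; rewrite -subr_eq0 -normr_le0; apply/ler_addgt0Pr => k k0; rewrite add0r.
(* the initial interval [0, t0], on which the trivial small ball bound is used *)
pose t0' := Num.min t (Num.min 1 (k / (2 * (3 * C + 1)))).
have C1 : 0 < 3 * C + 1 by lra.
have t00 : 0 < t0' by rewrite !lt_min t0 ltr01/= divr_gt0// mulr_gt0.
have t0t : t0' <= t by rewrite ge_min lexx.
have t01 : t0' <= 1 by rewrite /t0' !ge_min lexx !orbT.
have t0k : (3 * C + 1) * t0' <= k / 2.
  have : t0' <= k / (2 * (3 * C + 1)) by rewrite /t0' !ge_min lexx !orbT.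
  rewrite ler_pdivlMr ?mulr_gt0// => H; lra.
have start : `|e t0' - e 0| <= k / 2.
  have := estep 0 t0' 1 1 1 (lexx 0) t00 t01; rewrite add0r => /(_ t0t ltr01 (lexx 1) ltr01).
  have mI : measurable_fun setT (fun w => (`|U 0 w| <= 1)%R%:R : R).
    apply: measurable_indicator_le; apply: measurableT_comp => //.
    exact: (adapted_measurable hF (lexx 0) aU).
  have : mean_le P (fun w => (`|U 0 w| <= 1)%R%:R) 1.
    split => //.
    - apply: (@le_trans _ _ (\int[P]_w 1%:E)%E); last by rewrite integral_cst//= probability_setT mule1.
      apply: ge0_le_integral => //.
      + exact/measurable_EFinP.
      + by move=> w _; rewrite lee_fin lern1; case: (`|U 0 w| <= 1).
  move=> B /(_ B) H; apply: (le_trans H); rewrite !divr1.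
  have q1 : Num.sqrt t0' <= 1 by rewrite -[leRHS]sqrtr1 ler_sqrt.
  have : Num.sqrt t0' ^+ 3 <= t0'.
    by rewrite exprS sqr_sqrtr ?(ltW t00)// ler_piMl// (ltW t00).
  move=> q3; apply: le_trans t0k.
  have : C * (Num.sqrt t0' ^+ 3 + t0' * (1 + 1)) <= C * (3 * t0') by rewrite ler_wpM2l//; lra.
  by lra.
(* on [t0, t] the exceptional probability is made small by the choice of r *)
pose r := Num.min t0' (k / (2 * (5 * C * t + 1))).
have Ct : 0 < 5 * C * t + 1 by have := mulr_ge0 C0 (ltW t0); lra.
have r0 : 0 < r by rewrite lt_min t00 divr_gt0// mulr_gt0.
have rt0 : r <= t0' by rewrite ge_min lexx.
have r1 : r <= 1 by exact: le_trans t01.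
have rk : (5 * C * t + 1) * r <= k / 2.
  have : r <= k / (2 * (5 * C * t + 1)) by rewrite /r !ge_min lexx !orbT.
  rewrite ler_pdivlMr ?mulr_gt0// => H; lra.
have r40 : 0 < r ^+ 4 by rewrite exprn_gt0.
have r41 : r ^+ 4 <= 1 by rewrite exprn_ile1// ltW.
have r4t : r ^+ 4 <= t0'.
  by apply: le_trans rt0; rewrite exprS ler_piMr ?(ltW r0)// exprn_ile1// ltW.
have small_step s h : t0' <= s -> 0 < h -> h <= r ^+ 10 -> s + h <= t ->
    `|e (s + h) - e s| <= 5 * C * r * h.
  move=> ts h0 hr sht; have s00 : 0 <= s by rewrite (le_trans _ ts)// ltW.
  have h1 : h <= 1 by rewrite (le_trans hr)// exprn_ile1// ltW.
  have B := mean_small_velocity r40 (le_trans r4t ts) _.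
  have st : s <= tau0 by lra.
  apply: (le_trans (estep s h (r ^+ 4) r _ s00 h0 h1 sht r40 r41 r0 (B st))).
  have -> : Num.sqrt (r ^+ 4) = r ^+ 2.
    by rewrite (_ : r ^+ 4 = (r ^+ 2) ^+ 2) ?sqrtr_sqr ?ger0_norm ?sqr_ge0// -exprM.
  have -> : 3 * r ^+ 2 / r = 3 * r by field; exact: lt0r_neq0.
  have q5 : Num.sqrt h <= r ^+ 5.
    rewrite -[leRHS]ger0_norm ?exprn_ge0 ?(ltW r0)// -sqrtr_sqr ler_wsqrtr//.
    by rewrite -exprM.
  have q3 : Num.sqrt h ^+ 3 / r ^+ 4 <= h * r.
    rewrite ler_pdivrMr// exprSr sqr_sqrtr ?(ltW h0)// -mulrA ler_wpM2l ?(ltW h0)//.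
  have -> : 5 * C * r * h = C * (5 * r * h) by ring.
  rewrite ler_wpM2l//; move: q3; set q := _ / _; lra.
pose L := t - t0'; have L0 : 0 <= L by rewrite subr_ge0.
have r100 : 0 < r ^+ 10 by rewrite exprn_gt0.
pose N := (Num.truncn (L / r ^+ 10)).+1.
have Nn : L / r ^+ 10 < N%:R by rewrite /N; exact: truncnS_gt.
have N0 : (0 : R) < N%:R by rewrite ltr0n.
pose h := L / N%:R.
have hr : h <= r ^+ 10.
  by rewrite /h ler_pdivrMr// mulrC -ler_pdivrMr// ltW.
have hN : h * N%:R = L by rewrite /h divfK// gt_eqF.
have chain m : (m <= N)%N -> `|e (t0' + h * m%:R) - e t0'| <= 5 * C * r * (h * m%:R).
  move: L0; rewrite le_eqVlt => /predU1P[L00|L0].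
    by rewrite /h -L00 !mul0r addr0 subrr normr0 mulr0.
  have h0 : 0 < h by rewrite divr_gt0.
  elim: m => [|m IH mN]; first by rewrite mulr0 addr0 subrr normr0 mulr0.
  have hm : 0 <= h * m%:R by rewrite mulr_ge0// ltW.
  have mE : h * m.+1%:R = h * m%:R + h by rewrite -natr1 mulrDr mulr1.
  have le_L : h * m.+1%:R <= L by rewrite -hN ler_pM2l// ler_nat.
  have := small_step (t0' + h * m%:R) h; rewrite mE addrA => S.
  have {}S : `|e (t0' + h * m%:R + h) - e (t0' + h * m%:R)| <= 5 * C * r * h.
    apply: S => //; first by rewrite lerDl.
    by move: le_L; rewrite mE /L; lra.
  have {}IH := IH (ltnW mN).
  rewrite (_ : e _ - e t0' = (e (t0' + h * m%:R + h) - e (t0' + h * m%:R)) +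
    (e (t0' + h * m%:R) - e t0')); last by ring.
  by rewrite (le_trans (ler_normD _ _))// mulrDr addrC lerD.
have := chain N (leqnn _); rewrite hN (_ : t0' + L = t); last by rewrite /L; ring.
move=> fin; rewrite (_ : e t - e 0 = (e t - e t0') + (e t0' - e 0)); last by ring.
apply: (le_trans (ler_normD _ _)).
have : 5 * C * r * L <= 5 * C * r * t.
  by rewrite ler_wpM2l ?mulr_ge0// ?(ltW r0)// /L; lra.
by lra.
Qed.

End conservation.

(** * Terminal values *)

Section terminal_value.
Context {d : measure_display} {T : measurableType d} {R : realType}.
Variable P : probability T R.
Variables (F : R -> set (set T)) (W : R -> T -> R) (tau0 : R) (g : R -> R) (U V : R -> T -> R).
Hypothesis sl : sliding P F W tau0 g U V.
Variables (p : R) (a as_ au auu b bs bu buu : R -> R -> R).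
Hypothesis ds : forall lo hi, 0 < lo ->
  exists K, dual_system lo hi K p g a as_ au auu b bs bu buu.
Variables (C a0 : R) (b0 : R -> R).
Hypotheses (C0 : 0 <= C) (mb0 : measurable_fun setT b0).
Hypothesis growth : forall s u, 0 < s -> s <= 1 ->
  `|a s u| <= C * (1 + `|u|) /\ `|b s u| <= C * (1 + `|u|) ^+ 2.
Hypothesis limit_a : forall u, u != 0 -> a n.+1%:R^-1 u @[n --> \oo] --> a0.
Hypothesis limit_b : forall u, u != 0 -> b n.+1%:R^-1 u @[n --> \oo] --> b0 u.

(** The dual functions are singular at s = 0: the conservation law is used with
    the time to go 1 / (n + 1) at the end, and the limit is taken by dominated
    convergence. The coefficients need not converge at u = 0, but the velocity
    is almost surely different from 0. *)
Lemma terminal_identity t beta : 0 < t -> t <= tau0 ->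
  b (n.+1%:R^-1 + t) 0 @[n --> \oo] --> beta ->
  P.-integrable setT (EFin \o (fun w => p * V t w ^+ 2 + V t w * a0 + b0 (U t w))) /\
  \int[P]_w (p * V t w ^+ 2 + V t w * a0 + b0 (U t w)) = beta.
Proof.
move=> t0 tT cb.
have hF := sl_filtration sl.
have mU := adapted_measurable hF (ltW t0) (sl_adapted sl).
have mV := adapted_measurable hF (ltW t0) (sl_adapted_position sl).
pose s n : R := n.+1%:R^-1.
have s0 n : 0 < s n by rewrite invr_gt0 ltr0n.
have s1 n : s n <= 1 by rewrite invf_le1 ?ltr0n// ler1n.
have sI n : s n <= s n <= s n + t by rewrite lexx lerDl ltW.
have [K1 ds1] := ds 2 ltr01.
have [m m1 mm] := mean_weight_sqr sl ds1.
have mW := mm t (ltW t0) tT.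
pose f n w := dual_fun p a b (s n) (U t w) (V t w).
have mf n : measurable_fun setT (f n).
  by have [K dsn] := ds (s n + t) (s0 n); exact: (measurable_dual_fun sl dsn (sI n) (ltW t0)).
have fE n : \int[P]_w f n w = b (s n + t) 0.
  have [K dsn] := ds (s n + t) (s0 n).
  by rewrite (dual_mean_conserved sl dsn)// ltW.
pose l w := p * V t w ^+ 2 + V t w * a0 + b0 (U t w).
have ml : measurable_fun setT l.
  apply: measurable_funD; last exact: measurableT_comp.
  by apply: measurable_funD; apply: measurable_funM => //; exact: measurable_funX.
pose B w := (`|p| + 2 * C) * weight U V t w ^+ 2.
have B0 : mean_le P B ((`|p| + 2 * C) * m).
  by apply: mean_leZ => //; rewrite addr_ge0// mulr_ge0.
have fB n w : `|f n w| <= B w.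
  have [aB bB] := growth (U t w) (s0 n) (s1 n).
  rewrite /f /dual_fun /B /weight.
  have u0 := normr_ge0 (U t w); have v0 := normr_ge0 (V t w).
  set M := 1 + _ + _.
  have vM : `|V t w| <= M by rewrite /M; lra.
  have uM : 1 + `|U t w| <= M by rewrite /M; lra.
  have T1 : `|p * V t w ^+ 2| <= `|p| * M ^+ 2.
    apply: norm_mul_le => //; rewrite normrX lerXn2r ?nnegrE//; lra.
  have T2 : `|V t w * a (s n) (U t w)| <= M * (C * M).
    by apply: norm_mul_le => //; rewrite (le_trans aB)// ler_wpM2l.
  have T3 : `|b (s n) (U t w)| <= C * M ^+ 2.
    by rewrite (le_trans bB)// ler_wpM2l// lerXn2r ?nnegrE//; lra.
  rewrite (le_trans (ler_normD _ _))//.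
  have := ler_normD (p * V t w ^+ 2) (V t w * a (s n) (U t w)).
  have -> : (`|p| + 2 * C) * M ^+ 2 = `|p| * M ^+ 2 + M * (C * M) + C * M ^+ 2 by ring.
  by lra.
have fl : {ae P, forall w, f n w @[n --> \oo] --> l w}.
  apply: filterS (velocity_neq0 sl t0 tT) => w u0; rewrite /f /dual_fun /l.
  apply: cvgD; last exact: limit_b.
  apply: cvgD; first exact: cvg_cst.
  by apply: cvgM; [exact: cvg_cst|exact: limit_a].
have iB : P.-integrable setT (EFin \o B).
  have [mB Bp _] := B0; apply: (integrable_mean_le mB _ B0) => w.
  by rewrite ger0_norm.
have mfE n : measurable_fun setT (fun w => (f n w)%:E) by exact/measurable_EFinP.
have mlE : measurable_fun setT (EFin \o l) by exact/measurable_EFinP.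
have flE : {ae P, forall w, setT w -> (f n w)%:E @[n --> \oo] --> (l w)%:E}.
  by apply: filterS fl => w H _; apply: cvg_EFin => //; near=> n.
have fBE : {ae P, forall w n, setT w -> (`|(f n w)%:E| <= (B w)%:E)%E}.
  by apply: aeW => w n _; rewrite lee_fin.
have [il _ cl] := dominated_convergence measurableT mfE mlE flE iB fBE.
split => //.
have /fine_cvgP[_ cl'] : ((\int[P]_w (f n w)%:E)%E @[n --> \oo] --> (\int[P]_w l w)%:E).
  rewrite /Rintegral fineK//; exact: integrable_fin_num.
apply: (cvg_unique _ cl') => //.
by move: cb; apply: cvg_trans; apply: near_eq_cvg; near=> n; rewrite /= -fE.
Unshelve. all: end_near. Qed.

End terminal_value.

(** * The dual systems of the theorem *)

Section dual_systems.
Context {R : realType}.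

Lemma dual_class_scale (lo hi : R) n (K k : R) c cs cu cuu :
  dual_class lo hi n K c cs cu cuu ->
  dual_class lo hi n (`|k| * K) (fun s u => k * c s u) (fun s u => k * cs s u)
    (fun s u => k * cu s u) (fun s u => k * cuu s u).
Proof.
move=> [H1 H2 H3 H4 H5 H6].
have w (x y : R) : `|x| <= y -> `|k * x| <= `|k| * y by rewrite normrM => ?; rewrite ler_wpM2l.
split.
- by move=> s sI; have [? ? ?] := H1 s sI; split; apply: measurable_funM.
- by move=> s u sI; rewrite -mulrA w// H2.
- by move=> s u sI; rewrite -mulrA w// H3.
- by move=> s u sI; rewrite w// H4.
- move=> s u v sI.
  rewrite (_ : _ - _ = k * (c s v - c s u - cu s u * (v - u) - cuu s u / 2 * (v - u) ^+ 2)).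
    by apply: le_trans (w _ _ (H5 s u v sI)) _; rewrite mulrA.
  by ring.
- move=> s t u sI tI.
  rewrite (_ : _ - _ = k * (c t u - c s u - cs s u * (t - s))); last by ring.
  by apply: le_trans (w _ _ (H6 s t u sI tI)) _; rewrite !mulrA.
Qed.

Lemma dual_class_cst (lo hi k : R) :
  dual_class lo hi 1 `|k| (fun _ _ : R => k) (fun _ _ => 0) (fun _ _ => 0) (fun _ _ => 0).
Proof.
have M1 (u : R) : 1 <= 1 + `|u| by rewrite lerDl.
split=> //.
- by move=> s u sI; rewrite expr1 ler_peMr.
- by move=> s u sI; rewrite normr0 expr0 mulr1.
- by move=> s u sI; rewrite normr0.
- move=> s u v sI; rewrite !mul0r !subr0 subrr normr0.
  by rewrite mulr_ge0// addr_ge0// ?exprn_ge0// mulr_ge0 ?exprn_ge0// /crossing ler0n.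
- move=> s t u sI tI; rewrite mul0r !subr0 subrr normr0.
  by rewrite !mulr_ge0 ?exprn_ge0// addr_ge0.
Qed.

(* Both expansions are exact, since the function is a polynomial. *)
Lemma dual_class_velocity (lo hi : R) : 0 < lo ->
  dual_class lo hi 2 (2 + 2 * `|hi|) (fun s u : R => u ^+ 2 + 2 * s) (fun _ _ => 2)
    (fun (_ u : R) => 2 * u) (fun _ _ => 2).
Proof.
move=> lo0; have hi0 := normr_ge0 hi.
have sh s : lo <= s <= hi -> 0 <= s <= `|hi|.
  by move=> /andP[ls sh]; rewrite (le_trans (ltW lo0) ls) (le_trans sh)// ler_norm.
have K0 : 0 <= 2 + 2 * `|hi| by lra.
split.
- move=> s _; split => //.
  + by apply: measurable_funD => //; exact: measurable_funX.
  + exact: measurable_funM.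
- move=> s u /sh /andP[s0 sB]; have u0 := normr_ge0 u.
  rewrite ger0_norm; last by rewrite addr_ge0 ?sqr_ge0// mulr_ge0.
  rewrite -[u ^+ 2]real_normK ?num_real//.
  have : `|hi| <= `|hi| * (1 + `|u|) ^+ 2 by rewrite ler_peMr// expr_ge1//; lra.
  by have := sqr_ge0 `|u|; lra.
- move=> s u sI; have u0 := normr_ge0 u; rewrite expr1 normrM ger0_norm//.
  by have : 0 <= `|hi| * (1 + `|u|) by [rewrite mulr_ge0// addr_ge0]; lra.
- by move=> s u sI; rewrite ger0_norm//; lra.
- move=> s u v sI; rewrite (_ : _ - _ = 0) ?normr0; last by field.
  by rewrite mulr_ge0// addr_ge0// ?exprn_ge0// mulr_ge0 ?exprn_ge0// /crossing ler0n.
- move=> s t u sI tI; rewrite (_ : _ - _ = 0) ?normr0; last by ring.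
  by rewrite !mulr_ge0 ?exprn_ge0// addr_ge0.
Qed.

Lemma lipschitz_scale (c : R -> R -> R) (K k : R) lo hi :
  (forall s u v, lo <= s <= hi -> `|c s v - c s u| <= K * `|v - u|) ->
  forall s u v, lo <= s <= hi -> `|k * c s v - k * c s u| <= `|k| * K * `|v - u|.
Proof. by move=> H s u v sI; rewrite -mulrBr normrM -mulrA ler_wpM2l// H. Qed.

Lemma norm_lipschitz (x y : R) : `| `|x| - `|y| | <= `|x - y|.
Proof. exact: ler_dist_dist. Qed.

Lemma dual_system_of_classes (lo hi p : R) g a as_ au auu b bs bu buu Ka Kb L :
  0 <= Ka -> 0 <= Kb -> 0 <= L ->
  dual_class lo hi 1 Ka a as_ au auu -> dual_class lo hi 2 Kb b bs bu buu ->
  (forall s u v, lo <= s <= hi -> `|a s v - a s u| <= L * `|v - u|) ->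
  (forall x y, `|g x - g y| <= `|x - y|) -> g 0 = 0 ->
  (forall s u, lo <= s <= hi ->
    as_ s u = auu s u - 2 * Num.sg u * au s u + 2 * p * g u) ->
  (forall s u, lo <= s <= hi ->
    bs s u = buu s u - 2 * Num.sg u * bu s u + g u * a s u) ->
  exists K, dual_system lo hi K p g a as_ au auu b bs bu buu.
Proof.
move=> Ka0 Kb0 L0 ca cb la lg g0 ea eb; have p0 := normr_ge0 p.
exists (1 + `|p| + Ka + Kb + L); split => //; try lra.
- by apply: dual_class_weaken ca; lra.
- by apply: dual_class_weaken cb; lra.
- by move=> s u v sI; rewrite (le_trans (la s u v sI))// ler_wpM2r//; lra.
Qed.

Let odd1 := @odd_form1 R.
Let even1 := @even_form1 R.
Let odd2 := @odd_form2 R.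
Let even2 := @even_form2 R.

Lemma displacement_system (lo hi : R) : 0 < lo -> exists K, dual_system lo hi K 768 id
  (fun s u : R => 96 * odd_ext odd1 s u) (fun s u => 96 * odd_ext (fds odd1) s u)
  (fun s u => 96 * even_ext (fdx odd1) s u) (fun s u => 96 * odd_ext (fdx (fdx odd1)) s u)
  (even_ext odd2) (even_ext (fds odd2)) (odd_ext (fdx odd2)) (even_ext (fdx (fdx odd2))).
Proof.
move=> lo0; have sp s : lo <= s <= hi -> 0 < s by move=> /andP[ls _]; exact: lt_le_trans ls.
have [Ka Ka0 ca] : exists2 K, 0 <= K & dual_class lo hi 1 K (odd_ext odd1)
    (odd_ext (fds odd1)) (even_ext (fdx odd1)) (odd_ext (fdx (fdx odd1))).
  by apply: odd_class => // s s0; exact: odd_form1_at0.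
have [Kb Kb0 cb] : exists2 K, 0 <= K & dual_class lo hi 2 K (even_ext odd2)
    (even_ext (fds odd2)) (odd_ext (fdx odd2)) (even_ext (fdx (fdx odd2))).
  by apply: even_class => // s s0; exact: odd_form2_dx_at0.
have [L L0 la] := @odd_lipschitz R lo hi odd1 lo0 isT (fun s s0 => odd_form1_at0 s0).
apply: (dual_system_of_classes (Ka := `|96| * Ka) (Kb := Kb) (L := `|96| * L)) => //.
- exact: mulr_ge0.
- exact: mulr_ge0.
- exact: dual_class_scale.
- exact: lipschitz_scale.
- move=> s u sI; rewrite (odd_ext_pde (odd_form1_pde `|u| (sp s sI))).
  by rewrite [Num.sg u * (16 * _)]mulrCA -numEsg; ring.
- move=> s u sI; rewrite (even_ext_pde (sp s sI) (odd_form2_dx_at0 (sp s sI)) (odd_form2_pde `|u| (sp s sI))).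
  rewrite /odd1 [in RHS]/odd_ext -/(odd_ext _ s u) /odd2; congr (_ + _).
  by move: (feval odd_form1 s `|u|) => X; rewrite normrEsg; ring.
Qed.

Lemma distance_system (lo hi : R) : 0 < lo -> exists K, dual_system lo hi K 768 (fun u : R => `|u|)
  (fun s u => 96 * even_ext even1 s u) (fun s u => 96 * even_ext (fds even1) s u)
  (fun s u => 96 * odd_ext (fdx even1) s u) (fun s u => 96 * even_ext (fdx (fdx even1)) s u)
  (even_ext even2) (even_ext (fds even2)) (odd_ext (fdx even2)) (even_ext (fdx (fdx even2))).
Proof.
move=> lo0; have sp s : lo <= s <= hi -> 0 < s by move=> /andP[ls _]; exact: lt_le_trans ls.
have [Ka Ka0 ca] : exists2 K, 0 <= K & dual_class lo hi 1 K (even_ext even1)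
    (even_ext (fds even1)) (odd_ext (fdx even1)) (even_ext (fdx (fdx even1))).
  by apply: even_class => // s s0; exact: even_form1_dx_at0.
have [Kb Kb0 cb] : exists2 K, 0 <= K & dual_class lo hi 2 K (even_ext even2)
    (even_ext (fds even2)) (odd_ext (fdx even2)) (even_ext (fdx (fdx even2))).
  by apply: even_class => // s s0; exact: even_form2_dx_at0.
have [L L0 la] := @even_lipschitz R lo hi even1 lo0 isT.
apply: (dual_system_of_classes (Ka := `|96| * Ka) (Kb := Kb) (L := `|96| * L)) => //.
- exact: mulr_ge0.
- exact: mulr_ge0.
- exact: dual_class_scale.
- exact: lipschitz_scale.
- exact: norm_lipschitz.
- exact: normr0.
- move=> s u sI; rewrite (even_ext_pde (sp s sI) (even_form1_dx_at0 (sp s sI)) (even_form1_pde `|u| (sp s sI))).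
  by ring.
- move=> s u sI; rewrite (even_ext_pde (sp s sI) (even_form2_dx_at0 (sp s sI)) (even_form2_pde `|u| (sp s sI))).
  by congr (_ + _); rewrite /even_ext; ring.
Qed.

Lemma mean_displacement_system (lo hi : R) : 0 < lo -> exists K, dual_system lo hi K 0 id
  (fun _ _ => 16) (fun _ _ => 0) (fun _ _ => 0) (fun _ _ => 0)
  (odd_ext odd1) (odd_ext (fds odd1)) (even_ext (fdx odd1)) (odd_ext (fdx (fdx odd1))).
Proof.
move=> lo0; have sp s : lo <= s <= hi -> 0 < s by move=> /andP[ls _]; exact: lt_le_trans ls.
have [Kb Kb0 cb] : exists2 K, 0 <= K & dual_class lo hi 2 K (odd_ext odd1)
    (odd_ext (fds odd1)) (even_ext (fdx odd1)) (odd_ext (fdx (fdx odd1))).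
  by apply: odd_class => // s s0; exact: odd_form1_at0.
apply: (dual_system_of_classes (Ka := `|16|) (Kb := Kb) (L := 0)) => //.
- exact: dual_class_cst.
- by move=> s u v _; rewrite subrr normr0 mul0r.
- by move=> s u _; rewrite !mulr0 mul0r subrr addr0.
- move=> s u sI; rewrite (odd_ext_pde (odd_form1_pde `|u| (sp s sI))).
  by congr (_ + _); rewrite mulrCA -numEsg mulrC.
Qed.

Lemma mean_distance_system (lo hi : R) : 0 < lo -> exists K, dual_system lo hi K 0 (fun u : R => `|u|)
  (fun _ _ => 16) (fun _ _ => 0) (fun _ _ => 0) (fun _ _ => 0)
  (even_ext even1) (even_ext (fds even1)) (odd_ext (fdx even1)) (even_ext (fdx (fdx even1))).
Proof.
move=> lo0; have sp s : lo <= s <= hi -> 0 < s by move=> /andP[ls _]; exact: lt_le_trans ls.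
have [Kb Kb0 cb] : exists2 K, 0 <= K & dual_class lo hi 2 K (even_ext even1)
    (even_ext (fds even1)) (odd_ext (fdx even1)) (even_ext (fdx (fdx even1))).
  by apply: even_class => // s s0; exact: even_form1_dx_at0.
apply: (dual_system_of_classes (Ka := `|16|) (Kb := Kb) (L := 0)) => //.
- exact: dual_class_cst.
- by move=> s u v _; rewrite subrr normr0 mul0r.
- exact: norm_lipschitz.
- exact: normr0.
- by move=> s u _; rewrite !mulr0 mul0r subrr addr0.
- move=> s u sI; rewrite (even_ext_pde (sp s sI) (even_form1_dx_at0 (sp s sI)) (even_form1_pde `|u| (sp s sI))).
  by congr (_ + _); rewrite mulrC.
Qed.

(** The generator of the velocity maps u^2 to 2 - 4 |u|, and the distance
    compensates the second term: E U1^2 + 4 E U3 grows at the rate 2. *)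
Lemma velocity_system (lo hi : R) : 0 < lo -> exists K, dual_system lo hi K 0 (fun u : R => `|u|)
  (fun _ _ => 4) (fun _ _ => 0) (fun _ _ => 0) (fun _ _ => 0)
  (fun s u : R => u ^+ 2 + 2 * s) (fun _ _ => 2) (fun _ u : R => 2 * u) (fun _ _ => 2).
Proof.
move=> lo0.
apply: (dual_system_of_classes (Ka := `|4|) (Kb := 2 + 2 * `|hi|) (L := 0)) => //.
- exact: dual_class_cst.
- exact: dual_class_velocity.
- by move=> s u v _; rewrite subrr normr0 mul0r.
- exact: norm_lipschitz.
- exact: normr0.
- by move=> s u _; rewrite !mulr0 mul0r subrr addr0.
- by move=> s u _; rewrite normrEsg; ring.
Qed.

End dual_systems.

(** * Means and second moments *)

Section moments.
Context {d : measure_display} {T : measurableType d} {R : realType}.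
Variable P : probability T R.

Lemma expectation_Rintegral (X : T -> R) : P.-integrable setT (EFin \o X) ->
  'E_P[X]%E = (\int[P]_w X w)%:E.
Proof. by move=> iX; rewrite unlock /Rintegral fineK//; exact: integrable_fin_num. Qed.

Lemma variance_Rintegral (X : T -> R) : P.-integrable setT (EFin \o X) ->
  P.-integrable setT (EFin \o (fun w => X w ^+ 2)) ->
  'V_P[X]%E = (\int[P]_w (X w ^+ 2) - (\int[P]_w X w) ^+ 2)%:E.
Proof.
move=> iX iX2; rewrite /variance.
have XX : (X * X)%R = (fun w => X w ^+ 2) by [].
rewrite covarianceE ?Lfun1_integrable// ?XX//.
by rewrite !expectation_Rintegral// EFinB EFinM.
Qed.

End moments.

Section limits_of_forms.
Context {R : realType}.

Lemma cvg_harmonic_shift (t : R) : n.+1%:R^-1 + t @[n --> \oo] --> t.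
Proof.
rewrite -[X in _ --> X]add0r; apply: cvgD; last exact: cvg_cst.
exact: cvg_harmonic.
Qed.

Lemma feval_vanish_seq n f (x : R) : 0 < x -> all (tregular n) f -> all tvanishing f ->
  feval f m.+1%:R^-1 x @[m --> \oo] --> 0.
Proof.
move=> x0 rf vf; have [K K0 H] := feval_vanish x0 rf vf.
have cs : K * Num.sqrt m.+1%:R^-1 @[m --> \oo] --> 0.
  rewrite -(mulr0 K) -[X in K * X]sqrtr0; apply: cvgM; first exact: cvg_cst.
  by apply: (cvg_comp _ _ (@cvg_harmonic R)); exact: sqrt_continuous.
apply: norm_cvg0; apply: (squeeze_cvgr _ (cvg_cst 0) cs).
near=> m; apply/andP; split => //.
apply: H; first by rewrite invr_gt0 ltr0n/= invf_le1 ?ltr0n// ler1n.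
rewrite -[leRHS]invrK lef_pV2 ?posrE ?ltr0n ?invr_gt0 ?divr_gt0//.
apply: (@le_trans _ _ m%:R); last by rewrite ler_nat.
by near: m; exact: nbhs_infty_ger.
Unshelve. all: end_near. Qed.

Lemma even_ext_vanish n f (u : R) : u != 0 -> all (tregular n) f && all tvanishing f ->
  even_ext f m.+1%:R^-1 u @[m --> \oo] --> 0.
Proof. by move=> u0 /andP[rf vf]; apply: feval_vanish_seq rf vf; rewrite normr_gt0. Qed.

Lemma odd_ext_vanish n f (u : R) : u != 0 -> all (tregular n) f && all tvanishing f ->
  odd_ext f m.+1%:R^-1 u @[m --> \oo] --> 0.
Proof.
move=> u0 /andP[rf vf]; rewrite -(mulr0 (Num.sg u)); apply: cvgM; first exact: cvg_cst.
by apply: feval_vanish_seq rf vf; rewrite normr_gt0.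
Qed.

Lemma even_ext_initial f (t : R) : 0 < t ->
  even_ext f (m.+1%:R^-1 + t) 0 @[m --> \oo] --> feval f t 0.
Proof.
move=> t0; rewrite /even_ext normr0.
apply: (@cvg_comp _ _ _ (fun m : nat => m.+1%:R^-1 + t) (feval f ^~ 0)); first exact: cvg_harmonic_shift.
have H := der_feval_s f 0 t0.
have D : differentiable (feval f ^~ 0) t by apply/derivable1_diffP; exact: ex_derive.
exact: differentiable_continuous D.
Qed.

Lemma even_ext_bound n f : all (tregular n) f -> exists2 K, 0 <= K &
  forall s u : R, 0 < s -> s <= 1 -> `|even_ext f s u| <= K * (1 + `|u|) ^+ n.
Proof.
move=> rf; have [K K0 H] := feval_regular 1 rf; exists K => // s u s0 s1.
by apply: H => //; rewrite s0.
Qed.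

Lemma odd_ext_bound n f : all (tregular n) f -> exists2 K, 0 <= K &
  forall s u : R, 0 < s -> s <= 1 -> `|odd_ext f s u| <= K * (1 + `|u|) ^+ n.
Proof.
move=> rf; have [K K0 H] := even_ext_bound rf; exists K => // s u s0 s1.
apply: le_trans (H s u s0 s1); rewrite normrM normr_sg.
by case: (u != 0); rewrite ?mul1r// mul0r.
Qed.

End limits_of_forms.

Section mean_values.
Context {d : measure_display} {T : measurableType d} {R : realType}.
Variable P : probability T R.
Variables (F : R -> set (set T)) (W : R -> T -> R) (tau0 : R) (U U2 U3 : R -> T -> R).
Hypothesis sl2 : sliding P F W tau0 id U U2.
Hypothesis sl3 : sliding P F W tau0 (fun u => `|u|) U U3.

Let weight2 : exists2 m, 1 <= m & forall t, 0 <= t -> t <= tau0 ->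
  mean_le P (fun w => weight U U2 t w ^+ 2) m.
Proof.
have [K ds] := @displacement_system R 1 1 ltr01.
by have [m m1 mm] := mean_weight_sqr sl2 ds; exists m.
Qed.

Let weight3 : exists2 m, 1 <= m & forall t, 0 <= t -> t <= tau0 ->
  mean_le P (fun w => weight U U3 t w ^+ 2) m.
Proof.
have [K ds] := @distance_system R 1 1 ltr01.
by have [m m1 mm] := mean_weight_sqr sl3 ds; exists m.
Qed.

Let mU t : 0 <= t -> measurable_fun setT (U t).
Proof. by move=> t0; exact: (adapted_measurable (sl_filtration sl2) t0 (sl_adapted sl2)). Qed.
Let mU2 t : 0 <= t -> measurable_fun setT (U2 t).
Proof. by move=> t0; exact: (adapted_measurable (sl_filtration sl2) t0 (sl_adapted_position sl2)). Qed.
Let mU3 t : 0 <= t -> measurable_fun setT (U3 t).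
Proof. by move=> t0; exact: (adapted_measurable (sl_filtration sl3) t0 (sl_adapted_position sl3)). Qed.

Let velocity_weight V t w : `|U t w| <= weight U V t w ^+ 2 /\ `|U t w ^+ 2| <= weight U V t w ^+ 2.
Proof.
rewrite /weight normrX; have := normr_ge0 (U t w); have := normr_ge0 (V t w).
by move: `|U t w| `|V t w| => u v v0 u0; split; nra.
Qed.

Let position_weight V t w : `|V t w| <= weight U V t w ^+ 2 /\ `|V t w ^+ 2| <= weight U V t w ^+ 2.
Proof.
rewrite /weight normrX; have := normr_ge0 (U t w); have := normr_ge0 (V t w).
by move: `|U t w| `|V t w| => u v v0 u0; split; nra.
Qed.

Lemma integrable_components t : 0 <= t -> t <= tau0 ->
  [/\ P.-integrable setT (EFin \o U t), P.-integrable setT (EFin \o U2 t) &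
      P.-integrable setT (EFin \o U3 t)] /\
  [/\ P.-integrable setT (EFin \o (fun w => U t w ^+ 2)),
      P.-integrable setT (EFin \o (fun w => U2 t w ^+ 2)) &
      P.-integrable setT (EFin \o (fun w => U3 t w ^+ 2))].
Proof.
move=> t0 tT; have m1 := mU t0; have m2 := mU2 t0; have m3 := mU3 t0.
have [k2 _ H2] := weight2; have [k3 _ H3] := weight3.
have in2 X (mX : measurable_fun setT X) XB := integrable_mean_le mX XB (H2 t t0 tT).
have in3 X (mX : measurable_fun setT X) XB := integrable_mean_le mX XB (H3 t t0 tT).
split; split.
- by apply: in2 => // w; have [] := velocity_weight U2 t w.
- by apply: in2 => // w; have [] := position_weight U2 t w.
- by apply: in3 => // w; have [] := position_weight U3 t w.
- by apply: in2 => [|w]; [exact: measurable_funX|have [] := velocity_weight U2 t w].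
- by apply: in2 => [|w]; [exact: measurable_funX|have [] := position_weight U2 t w].
- by apply: in3 => [|w]; [exact: measurable_funX|have [] := position_weight U3 t w].
Qed.

Let coefficient_bounds (a b : R -> R -> R) (k : R) K1 K2 : 0 <= k -> 0 <= K1 -> 0 <= K2 ->
  (forall s u, 0 < s -> s <= 1 -> `|a s u| <= K1 * (1 + `|u|) ^+ 1) ->
  (forall s u, 0 < s -> s <= 1 -> `|b s u| <= K2 * (1 + `|u|) ^+ 2) ->
  forall s u, 0 < s -> s <= 1 -> `|k * a s u| <= (k * K1 + K2) * (1 + `|u|) /\
     `|b s u| <= (k * K1 + K2) * (1 + `|u|) ^+ 2.
Proof.
move=> k0 K10 K20 B1 B2 s u s0 s1; have := B1 s u s0 s1; have := B2 s u s0 s1; rewrite expr1 => b2 b1.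
have u0 : 0 <= 1 + `|u| by rewrite addr_ge0.
split.
  rewrite normrM ger0_norm// mulrDl (le_trans (ler_wpM2l _ b1))//.
  by rewrite mulrA lerDl mulr_ge0.
by rewrite (le_trans b2)// mulrDl lerDr !mulr_ge0// exprn_ge0.
Qed.

Lemma displacement_sqr t : 0 < t -> t <= tau0 ->
  768 * \int[P]_w (U2 t w ^+ 2) = feval odd_form2 t 0.
Proof.
move=> t0 tT; have [_ [_ i2 _]] := integrable_components (ltW t0) tT.
have /andP[r1 v1] := @odd_form1_regular R; have /andP[r2 v2] := @odd_form2_regular R.
have [K1 K10 B1] := odd_ext_bound r1; have [K2 K20 B2] := even_ext_bound r2.
have [] := @terminal_identity _ _ _ P F W tau0 id U U2 sl2 _ _ _ _ _ _ _ _ _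
  (@displacement_system R) (96 * K1 + K2) 0 (fun=> 0) _ _ (coefficient_bounds _ K10 K20 B1 B2)
  _ _ t _ t0 tT (even_ext_initial t0) => //.
- by rewrite addr_ge0// mulr_ge0.
- move=> u u0; rewrite -(mulr0 96); apply: cvgM; first exact: cvg_cst.
  by apply: odd_ext_vanish u0 _; exact: odd_form1_regular.
- by move=> u u0; apply: even_ext_vanish u0 _; exact: odd_form2_regular.
- move=> _ <-; rewrite -RintegralZl//; apply: eq_Rintegral => w _.
  by rewrite mulr0 !addr0.
Qed.

Lemma distance_sqr t : 0 < t -> t <= tau0 ->
  768 * \int[P]_w (U3 t w ^+ 2) = feval even_form2 t 0.
Proof.
move=> t0 tT; have [_ [_ _ i3]] := integrable_components (ltW t0) tT.
have /andP[r1 v1] := @even_form1_regular R; have /andP[r2 v2] := @even_form2_regular R.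
have [K1 K10 B1] := even_ext_bound r1; have [K2 K20 B2] := even_ext_bound r2.
have [] := @terminal_identity _ _ _ P F W tau0 _ U U3 sl3 _ _ _ _ _ _ _ _ _
  (@distance_system R) (96 * K1 + K2) 0 (fun=> 0) _ _ (coefficient_bounds _ K10 K20 B1 B2)
  _ _ t _ t0 tT (even_ext_initial t0) => //.
- by rewrite addr_ge0// mulr_ge0.
- move=> u u0; rewrite -(mulr0 96); apply: cvgM; first exact: cvg_cst.
  by apply: even_ext_vanish u0 _; exact: even_form1_regular.
- by move=> u u0; apply: even_ext_vanish u0 _; exact: even_form2_regular.
- move=> _ <-; rewrite -RintegralZl//; apply: eq_Rintegral => w _.
  by rewrite mulr0 !addr0.
Qed.

Let mean_bounds (b : R -> R -> R) (k K : R) : 0 <= k -> 0 <= K ->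
  (forall s u, 0 < s -> s <= 1 -> `|b s u| <= K * (1 + `|u|) ^+ 2) ->
  forall s u : R, 0 < s -> s <= 1 -> `|k| <= (k + K) * (1 + `|u|) /\
     `|b s u| <= (k + K) * (1 + `|u|) ^+ 2.
Proof.
move=> k0 K0 B s u s0 s1; have u1 : 1 <= 1 + `|u| by rewrite lerDl.
have u0 : 0 <= 1 + `|u| by exact: le_trans u1.
split.
  rewrite ger0_norm// mulrDl.
  have : k <= k * (1 + `|u|) by rewrite ler_peMr.
  by have := mulr_ge0 K0 u0; lra.
by rewrite (le_trans (B s u s0 s1))// mulrDl lerDr mulr_ge0// exprn_ge0.
Qed.

Lemma mean_displacement t : 0 < t -> t <= tau0 -> \int[P]_w U2 t w = 0.
Proof.
move=> t0 tT; have [[_ i2 _] _] := integrable_components (ltW t0) tT.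
have [K K0 B] := @odd_ext_bound R 2 odd_form1 isT.
have [] := @terminal_identity _ _ _ P F W tau0 id U U2 sl2 _ _ _ _ _ _ _ _ _
  (@mean_displacement_system R) (16 + K) 16 (fun=> 0) _ _ (mean_bounds _ K0 B)
  _ _ t 0 t0 tT _ => //.
- exact: addr_ge0.
- by move=> u u0; exact: cvg_cst.
- by move=> u u0; apply: odd_ext_vanish u0 _; exact: odd_form1_regular.
- by under eq_fun do rewrite /odd_ext sgr0 mul0r; exact: cvg_cst.
- move=> _ E; apply: (@mulfI _ 16); first by rewrite pnatr_eq0.
  rewrite mulr0 -[RHS]E -RintegralZl//; apply: eq_Rintegral => w _; ring.
Qed.

Lemma mean_distance t : 0 < t -> t <= tau0 -> 16 * \int[P]_w U3 t w = feval even_form1 t 0.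
Proof.
move=> t0 tT; have [[_ _ i3] _] := integrable_components (ltW t0) tT.
have [K K0 B] := @even_ext_bound R 2 even_form1 isT.
have [] := @terminal_identity _ _ _ P F W tau0 _ U U3 sl3 _ _ _ _ _ _ _ _ _
  (@mean_distance_system R) (16 + K) 16 (fun=> 0) _ _ (mean_bounds _ K0 B)
  _ _ t _ t0 tT (even_ext_initial t0) => //.
- exact: addr_ge0.
- by move=> u u0; exact: cvg_cst.
- by move=> u u0; apply: even_ext_vanish u0 _; exact: even_form1_regular.
- move=> _ <-; rewrite -RintegralZl//; apply: eq_Rintegral => w _; ring.
Qed.

Lemma velocity_second_moment t : 0 < t -> t <= tau0 ->
  \int[P]_w (U t w ^+ 2) = 2 * t - 4 * \int[P]_w U3 t w.
Proof.
move=> t0 tT; have [[_ _ i3] [i1 _ _]] := integrable_components (ltW t0) tT.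
have B (s u : R) : 0 < s -> s <= 1 -> `|u ^+ 2 + 2 * s| <= 2 * (1 + `|u|) ^+ 2.
  move=> s0 s1; rewrite ger0_norm; last by rewrite addr_ge0 ?sqr_ge0// mulr_ge0// ltW.
  by rewrite -[u ^+ 2]real_normK ?num_real//; have := normr_ge0 u; have := sqr_ge0 `|u|; lra.
have [] := @terminal_identity _ _ _ P F W tau0 _ U U3 sl3 _ _ _ _ _ _ _ _ _
  (@velocity_system R) (4 + 2) 4 (fun u => u ^+ 2) _ _ (mean_bounds _ _ B)
  _ _ t (2 * t) t0 tT _ => //.
- by move=> u u0; exact: cvg_cst.
- move=> u u0; rewrite -[X in _ --> X]addr0; apply: cvgD; first exact: cvg_cst.
  by rewrite -(mulr0 2); apply: cvgM; [exact: cvg_cst|exact: cvg_harmonic].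
- under eq_fun do rewrite expr0n add0r.
  by apply: cvgM; [exact: cvg_cst|exact: cvg_harmonic_shift].
- move=> iS <-.
  have i4 : P.-integrable setT (EFin \o (fun w => 4 * U3 t w)).
    rewrite (_ : EFin \o _ = (fun w => 4%:E * (EFin \o U3 t) w))%E//.
    exact: integrableZl.
  rewrite -RintegralZl// -RintegralB//.
  by apply: eq_Rintegral => w _; ring.
Qed.

End mean_values.

(** * Mean of the velocity *)

Section mean_velocity.
Context {d : measure_display} {T : measurableType d} {R : realType}.
Variable P : probability T R.
Variables (F : R -> set (set T)) (W : R -> T -> R) (tau0 : R) (U U2 U3 : R -> T -> R).
Hypothesis sl2 : sliding P F W tau0 id U U2.
Hypothesis sl3 : sliding P F W tau0 (fun u => `|u|) U U3.

(** The mean displacement is 0 at all times. Its increment over [t - h, t] is h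
    times the mean velocity at time t - h up to an error of order h^(3/2), and
    the mean velocity at time t differs from the one at time t - h by at most a
    multiple of sqrt h. *)
Lemma mean_velocity t : 0 < t -> t <= tau0 -> \int[P]_w U t w = 0.
Proof.
move=> t0 tT; have hF := sl_filtration sl2; have hW := sl_wiener sl2.
have aU := sl_adapted sl2.
apply/eqP; rewrite -normr_le0; apply/ler_addgt0Pr => k k0; rewrite add0r.
pose q := Num.min 1 (Num.min (t / 2) (k / 26)).
have q0 : 0 < q by rewrite !lt_min ltr01 !divr_gt0.
have q1 : q <= 1 by rewrite ge_min lexx.
have qt : q <= t / 2 by rewrite /q !ge_min lexx !orbT.
have qk : 26 * q <= k.
  have : q <= k / 26 by rewrite /q !ge_min lexx !orbT.
  by lra.
pose h := q ^+ 2; have h0 : 0 < h by rewrite exprn_gt0.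
have hq : h <= q by rewrite /h expr2 ler_piMl// ltW.
pose r := t - h; have r0 : 0 < r by rewrite /r; lra.
have rE : r + h = t by rewrite /r; ring.
have rT : r <= tau0 by rewrite (le_trans _ tT)// /r gerBl ltW.
have rhT : r + h <= tau0 by rewrite rE.
have [[iUt i2t _] _] := integrable_components sl2 sl3 (ltW t0) tT.
have [[iUr i2r _] _] := integrable_components sl2 sl3 (ltW r0) rT.
have [Q [mQ Q0 iQ Hstep]] := one_step hF hW aU (sl_continuous sl2) (sl_velocity sl2)
  (sl_position sl2) (fun x y => lexx `|x - y|) (ltW r0) h0 rhT.
have q3 : 0 < q ^+ 3 by rewrite exprn_gt0.
have h12 : 8 * h ^+ 2 + 4 * h <= 12 * q ^+ 2.
  have : h ^+ 2 <= h by rewrite expr2 ler_piMl ?(ltW h0)// (le_trans hq).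
  by rewrite -/h; lra.
(* E U_r is recovered from E V_t = E V_r = 0 *)
have velocity_r : `|\int[P]_w U r w| <= 13 * q.
  have iZ : P.-integrable setT (EFin \o (fun w => h * U r w)).
    rewrite (_ : EFin \o _ = (fun w => h%:E * (EFin \o U r) w))%E//.
    exact: integrableZl.
  have iD := integrable_EFinB i2t i2r.
  have iX := integrable_EFinB iD iZ.
  have E : \int[P]_w (U2 t w - U2 r w - h * U r w) = - (h * \int[P]_w U r w).
    rewrite (RintegralB measurableT iD iZ) (RintegralB measurableT i2t i2r) RintegralZl//.
    by rewrite (mean_displacement sl2 sl3 t0 tT) (mean_displacement sl2 sl3 r0 rT) subrr sub0r.
  have B : mean_le P (fun w => q ^+ 3 + (q ^+ 3)^-1 * Q w) (q ^+ 3 + (q ^+ 3)^-1 * (12 * q ^+ 6)).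
    apply: mean_leD; first by apply: mean_le_cst; exact: ltW.
    apply: mean_leZ; first by rewrite invr_ge0 ltW.
    split => //; apply: (le_trans iQ); rewrite lee_fin.
    rewrite (_ : 12 * q ^+ 6 = 12 * q ^+ 2 * h ^+ 2) ?ler_wpM2r ?sqr_ge0//.
    by rewrite /h; ring.
  have : `|\int[P]_w (U2 t w - U2 r w - h * U r w)| <= q ^+ 3 + (q ^+ 3)^-1 * (12 * q ^+ 6).
    apply: (norm_mean_le iX _ B); apply: filterS Hstep => w [j [j0 jQ _ _ +]].
    rewrite rE => /le_trans; apply.
    have : j ^+ 2 / q ^+ 3 <= Q w / q ^+ 3 by rewrite ler_wpM2r// invr_ge0 ltW.
    have : j * 2 <= q ^+ 3 + j ^+ 2 / q ^+ 3.
      rewrite -(ler_pM2r q3) mulrDl divfK ?gt_eqF//.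
      by have := sqr_ge0 (q ^+ 3 - j); lra.
    by have : 0 <= Q w / q ^+ 3 by [rewrite divr_ge0// ltW]; lra.
  rewrite E normrN normrM (gtr0_norm h0).
  have -> : q ^+ 3 + (q ^+ 3)^-1 * (12 * q ^+ 6) = h * (13 * q).
    by rewrite /h; field; exact: lt0r_neq0.
  by rewrite ler_pM2l.
have continuity : `|\int[P]_w (U t w - U r w)| <= 13 * q.
  have mt := adapted_measurable hF (ltW t0) aU; have mr := adapted_measurable hF (ltW r0) aU.
  have B : mean_le P (fun w => q + q^-1 * `|U t w - U r w| ^+ 2) (q + q^-1 * (12 * q ^+ 2)).
    apply: mean_leD; first by apply: mean_le_cst; exact: ltW.
    apply: mean_leZ; first by rewrite invr_ge0 ltW.
    split.
    - by apply: measurable_funX; apply: measurableT_comp => //; exact: measurable_funB.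
    - by move=> w; exact: sqr_ge0.
    - have := velocity_increment_sqr hF hW aU (sl_continuous sl2) (sl_velocity sl2)
        (ltW r0) (ltW h0) rhT.
      by rewrite rE => /le_trans; apply; rewrite lee_fin.
  have -> : 13 * q = q + q^-1 * (12 * q ^+ 2) by field; exact: lt0r_neq0.
  apply: (norm_mean_le (integrable_EFinB iUt iUr) _ B); apply: aeW => w.
  move: `|_ - _| (normr_ge0 (U t w - U r w)) => y y0.
  have : y * 2 <= q + q^-1 * y ^+ 2.
    rewrite [q^-1 * _]mulrC -(ler_pM2r q0) mulrDl divfK ?gt_eqF//.
    by have := sqr_ge0 (q - y); lra.
  by have : 0 <= q^-1 * y ^+ 2 by [rewrite mulr_ge0 ?sqr_ge0// invr_ge0 ltW]; lra.
move: continuity; rewrite RintegralB//.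
move: velocity_r; set a := Rintegral _ _ _; set b := Rintegral _ _ _ => A B.
have := ler_normD (b - a) a; rewrite subrK; lra.
Qed.

End mean_velocity.

Lemma Rintegral_ae_cst {d : measure_display} {T : measurableType d} {R : realType}
    (P : probability T R) (X : T -> R) (c : R) :
  measurable_fun setT X -> {ae P, forall w, X w = c} -> \int[P]_w X w = c.
Proof.
move=> mX Xc; rewrite /Rintegral.
have -> : (\int[P]_w (X w)%:E = \int[P]_w c%:E)%E.
  apply: ae_eq_integral => //; first exact/measurable_EFinP.
  by apply: filterS Xc => w /= -> _.
by rewrite integral_cst//= probability_setT mule1.
Qed.

(** * The moments of the dry friction process *)

Theorem mainTheorem2 (R : realType) (d : measure_display)
  (T : measurableType d) (P : probability T R)
  (F : R -> set (set T)) (W U1 U2 U3 : R -> T -> R) (tau0 : R)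
  (tau0_gt0 : 0 < tau0)
  (hF : filtration F)
  (hW : wiener_process P F W)
  (hU : dry_friction_process P tau0 F W U1 U2 U3)
  (tau : R) (tau_ge0 : 0 <= tau) (tau_le : tau <= tau0) :
  [/\ 'E_P[U1 tau] = 0%:E,
      'E_P[U2 tau] = 0%:E &
      'E_P[U3 tau] =
        (1 / 8 *
         (2 * (1 + 2 * tau) * Num.sqrt (tau / pi) * expR (- tau)
          - 4 * tau ^+ 2 * Erfc (Num.sqrt tau)
          + (4 * tau - 1) * Erf (Num.sqrt tau)))%:E]%E
  /\
  [/\ 'V_P[U1 tau] =
        (1 / 2 *
         (Erf (Num.sqrt tau)
          + 4 * tau * (tau + 1) * Erfc (Num.sqrt tau)
          - 2 * (1 + 2 * tau) * Num.sqrt (tau / pi) * expR (- tau)))%:E,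
      'V_P[U2 tau] =
        (5 / 8 * tau - 27 / 32
         + expR (- tau) *
           (1 - Num.sqrt (tau / pi) *
                (1 / 2 * tau ^+ 3 + 7 / 12 * tau ^+ 2 - 13 / 24 * tau + 5 / 16))
         + Erfc (Num.sqrt tau) *
           (1 / 2 * tau ^+ 4 + 5 / 6 * tau ^+ 3 - 1 / 2 * tau ^+ 2
            + 3 / 8 * tau - 5 / 32))%:E &
      'V_P[U3 tau] =
        (1 / 4 * tau ^+ 2 + 1 / 8 * tau - 11 / 32
         + expR (- tau) *
           (1 / 2 - Num.sqrt (tau / pi) *
                (1 / 2 * tau ^+ 3 + 7 / 12 * tau ^+ 2 - 13 / 24 * tau + 5 / 16))
         + Erfc (Num.sqrt tau) *
           (1 / 2 * tau ^+ 4 + 5 / 6 * tau ^+ 3 - 1 / 2 * tau ^+ 2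
            + 3 / 8 * tau - 5 / 32)
         - (fine 'E_P[U3 tau]) ^+ 2)%:E]%E.
Proof.
have [[aU1 aU2 aU3] cU init vel dis dist] := hU.
have sl2 : sliding P F W tau0 id U1 U2.
  by split => //; apply: filterS init => w [].
have sl3 : sliding P F W tau0 (fun u => `|u|) U1 U3.
  by split => //; apply: filterS init => w [].
have [[i1 i2 i3] [j1 j2 j3]] := integrable_components sl2 sl3 tau_ge0 tau_le.
rewrite !expectation_Rintegral// !variance_Rintegral// [fine _]/=.
pose u3 : R := 1 / 8 * (2 * (1 + 2 * tau) * Num.sqrt (tau / pi) * expR (- tau)
  - 4 * tau ^+ 2 * Erfc (Num.sqrt tau) + (4 * tau - 1) * Erf (Num.sqrt tau)).
pose s2 : R := 5 / 8 * tau - 27 / 32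
  + expR (- tau) * (1 - Num.sqrt (tau / pi) *
      (1 / 2 * tau ^+ 3 + 7 / 12 * tau ^+ 2 - 13 / 24 * tau + 5 / 16))
  + Erfc (Num.sqrt tau) *
      (1 / 2 * tau ^+ 4 + 5 / 6 * tau ^+ 3 - 1 / 2 * tau ^+ 2 + 3 / 8 * tau - 5 / 32).
pose s3 : R := 1 / 4 * tau ^+ 2 + 1 / 8 * tau - 11 / 32
  + expR (- tau) * (1 / 2 - Num.sqrt (tau / pi) *
      (1 / 2 * tau ^+ 3 + 7 / 12 * tau ^+ 2 - 13 / 24 * tau + 5 / 16))
  + Erfc (Num.sqrt tau) *
      (1 / 2 * tau ^+ 4 + 5 / 6 * tau ^+ 3 - 1 / 2 * tau ^+ 2 + 3 / 8 * tau - 5 / 32).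
suff [[m1 m2 m3] [q1 q2 q3]] : [/\ \int[P]_w U1 tau w = 0, \int[P]_w U2 tau w = 0 &
      \int[P]_w U3 tau w = u3] /\
    [/\ \int[P]_w (U1 tau w ^+ 2) = 2 * tau - 4 * u3,
      \int[P]_w (U2 tau w ^+ 2) = s2 & \int[P]_w (U3 tau w ^+ 2) = s3].
  rewrite m1 m2 m3 q1 q2 q3; split; split => //; congr EFin.
  - by rewrite /u3 /Erfc; field.
  - by rewrite expr0n subr0.
case: (ltgtP tau 0) tau_ge0 => // [tau_gt0|tau0'] _.
- have m3 : \int[P]_w U3 tau w = u3.
    apply: (@mulfI _ 16); first by rewrite pnatr_eq0.
    by rewrite (mean_distance sl2 sl3)// even_form1_at0.
  split; split => //.
  + exact: (mean_velocity sl2 sl3).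
  + exact: (mean_displacement sl2 sl3).
  + by rewrite (velocity_second_moment sl2 sl3)// m3.
  + apply: (@mulfI _ 768); first by rewrite pnatr_eq0.
    by rewrite (displacement_sqr sl2 sl3)// odd_form2_at0.
  + apply: (@mulfI _ 768); first by rewrite pnatr_eq0.
    by rewrite (distance_sqr sl2 sl3)// even_form2_at0.
- have u30 : u3 = 0.
    by rewrite /u3 tau0' mul0r sqrtr0 Erf0 !(mulr0, mul0r, expr0n) /=; ring.
  have s20 : s2 = 0.
    by rewrite /s2 tau0' mul0r sqrtr0 oppr0 expR0 Erfc0 !(mulr0, mul0r, expr0n) /=; field.
  have s30 : s3 = 0.
    by rewrite /s3 tau0' mul0r sqrtr0 oppr0 expR0 Erfc0 !(mulr0, mul0r, expr0n) /=; field.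
  have hF' := sl_filtration sl2.
  have mU1 := adapted_measurable hF' (lexx 0) aU1.
  have mU2 := adapted_measurable hF' (lexx 0) aU2.
  have mU3 := adapted_measurable hF' (lexx 0) aU3.
  rewrite u30 s20 s30 tau0' !mulr0 subr0.
  split; split; apply: Rintegral_ae_cst; try exact: measurable_funX; try by [];
    by apply: filterS init => w [w1 w2 w3]; rewrite ?w1 ?w2 ?w3 ?expr0n.
Qed.
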